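(* Let $\dot{\mathfrak g}$ be the simple complex Lie algebra of type $E_6$ with Chevalley generators $e_i,f_i$ ($1\le i\le6$), simple roots labelled as in Bourbaki, and highest root $\theta$. Let $e_{-\theta}=[f_2f_4f_5f_3f_4f_2f_6f_5f_4f_3f_1]$ and $\omega=e^{2\pi i/3}$. For a suitably normalized root vector $e_\theta$ of root $\theta$, the formulas $$\sigma_0(e_1)=e_6,\ \sigma_0(e_2)=e_3,\ \sigma_0(e_3)=e_5,\ \sigma_0(e_4)=e_4,\ \sigma_0(e_5)=e_2,\ \sigma_0(e_6)=e_{-\theta},$$ $$\sigma_0(f_1)=f_6,\ \sigma_0(f_2)=f_3,\ \sigma_0(f_3)=f_5,\ \sigma_0(f_4)=f_4,\ \sigma_0(f_5)=f_2,\ \sigma_0(f_6)=e_{\theta}$$ define an automorphism $\sigma_0$ of $\dot{\mathfrak g}$ of order 3. Let $\sigma_1$ be the automorphism with $\sigma_1(e_i)=e_i$, $\sigma_1(f_i)=f_i$ for $i\neq1,6$ and $\sigma_1(e_i)=\omega e_i$, $\sigma_1(f_i)=\omega^2f_i$ for $i=1,6$. Then $\sigma_0,\sigma_1$ commute; $\dot{\mathfrak g}_{(\overline0,\overline0)}$ is the simple Lie algebra of type $G_2$; each of the 8 spaces $\dot{\mathfrak g}_{(\overline i,\overline j)}$, $0\le i,j\le2$, $(i,j)\ne(0,0)$, is the direct sum of the irreducible 7-dimensional representation and a 1-dimensional trivial representation of $G_2$; and the set $R$ of non-isotropic roots of the twisted 2-toroidal Lie algebra $\mathfrak g(\sigma_0,\sigma_1)$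 is the extended affine root system $G_2^{(3,3)}$: $$R=\{\alpha+m\delta_0+n\delta_1\mid\alpha\in R(G_2)\text{ short},\ m,n\in\mathbb Z\}\cup\{\alpha+3m\delta_0+3n\delta_1\mid\alpha\in R(G_2)\text{ long},\ m,n\in\mathbb Z\},$$ where $R(G_2)$ is the root system of $\dot{\mathfrak g}_{(\overline0,\overline0)}$ with respect to its Cartan subalgebra $\dot{\mathfrak h}_{\overline0}$.
   Context: Bourbaki labelling of $E_6$: the Dynkin diagram is the chain $1-3-4-5-6$ with node $2$ attached to node $4$. The notation $[ab\cdots cd]$ means the iterated bracket $[a,[b,\dots,[c,d]\dots]]$. Work over $\mathbb C$. Let $\dot{\mathfrak g}$ be a simple finite-dimensional Lie algebra with Killing form $(\cdot,\cdot)$, and $\sigma_0,\sigma_1$ commuting automorphisms of finite orders $n_0,n_1$ (order 1 allowed). Put $\epsilon_j=\exp(2\pi i/n_j)$ and, for $p,q\in\mathbb Z$, $\dot{\mathfrak g}_{(\overline p,\overline q)}=\{g\in\dot{\mathfrak g}\mid\sigma_0(g)=\epsilon_0^p g,\ \sigma_1(g)=\epsilon_1^q g\}$, where $\overline p=p \bmod n_0$, $\overline q=q\bmod n_1$. Let $\mathcal R=\mathbb C[t_0^{\pm1},t_1^{\pm1}]$, $\mathcal K=\Omega^1_{\mathcal R}/d\mathcal R$, $k_i=t_i^{-1}dt_i$, and let $\mathcal K(\Sigma)\subset\mathcal K$ be spanned by the elements $t_0^{n_0a}t_1^{n_1b}k_i$ ($a,b\in\mathbb Z$, $i=0,1$).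 The twisted 2-toroidal Lie algebra is $$\mathfrak g(\sigma_0,\sigma_1)=\bigoplus_{m,n\in\mathbb Z}\dot{\mathfrak g}_{(\overline m,\overline n)}\otimes t_0^mt_1^n\ \oplus\ \mathcal K(\Sigma)\ \oplus\ \mathbb Cd_0\oplus\mathbb Cd_1,$$ with bracket $[g_1\otimes f_1,g_2\otimes f_2]=[g_1,g_2]\otimes f_1f_2+(g_1,g_2)f_2\,df_1$; $\mathcal K(\Sigma)$ commutes with itself and with all $g\otimes f$; $d_j=t_j\partial/\partial t_j$ acts by $[d_j,g\otimes t_0^{r_0}t_1^{r_1}]=r_j\,g\otimes t_0^{r_0}t_1^{r_1}$, $[d_j,t_0^{r_0}t_1^{r_1}k_i]=r_j\,t_0^{r_0}t_1^{r_1}k_i$; and $[d_0,d_1]=0$. Let $\dot{\mathfrak h}_{\overline 0}$ be a Cartan subalgebra of the reductive algebra $\dot{\mathfrak g}_{(\overline 0,\overline 0)}$ and $\mathfrak h=\dot{\mathfrak h}_{\overline 0}\oplus\mathbb Cd_0\oplus\mathbb Cd_1\oplus\mathbb Ck_0\oplus\mathbb Ck_1$. Elements of $\dot{\mathfrak h}_{\overline 0}^*$ are extended to $\mathfrak h$ by $0$ on all $d_i,k_i$; $\delta_i\in\mathfrak h^*$ is defined by $\delta_i(d_j)=\delta_{ij}$ and zero on $\dot{\mathfrak h}_{\overline 0}$ and all $k_j$. Let $V=\dot{\mathfrak h}_{\overline 0}^*\oplus\mathbb C\delta_0\oplus\mathbb C\delta_1$ with the bilinear form $(\cdot,\cdot)_V$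 which on $\dot{\mathfrak h}_{\overline 0}^*$ is dual to the restriction of the Killing form to $\dot{\mathfrak h}_{\overline 0}$ and has $\delta_0,\delta_1$ in its radical. Then $R$ is the set of $\beta\in V$ with $(\beta,\beta)_V\ne0$ whose weight space in $\mathfrak g(\sigma_0,\sigma_1)$ under the adjoint action of $\mathfrak h$ is nonzero. *)

(* Defs.v *)
(* The field of complex numbers is R[i], for R : realType. *)
From HB Require Import structures.
From mathcomp Require Import all_boot all_order all_algebra.
From mathcomp Require Import ring_quotient complex.
From mathcomp Require Import all_classical all_reals all_analysis.

Set Implicit Arguments.
Unset Strict Implicit.
Unset Printing Implicit Defensive.

Import Order.TTheory GRing.Theory Num.Theory.
Import passmx.

Local Open Scope classical_set_scope.
Local Open Scope ring_scope.
Local Open Scope quotient_scope.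

HB.mixin Record isLie (K : fieldType) L of Vector K L := {
  lie : L -> L -> L;
  lie_linear_l : forall y, linear (lie^~ y);
  lie_linear_r : forall x, linear (lie x);
  liexx : forall x, lie x x = 0;
  lie_jacobi : forall x y z,
    lie x (lie y z) + lie y (lie z x) + lie z (lie x y) = 0
}.

#[short(type="finLieType")]
HB.structure Definition FinLie (K : fieldType) := {L of Vector K L & isLie K L}.

Notation "[ 'lie' x , y ]" := (lie x y) (format "[ 'lie'  x ,  y ]").

(* [lie_nest [:: a1; a2; ..; ak] b] is [a1,[a2,..,[ak,b]..]] *)
Definition lie_nest (K : fieldType) (L : finLieType K) (s : seq L) (b : L) : L :=
  foldr (fun a c => [lie a, c]) b s.

Section LieAlgebra.
Context {K : fieldType} {L : finLieType K}.
Implicit Types (U H I M W : {vspace L}).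

HB.instance Definition _ (x : L) :=
  GRing.isLinear.Build K L L *:%R (lie x) (lie_linear_r x).

Definition ad (x : L) : 'End(L) := linfun (lie x).

Definition killing (x y : L) : K :=
  \tr (mxof (vbasis {:L}) (vbasis {:L}) (ad x \o ad y)%VF).

Definition subalgebra U := forall x y, x \in U -> y \in U -> [lie x, y] \in U.

Definition lie_ideal U I :=
  (I <= U)%VS /\ forall x y, x \in U -> y \in I -> [lie x, y] \in I.

Definition simple_lie U :=
  [/\ subalgebra U,
      exists x y, [/\ x \in U, y \in U & [lie x, y] != 0] &
      forall I, lie_ideal U I -> I = 0%VS \/ I = U].

(* Chevalley generators of U for the Cartan matrix A, with
   h_i = [e_i, f_i] and the convention [h_i, e_j] = A_ij e_j. *)
Record chevalley_generators n (A : 'M[int]_n) U (e f : 'I_n -> L) : Prop :=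
  ChevalleyGenerators {
    chevalley_mem : forall i, e i \in U /\ f i \in U;
    chevalley_hh : forall i j, [lie [lie e i, f i], [lie e j, f j]] = 0;
    chevalley_ef : forall i j, i != j -> [lie e i, f j] = 0;
    chevalley_he : forall i j,
      [lie [lie e i, f i], e j] = (A i j)%:~R *: e j;
    chevalley_hf : forall i j,
      [lie [lie e i, f i], f j] = - (A i j)%:~R *: f j;
    chevalley_serre_e : forall i j, i != j ->
      iter `|1 - A i j|%N (lie (e i)) (e j) = 0;
    chevalley_serre_f : forall i j, i != j ->
      iter `|1 - A i j|%N (lie (f i)) (f j) = 0;
    chevalley_gen : forall W, subalgebra W ->
      (forall i, e i \in W /\ f i \in W) -> (U <= W)%VS }.

Definition simple_of_type n (A : 'M[int]_n) U :=
  simple_lie U /\ exists e f : 'I_n -> L, chevalley_generators A U e f.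

Definition chevalley_cartan n (e f : 'I_n -> L) : {vspace L} :=
  <<[seq [lie e i, f i] | i <- enum 'I_n]>>%VS.

Definition lie_prod U W : {vspace L} :=
  <<[seq [lie x, y] | x <- vbasis U, y <- vbasis W]>>%VS.

Definition nilpotent_lie H := exists n, iter n (lie_prod H) H = 0%VS.

(* Cartan subalgebra: nilpotent and self-normalizing *)
Definition cartan_subalgebra U H :=
  [/\ (H <= U)%VS, subalgebra H, nilpotent_lie H &
      forall x, x \in U -> (forall h, h \in H -> [lie x, h] \in H) -> x \in H].

Definition dual H := 'Hom(subvs_of H, K^o).

Definition weight_vector H (a : dual H) (x : L) :=
  forall h : subvs_of H, [lie vsval h, x] = (a h : K) *: x.

Definition roots U H : set (dual H) :=
  [set a | a != 0 /\ exists x, [/\ x \in U, x != 0 & weight_vector a x]].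

Definition highest_root H n (alpha : 'I_n -> dual H) (theta : dual H) :=
  roots {:L} theta /\
  forall b : dual H, roots {:L} b ->
    exists c : 'I_n -> nat, theta - b = \sum_i alpha i *+ c i.

(* When the restriction of the Killing form to H is nondegenerate,
   [dual_vector a] is the unique t in H such that (t, h) = a(h) on H. *)
Definition dual_vector H (a : dual H) : L :=
  xget 0 [set t : L | t \in H /\
    forall h : subvs_of H, killing t (vsval h) = a h].

Definition dual_form H (a b : dual H) : K :=
  killing (dual_vector a) (dual_vector b).

Definition lie_automorphism (s : 'End(L)) :=
  bijective s /\ forall x y, s [lie x, y] = [lie s x, s y].

Definition automorphism_order (s : 'End(L)) (n : nat) :=
  [/\ (0 < n)%N, forall x, iter n s x = x &
      forall m, (0 < m < n)%N -> exists x, iter m s x != x].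

Definition submodule U M := forall x v, x \in U -> v \in M -> [lie x, v] \in M.

Definition irreducible_module U M :=
  [/\ M != 0%VS, submodule U M &
      forall W, (W <= M)%VS -> submodule U W -> W = 0%VS \/ W = M].

Definition irr7_plus_trivial U M :=
  exists V7 V1 : {vspace L},
    [/\ (V7 + V1)%VS = M, (V7 :&: V1)%VS = 0%VS,
        \dim V7 = 7%N /\ irreducible_module U V7, \dim V1 = 1%N &
        forall x v, x \in U -> v \in V1 -> [lie x, v] = 0].

End LieAlgebra.
Arguments roots {K L} U H _.

(* [laurent W] is W (x) K[t_0^{+-1}, t_1^{+-1}]: finitely supported families
   of elements of W, the value at r being the coefficient of
   t^r = t_0^(r 0 0) t_1^(r 0 1). *)
Section Laurent.
Context {K : fieldType} {W : lmodType K}.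

Definition fin_supp : pred ('rV[int]_2 -> W) :=
  fun x => `[< finite_set [set r | x r != 0] >].

Record laurent := Laurent {
  coeff :> 'rV[int]_2 -> W;
  laurent_fin_supp : coeff \in fin_supp }.

HB.instance Definition _ := [isSub for coeff].
HB.instance Definition _ := [Choice of laurent by <:].

Lemma fin_suppP (x : 'rV[int]_2 -> W) :
  reflect (finite_set [set r | x r != 0]) (x \in fin_supp).
Proof. exact: asboolP. Qed.

Lemma fin_supp_submod : submod_closed fin_supp.
Proof.
split=> [|a x y /fin_suppP fx /fin_suppP fy]; apply/fin_suppP.
  rewrite (_ : [set _ | _] = set0)//; apply/seteqP; split=> // r /=.
  by rewrite eqxx.
have fxy : finite_set ([set r | x r != 0] `|` [set r | y r != 0]).
  by rewrite finite_setU.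
apply: sub_finite_set fxy => r /= nz; have [x0|xn0] := eqVneq (x r) 0;
  last by left.
right; apply: contra_neq nz => y0; rewrite -[LHS]/(a *: x r + y r).
by rewrite x0 y0 scaler0 addr0.
Qed.

HB.instance Definition _ :=
  GRing.isSubmodClosed.Build K ('rV[int]_2 -> W) fin_supp fin_supp_submod.
HB.instance Definition _ := [SubChoice_isSubLmodule of laurent by <:].

Lemma fin_supp_mono r w :
  (fun s : 'rV[int]_2 => if s == r then w else 0 : W) \in fin_supp.
Proof.
apply/fin_suppP; apply: (@sub_finite_set _ _ [set r]) => // s /=.
by case: (eqVneq s r) => // _; rewrite eqxx.
Qed.

(* w (x) t^r *)
Definition mono r w : laurent := Laurent (fin_supp_mono r w).

Lemma fin_supp_degree (j : 'I_2) (x : laurent) :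
  (fun r : 'rV[int]_2 => (r 0 j)%:~R *: x r) \in fin_supp.
Proof.
apply/fin_suppP; move/fin_suppP: (laurent_fin_supp x); apply: sub_finite_set.
by move=> r /=; apply: contraNneq => ->; rewrite scaler0.
Qed.

(* the derivation d_j = t_j d/dt_j, acting coefficientwise *)
Definition degree_der (j : 'I_2) (x : laurent) : laurent :=
  Laurent (fin_supp_degree j x).

End Laurent.
Arguments laurent {K} W.
Arguments fin_supp {K} W.

(* A differential form is stored as its coordinates in the basis
   k_i = t_i^{-1} dt_i of the free module of 1-forms: the i-th coordinate of
   [w r] is the coefficient of t^r k_i. *)
Section Kaehler.
Context {K : fieldType}.
Local Notation omega := (laurent 'rV[K]_2).

Lemma fin_supp_differential (f : laurent K^o) :
  (fun r : 'rV[int]_2 => (f r : K) *: map_mx intr r) \in fin_supp 'rV[K]_2.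
Proof.
apply/fin_suppP; move/fin_suppP: (laurent_fin_supp f); apply: sub_finite_set.
by move=> r /=; apply: contraNneq => ->; rewrite scale0r.
Qed.

(* d t^r = r_0 t^r k_0 + r_1 t^r k_1 *)
Definition differential f : omega := Laurent (fin_supp_differential f).

Lemma differential_linear : linear differential.
Proof.
move=> a f g; apply/val_inj/funext => r /=.
by rewrite -[LHS]/((a * f r + g r) *: _) scalerDl -scalerA.
Qed.

Definition exact_form : pred omega :=
  fun w => `[< exists f, w = differential f >].

Lemma exact_formP w :
  reflect (exists f, w = differential f) (w \in exact_form).
Proof. exact: asboolP. Qed.

Lemma exact_form_scale (a : K) w : w \in exact_form -> a *: w \in exact_form.
Proof.
case/exact_formP=> f ->; apply/exact_formP; exists (a *: f).
have d0 : differential 0 = 0.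
  by apply/val_inj/funext => r /=; rewrite scale0r.
by have := differential_linear a f 0; rewrite d0 !addr0.
Qed.

Lemma exact_form_zmod : zmod_closed exact_form.
Proof.
split; first by apply/exact_formP; exists 0; apply/val_inj/funext => r /=;
  rewrite scale0r.
move=> _ _ /exact_formP[f ->] /exact_formP[g ->]; apply/exact_formP.
exists (f - g); apply/val_inj/funext => r /=.
by rewrite -[RHS]/((f r - g r) *: _) scalerBl.
Qed.

HB.instance Definition _ :=
  GRing.isZmodClosed.Build omega exact_form exact_form_zmod.

Definition kaehler := {ideal_quot (GRing.ZmodClosed.clone omega exact_form _)}.
HB.instance Definition _ := GRing.Zmodule.on kaehler.

Definition class_of (w : omega) : kaehler := \pi_kaehler w.

Lemma class_of_eq u v : (class_of u = class_of v) <-> (u - v \in exact_form).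
Proof.
rewrite /class_of; split=> [/eqP|uv].
  by rewrite eqmodE.
by apply/eqP; rewrite eqmodE.
Qed.

Lemma class_of_repr z : class_of (repr z) = z.
Proof. exact: reprK. Qed.

Lemma class_ofD u v : class_of (u + v) = class_of u + class_of v.
Proof. exact: raddfD. Qed.

Definition kaehler_scale (a : K) (z : kaehler) : kaehler :=
  class_of (a *: repr z).

Lemma class_ofZ a w : class_of (a *: w) = kaehler_scale a (class_of w).
Proof.
apply/class_of_eq; rewrite -scalerBr; apply: exact_form_scale.
by apply/class_of_eq; rewrite class_of_repr.
Qed.

Fact kaehler_scaleA a b z :
  kaehler_scale a (kaehler_scale b z) = kaehler_scale (a * b) z.
Proof. by rewrite -[z]class_of_repr -!class_ofZ scalerA. Qed.

Fact kaehler_scale1 : left_id 1 kaehler_scale.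
Proof. by move=> z; rewrite -[z]class_of_repr -class_ofZ scale1r. Qed.

Fact kaehler_scaleDr : right_distributive kaehler_scale +%R.
Proof.
move=> a y z; rewrite -[y]class_of_repr -[z]class_of_repr -class_ofD.
by rewrite -!class_ofZ scalerDr class_ofD.
Qed.

Fact kaehler_scaleDl z : {morph kaehler_scale^~ z : a b / a + b}.
Proof.
by move=> a b; rewrite -[z]class_of_repr -!class_ofZ scalerDl class_ofD.
Qed.

HB.instance Definition _ := GRing.Zmodule_isLmodule.Build K kaehler
  kaehler_scaleA kaehler_scale1 kaehler_scaleDr kaehler_scaleDl.

Definition kaehler_der j (z : kaehler) : kaehler :=
  class_of (degree_der j (repr z)).

Lemma degree_der_differential j f :
  degree_der j (differential f) = differential (degree_der j f).
Proof. by apply/val_inj/funext => r /=; rewrite scalerA. Qed.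

Lemma kaehler_der_class j w :
  kaehler_der j (class_of w) = class_of (degree_der j w).
Proof.
apply/class_of_eq.
have derB u v : degree_der j u - degree_der j v = degree_der j (u - v).
  by apply/val_inj/funext => r /=; rewrite -[RHS]/(_ *: (u r - v r)) scalerBr.
have /exact_formP[f fE] : repr (class_of w) - w \in exact_form.
  by apply/class_of_eq; rewrite class_of_repr.
rewrite derB fE degree_der_differential; apply/exact_formP.
by exists (degree_der j f).
Qed.

(* t^r k_i *)
Definition tk r i : kaehler := class_of (mono r (delta_mx 0 i)).

(* span of the t_0^{n0 a} t_1^{n1 b} k_i *)
Definition kaehler_sigma (n0 n1 : nat) : set kaehler :=
  [set z | exists (m : nat) (c : 'I_m -> K) (r : 'I_m -> 'rV[int]_2)
             (i : 'I_m -> 'I_2),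
     (forall l, (n0 %| (r l 0 0)%R)%Z /\ (n1 %| (r l 0 1)%R)%Z) /\
     z = \sum_l c l *: tk (r l) (i l)].

End Kaehler.
Arguments kaehler K : clear implicits.

(* The untwisted algebra L (x) K[t^{+-1}] + kaehler + K d_0 + K d_1; the last
   component is the row of coefficients of d_0, d_1. *)
Section Toroidal.
Context {K : fieldType} {L : finLieType K}.

Definition toroidal : Type := (laurent L * kaehler K * 'rV[K]_2)%type.

Lemma fin_supp_convol (W : lmodType K)
    (F : 'rV[int]_2 -> L -> L -> W) (x y : laurent L) :
  (forall r u, F r 0 u = 0) -> (forall r u, F r u 0 = 0) ->
  (fun s => \sum_(r \in [set: 'rV[int]_2]) F r (x r) (y (s - r)))
    \in fin_supp W.
Proof.
move=> F0l F0r; apply/fin_suppP.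
have fx := fin_suppP _ (laurent_fin_supp x).
have fy := fin_suppP _ (laurent_fin_supp y).
apply: (sub_finite_set _ (finite_image2 (fun r s => r + s) fx fy)) => s /= nz.
have [r _ Frs] := @fsbigN1 W 0 +%R _ _ setT
  (fun s r => F r (x r) (y (s - r))) s nz.
exists r; first by apply: contraNneq Frs => ->; rewrite F0l.
exists (s - r); first by apply: contraNneq Frs => ->; rewrite F0r.
by rewrite addrC subrK.
Qed.

Lemma lie0x (x : L) : [lie 0, x] = 0.
Proof.
have := lie_linear_l x 1 0 0; rewrite !scale1r !addr0 => /esym/eqP.
by rewrite -subr_eq0 addrK => /eqP.
Qed.

Lemma liex0 (x : L) : [lie x, 0] = 0.
Proof. exact: linear0. Qed.

Lemma ad0 : ad (0 : L) = 0.
Proof. by apply/lfunP => x; rewrite !lfunE /= lie0x. Qed.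

Lemma killing0x (x : L) : killing 0 x = 0.
Proof. by rewrite /killing ad0 comp_lfun0l !linear0. Qed.

Lemma killingx0 (x : L) : killing x 0 = 0.
Proof. by rewrite /killing ad0 comp_lfun0r !linear0. Qed.

(* [g1 (x) t^r, g2 (x) t^s] has loop part [g1, g2] (x) t^(r+s) *)
Definition loop_bracket (x y : laurent L) : laurent L :=
  Laurent (@fin_supp_convol L (fun _ u v => [lie u, v]) x y
    (fun _ => @lie0x) (fun _ => @liex0)).

Fact cocycle_l r (v : L) : killing 0 v *: (map_mx intr r : 'rV[K]_2) = 0.
Proof. by rewrite killing0x scale0r. Qed.

Fact cocycle_r r (u : L) : killing u 0 *: (map_mx intr r : 'rV[K]_2) = 0.
Proof. by rewrite killingx0 scale0r. Qed.

(* ... and central part (g1, g2) t^s d(t^r)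
   = (g1, g2) (r_0 t^(r+s) k_0 + r_1 t^(r+s) k_1) *)
Definition cocycle (x y : laurent L) : kaehler K :=
  class_of (Laurent (@fin_supp_convol 'rV[K]_2
    (fun r u v => killing u v *: map_mx intr r) x y cocycle_l cocycle_r)).

Definition toroidal_bracket (X Y : toroidal) : toroidal :=
  let: (x, z, a) := X in let: (y, w, b) := Y in
  (loop_bracket x y
     + \sum_j (a 0 j *: degree_der j y - b 0 j *: degree_der j x),
   cocycle x y
     + \sum_j (a 0 j *: kaehler_der j w - b 0 j *: kaehler_der j z),
   0).

(* h (x) 1 + a_0 d_0 + a_1 d_1 + b_0 k_0 + b_1 k_1 *)
Definition toroidal_cartan (h : L) (a b : 'rV[K]_2) : toroidal :=
  (mono 0 h, class_of (mono 0 b), a).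

End Toroidal.
Arguments toroidal {K} L.

(* V = H^* + K delta_0 + K delta_1 *)
Section RootSpace.
Context {K : fieldType} {L : finLieType K}.

Definition ext_dual (H : {vspace L}) : Type := (dual H * 'rV[K]_2)%type.

Variable H : {vspace L}.

Definition ext_of (a : dual H) : ext_dual H := (a, 0).

Definition delta (j : 'I_2) : ext_dual H := (0, delta_mx 0 j).

Definition ext_form (b c : ext_dual H) : K := dual_form b.1 c.1.

(* value of b at h + a_0 d_0 + a_1 d_1 + (any combination of k_0, k_1) *)
Definition ext_eval (b : ext_dual H) (h : subvs_of H) (a : 'rV[K]_2) : K :=
  (b.1 h : K) + \sum_j a 0 j * b.2 0 j.

End RootSpace.

Section Twisted.
Context {R : realType}.
Local Notation C := (R[i]).

(* exp(2 pi i / n) *)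
Definition root_unity (n : nat) : C :=
  (cos (2 * pi / n%:R) +i* sin (2 * pi / n%:R))%C.

Context {L : finLieType C}.
Variables (s0 s1 : 'End(L)) (n0 n1 : nat).

Definition graded (p q : int) : {vspace L} :=
  (leigenspace s0 (root_unity n0 ^ p)
     :&: leigenspace s1 (root_unity n1 ^ q))%VS.

Lemma mem_graded p q x :
  (x \in graded p q) =
  (s0 x == root_unity n0 ^ p *: x) && (s1 x == root_unity n1 ^ q *: x).
Proof.
by rewrite memv_cap !memv_ker !add_lfunE !opp_lfunE !scale_lfunE !id_lfunE
           !subr_eq0.
Qed.

(* The twisted 2-toroidal Lie algebra, as a subset of the untwisted one,
   whose bracket it inherits. *)
Definition twisted_toroidal : set (toroidal L) :=
  [set X : toroidal L |
           (forall r : 'rV[int]_2, X.1.1 r \in graded (r 0 0) (r 0 1)) /\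
           kaehler_sigma n0 n1 X.1.2].

Definition nonisotropic_roots (H : {vspace L}) : set (ext_dual H) :=
  [set b : ext_dual H | ext_form b b != 0 /\
     exists X : toroidal L, [/\ twisted_toroidal X, X != 0 &
       forall (h : subvs_of H) (a k : 'rV[C]_2),
         toroidal_bracket (toroidal_cartan (vsval h) a k) X
         = ext_eval b h a *: X]].

(* On R[i], x <= y means that y - x is a nonnegative real. *)
Definition long_root (U H : {vspace L}) (a : dual H) :=
  roots U H a /\ forall b, roots U H b -> dual_form b b <= dual_form a a.

Definition short_root (U H : {vspace L}) (a : dual H) :=
  roots U H a /\ forall b, roots U H b -> dual_form a a <= dual_form b b.

(* G_2^(3,3), for the finite root system of (U, H) *)
Definition G2_33 (U H : {vspace L}) : set (ext_dual H) :=
  [set b : ext_dual H | exists (a : dual H) (m n : int), short_root U a /\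
     b = ext_of a + m%:~R *: delta H 0 + n%:~R *: delta H 1]
  `|`
  [set b : ext_dual H | exists (a : dual H) (m n : int), long_root U a /\
     b = ext_of a + (3 * m)%:~R *: delta H 0 + (3 * n)%:~R *: delta H 1].

End Twisted.
Arguments nonisotropic_roots {R L} s0 s1 n0 n1 H _.
Arguments G2_33 {R L} U H _.

(* Indices in 'I_6 start at 0: Bourbaki's node k is [inord k.-1]. *)
Definition E6_edges : seq (nat * nat) :=
  [:: (1, 3); (3, 4); (4, 5); (5, 6); (2, 4)]%N.

Definition cartan_E6 : 'M[int]_6 := \matrix_(i, j)
  if i == j then 2
  else if ((i.+1, j.+1) \in E6_edges) || ((j.+1, i.+1) \in E6_edges) then -1
  else 0.

Definition cartan_G2 : 'M[int]_2 := \matrix_(i, j)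
  if i == j then 2 else if (i < j)%N then -1 else - 3.

Section E6.
Context {R : realType} {L : finLieType R[i]}.
Variables e f : 'I_6 -> L.
Let E k := e (inord k.-1).
Let F k := f (inord k.-1).

Definition e_minus_theta : L :=
  lie_nest [:: F 2; F 4; F 5; F 3; F 4; F 2; F 6; F 5; F 4; F 3] (F 1).

Definition is_sigma0 (e_theta : L) (s : 'End(L)) :=
  [/\ lie_automorphism s,
      s (E 1) = E 6 /\ s (E 2) = E 3 /\ s (E 3) = E 5 /\ s (E 4) = E 4 /\
      s (E 5) = E 2 /\ s (E 6) = e_minus_theta &
      s (F 1) = F 6 /\ s (F 2) = F 3 /\ s (F 3) = F 5 /\ s (F 4) = F 4 /\
      s (F 5) = F 2 /\ s (F 6) = e_theta].

Definition is_sigma1 (s : 'End(L)) :=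
  let omega := root_unity 3 in
  [/\ lie_automorphism s,
      forall k, k \in [:: 2; 3; 4; 5]%N -> s (E k) = E k /\ s (F k) = F k &
      forall k, k \in [:: 1; 6]%N ->
        s (E k) = omega *: E k /\ s (F k) = omega ^+ 2 *: F k].

End E6.

(* Main.v *)
(* A simple Lie algebra with Chevalley generators of type E6 has a basis of 78 root vectors and
   coroots, with structure constants given by the Frenkel-Kac cocycle.  In this
   basis sigma0 and sigma1 are explicit matrices over Z[omega], with an explicit
   basis of common eigenvectors; its degree (0, 0) part is spanned by words in
   e_4, e_2 + e_3 + e_5 and their negatives, hence is of type G2, and every other
   degree is spanned by a copy of the imaginary split octonions and a vector
   killed by G2.

   For an arbitrary Cartan subalgebra H one uses that G2 is the algebra of
   derivations of the imaginary split octonions with the commutator product.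
   Semisimple parts of derivations are derivations, so by Engel's theorem H is the
   centralizer of its semisimple elements.  These are simultaneously diagonal in a
   basis with the multiplication table of the standard one, so an automorphism of
   the octonions conjugates H to the standard torus, and it extends to E6
   compatibly with the action of G2 and with the grading.  The roots can
   therefore be read off the weights of the standard torus: the nonzero weights of
   the octonions are the short roots of G2, so short roots occur in all degrees
   and long roots only in the degrees divisible by 3. *)
From Stdlib Require Import BinNat BinInt.
Require Import Defs.
From HB Require Import structures.
From mathcomp Require Import all_boot all_order all_algebra.
From mathcomp Require Import ring_quotient complex.
From mathcomp Require Import all_classical all_reals all_analysis.
From mathcomp Require Import ssrZ zify ring.

Set Implicit Arguments.
Unset Strict Implicit.
Unset Printing Implicit Defensive.

Import Order.TTheory GRing.Theory Num.Theory.
Local Open Scope ring_scope.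
Delimit Scope Z_scope with BZ.

(** [L] is known only through the Chevalley relations, so nothing can be computed in it before a
    bracket table has been derived. Each non-simple positive root vector is a signed bracket of a
    simple generator with an earlier root vector; the action of all generators on these vectors
    follows by induction on the index, with sl2 strings supplying the vanishing brackets, and
    commutators of the matrices of the generators then give the full table. From there on numerical
    facts are equalities of sparse vectors decided by [vm_compute] and carried to [L] by evaluation.

    The theorem quantifies over all Cartan subalgebras, and a map carrying one of them to the
    standard torus must also respect the grading of E6. Octonions provide this: a multiplicative
    matrix g acts on G2 by conjugation and on each of the eight copies of the 7-dimensional module
    directly, hence commutes with both automorphisms. Compatibility with brackets by elements of G2
    is enough, because weights and the Killing form on H depend on the action of H alone. *)

Section LieTheory.
Context {K : fieldType} {L : finLieType K}.
Implicit Types x y z : L.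

Lemma lieDr x y z : [lie x, y + z] = [lie x, y] + [lie x, z].
Proof. exact: linearD. Qed.

Lemma lieZr a x y : [lie x, a *: y] = a *: [lie x, y].
Proof. exact: linearZ. Qed.

Lemma lieNr x y : [lie x, - y] = - [lie x, y].
Proof. exact: linearN. Qed.

Lemma lieDl x y z : [lie x + y, z] = [lie x, z] + [lie y, z].
Proof. by have := lie_linear_l z 1 x y; rewrite !scale1r. Qed.

Lemma lieZl a x y : [lie a *: x, y] = a *: [lie x, y].
Proof. by have := lie_linear_l y a x 0; rewrite !addr0 lie0x addr0. Qed.

Lemma lieNl x y : [lie - x, y] = - [lie x, y].
Proof. by rewrite -scaleN1r lieZl scaleN1r. Qed.

Lemma lieC x y : [lie x, y] = - [lie y, x].
Proof.
apply/eqP; rewrite -addr_eq0; apply/eqP; have := liexx (x + y).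
by rewrite lieDl !lieDr !liexx add0r addr0.
Qed.

Lemma lie_sumr I (s : seq I) (P : pred I) F x :
  [lie x, \sum_(i <- s | P i) F i] = \sum_(i <- s | P i) [lie x, F i].
Proof. exact: linear_sum. Qed.

Lemma lie_suml I (s : seq I) (P : pred I) F x :
  [lie \sum_(i <- s | P i) F i, x] = \sum_(i <- s | P i) [lie F i, x].
Proof.
by rewrite lieC lie_sumr -sumrN; apply: eq_bigr => i _; rewrite [RHS]lieC.
Qed.

Lemma lieA x y z : [lie x, [lie y, z]] = [lie [lie x, y], z] + [lie y, [lie x, z]].
Proof.
have := lie_jacobi x y z.
rewrite [[lie z, [lie x, y]]]lieC [[lie z, x]]lieC lieNr.
by move/eqP; rewrite -addrA -opprD subr_eq0 addrC => /eqP.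
Qed.

Lemma lieAl x y z : [lie [lie x, y], z] = [lie x, [lie y, z]] - [lie y, [lie x, z]].
Proof. by rewrite lieA addrK. Qed.

Lemma linfun_lieE x y : linfun (lie x) y = [lie x, y].
Proof. by rewrite lfunE. Qed.

End LieTheory.

(** * Independence of eigenvectors, and sl2 strings *)

Section EigenIndependence.
Context {K : fieldType} {V : vectType K}.

(** Applying [D - l a] removes the term of [a] and multiplies every other term by a nonzero factor,
    so the induction hypothesis applies to the rescaled family. *)
Lemma eigen_sum0 (T : eqType) (s : seq T) (D : 'End(V)) (v : T -> V)
    (l : T -> K) :
  uniq s -> {in s &, injective l} ->
  {in s, forall t, D (v t) = l t *: v t} ->
  \sum_(t <- s) v t = 0 -> {in s, forall t, v t = 0}.
Proof.
elim: s v => [|a s IHs] v //= /andP[as_ us] linj Dv.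
rewrite big_cons => sum0.
have s0 : {in s, forall t, (l t - l a) *: v t = 0}.
  apply: (IHs (fun t => (l t - l a) *: v t)) => //.
  - by apply: sub_in2 linj => t ts; rewrite inE ts orbT.
  - by move=> t ts; rewrite linearZ /= Dv ?inE ?ts ?orbT // !scalerA mulrC.
  have : D (v a + \sum_(t <- s) v t) - l a *: (v a + \sum_(t <- s) v t) = 0.
    by rewrite sum0 linear0 scaler0 subrr.
  move=> H; rewrite -[RHS]H.
  rewrite linearD /= scalerDr Dv ?mem_head // opprD addrACA subrr add0r.
  rewrite linear_sum /= scaler_sumr -sumrB.
  apply: eq_big_seq => t ts.
  by rewrite Dv ?inE ?ts ?orbT // scalerBl.
have v0 : {in s, forall t, v t = 0}.
  move=> t ts; have /eqP := s0 t ts; rewrite scaler_eq0 subr_eq0.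
  case/orP=> [/eqP /linj eta|/eqP //].
  have ta : t = a by apply: eta; rewrite ?mem_head // inE ts orbT.
  by rewrite ta (negbTE as_) in ts.
move=> t; rewrite inE => /orP[/eqP ->|/v0 //].
by move: sum0; rewrite big_seq big1 ?addr0.
Qed.

Lemma free_eigen (n : nat) (D : 'End(V)) (v : 'I_n -> V) (l : 'I_n -> K) :
  injective l -> (forall i, D (v i) = l i *: v i) -> (forall i, v i != 0) ->
  free [seq v i | i <- enum 'I_n].
Proof.
move=> linj Dv vn0.
have -> : [seq v i | i <- enum 'I_n] = [tuple v i | i < n] by rewrite /= .
apply/freeP => k; under eq_bigr => i _ do rewrite nth_mktuple.
move=> sum0 i.
have := @eigen_sum0 _ (index_enum 'I_n) D (fun i => k i *: v i) l
  (index_enum_uniq _) (in2W linj) _ sum0 i (mem_index_enum _).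
move=> /(_ _)/eqP; rewrite scaler_eq0 (negbTE (vn0 i)) orbF => /(_ _)/eqP; apply.
by move=> t _; rewrite linearZ /= Dv !scalerA mulrC.
Qed.

End EigenIndependence.

Section Sl2.
Context {K : numFieldType} {L : finLieType K}.

(** The coefficient in [[f, w (n+1)] = (n+1)(m-n) w n] is nonzero for n > m. A nonzero vector at
    position m+1 would therefore make all later ones nonzero, with distinct eigenvalues of [h],
    against finite dimension. This is how brackets that leave the root system are shown to
    vanish. *)
Lemma sl2_raise (e f h v : L) (m : nat) :
  [lie h, e] = 2%:R *: e -> [lie e, f] = h ->
  [lie f, v] = 0 -> [lie h, v] = - m%:R *: v ->
  iter m.+1 (lie e) v = 0.
Proof.
move=> he ef fv hv; pose w n := iter n (lie e) v.
have hw n : [lie h, w n] = (n.*2%:R - m%:R) *: w n.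
  elim: n => [|n IHn]; first by rewrite sub0r.
  rewrite [w n.+1]iterS -/(w n) lieA he lieZl IHn lieZr -scalerDl.
  by congr (_ *: _); rewrite doubleS -addn2 natrD; ring.
have fw n : [lie f, w n.+1] = (n.+1%:R * (m%:R - n%:R)) *: w n.
  elim: n => [|n IHn].
    by rewrite /w /= lieA fv liex0 addr0 [[lie f, e]]lieC ef lieNl hv -scaleNr;
      congr (_ *: _); ring.
  rewrite [w n.+2]iterS -/(w n.+1) lieA IHn lieZr -[[lie e, w n]]/(w n.+1).
  rewrite [[lie f, e]]lieC ef lieNl hw -scaleNr -scalerDl; congr (_ *: _).
  by rewrite -muln2 natrM -!natr1; ring.
apply/eqP/negPn/negP => wn0.
have wn k : w (m.+1 + k)%N != 0.
  elim: k => [|k IHk]; first by rewrite addn0.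
  apply: contra_neq IHk => wk0.
  have := fw (m.+1 + k)%N; rewrite -addnS wk0 liex0 => /esym/eqP.
  rewrite scaler_eq0 mulf_eq0 pnatr_eq0 addSn /= subr_eq0 eqr_nat.
  by rewrite ltn_eqF ?ltnS ?leq_addr //= => /eqP.
(* One eigenvector more than the dimension suffices for the contradiction. *)
pose n := (\dim {:L}).+1.
have /eqP dimE : free [seq w (m.+1 + i)%N | i : 'I_n <- enum 'I_n].
  apply: (@free_eigen _ _ n (linfun (lie h)) (fun i => w (m.+1 + i)%N)
    (fun i => ((m.+1 + i)%N.*2%:R - m%:R))) => [i j /addIr/eqP|i|i].
  - by rewrite eqr_nat (inj_eq double_inj) eqn_add2l => /eqP; exact: val_inj.
  - by rewrite linfun_lieE hw.
  - exact: wn.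
have := dimvS (subvf <<[seq w (m.+1 + i)%N | i : 'I_n <- enum 'I_n]>>).
by rewrite dimE size_map size_enum_ord ltnn.
Qed.

End Sl2.

(** * The root system E6 *)

Section E6Data.
Local Open Scope nat_scope.

Definition E6_adj (i j : nat) : bool :=
  ((i.+1, j.+1) \in E6_edges) || ((j.+1, i.+1) \in E6_edges).

Definition Zsum (s : seq Z) : Z := foldr Z.add 0%BZ s.

Definition E6_bilin (m : nat -> nat -> Z) (a b : seq Z) : Z :=
  Zsum [seq Z.mul (nth 0%BZ a i) (Zsum [seq Z.mul (m i j) (nth 0%BZ b j)
    | j <- iota 0 6]) | i <- iota 0 6].

Definition E6_cartan (i j : nat) : Z :=
  if i == j then 2%BZ else if E6_adj i j then (-1)%BZ else 0%BZ.

(* The Frenkel-Kac bimultiplicative cocycle. *)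
Definition E6_eps (a b : seq Z) : Z :=
  if Z.even (E6_bilin (fun i j =>
    if (i == j) || (i < j) && E6_adj i j then 1%BZ else 0%BZ) a b)
  then 1%BZ else (-1)%BZ.

Definition E6_simple (j : nat) : seq Z := mkseq (fun i => if i == j then 1%BZ else 0%BZ) 6.

(** Ordered by height: lowering a root decreases its index, which is what the inductions use.
    Indices 0 to 5 are the simple roots and 35 is the highest root. *)
Definition E6_pos : seq (seq Z) := Eval vm_compute in map (map Z.of_nat) [::
  [:: 1; 0; 0; 0; 0; 0]; [:: 0; 1; 0; 0; 0; 0]; [:: 0; 0; 1; 0; 0; 0];
  [:: 0; 0; 0; 1; 0; 0]; [:: 0; 0; 0; 0; 1; 0]; [:: 0; 0; 0; 0; 0; 1];
  [:: 1; 0; 1; 0; 0; 0]; [:: 0; 1; 0; 1; 0; 0]; [:: 0; 0; 1; 1; 0; 0];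
  [:: 0; 0; 0; 1; 1; 0]; [:: 0; 0; 0; 0; 1; 1]; [:: 1; 0; 1; 1; 0; 0];
  [:: 0; 1; 1; 1; 0; 0]; [:: 0; 1; 0; 1; 1; 0]; [:: 0; 0; 1; 1; 1; 0];
  [:: 0; 0; 0; 1; 1; 1]; [:: 1; 1; 1; 1; 0; 0]; [:: 1; 0; 1; 1; 1; 0];
  [:: 0; 1; 1; 1; 1; 0]; [:: 0; 1; 0; 1; 1; 1]; [:: 0; 0; 1; 1; 1; 1];
  [:: 1; 1; 1; 1; 1; 0]; [:: 1; 0; 1; 1; 1; 1]; [:: 0; 1; 1; 2; 1; 0];
  [:: 0; 1; 1; 1; 1; 1]; [:: 1; 1; 1; 2; 1; 0]; [:: 1; 1; 1; 1; 1; 1];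
  [:: 0; 1; 1; 2; 1; 1]; [:: 1; 1; 2; 2; 1; 0]; [:: 1; 1; 1; 2; 1; 1];
  [:: 0; 1; 1; 2; 2; 1]; [:: 1; 1; 2; 2; 1; 1]; [:: 1; 1; 1; 2; 2; 1];
  [:: 1; 1; 2; 2; 2; 1]; [:: 1; 1; 2; 3; 2; 1]; [:: 1; 2; 2; 3; 2; 1]].

Definition E6_root (k : nat) : seq Z := nth [::] E6_pos k.

Definition E6_idx (a : seq Z) : nat := find (all2 Z.eqb a) E6_pos.

Definition vecZ_add (a b : seq Z) := [seq Z.add p.1 p.2 | p <- zip a b].

Definition vecZ_sub (a b : seq Z) := [seq Z.sub p.1 p.2 | p <- zip a b].

Definition E6_pair (j k : nat) : Z := E6_bilin E6_cartan (E6_simple j) (E6_root k).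

(* [e_j, x_beta] = c x_(beta + alpha_j) and [f_j, x_beta] = c x_(beta - alpha_j),
   for c and the index of the root given by the next two functions. *)
Definition E6_up (j k : nat) : option (Z * nat) :=
  if Z.eqb (E6_pair j k) (-1)%BZ then
    Some (E6_eps (E6_simple j) (E6_root k),
          E6_idx (vecZ_add (E6_root k) (E6_simple j)))
  else None.

Definition E6_down (j k : nat) : option (Z * nat) :=
  if Z.eqb (E6_pair j k) 1%BZ then
    let b := vecZ_sub (E6_root k) (E6_simple j) in
    Some (E6_eps (E6_simple j) b, E6_idx b)
  else None.

(** Picks one way to build a non-simple root from a lower one, which fixes the root vectors
    including their signs. No simple root can be subtracted from a simple root, where the value is a
    dummy. *)
Definition E6_parent (k : nat) : nat * (Z * nat) :=
  let i := find (fun i => isSome (E6_down i k)) (iota 0 6) in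
  (i, odflt (0%BZ, 0%N) (E6_down i k)).

(** The combinatorial content of the induction step for [[e_j, X_k]]. Let m be k raised by alpha_j,
    with parent p below m by alpha_i. For i = j this is the definition of [X_m]; for k = alpha_i it
    is skew-symmetry. Otherwise alpha_i and alpha_j are orthogonal, [X_k = c1 [e_i, X_q]], and [e_j]
    passes through [e_i]: the result is [c1 c2 [e_i, X_p] = c1 c2 s X_m], whose sign must agree with
    the cocycle. *)
Definition E6_up_ok (j k : nat) : bool :=
  match E6_up j k with
  | Some (c, m) =>
      let: (i, (s, p)) := E6_parent m in
      [&& 6 <= m, m < 36, i < 6, Z.eqb (Z.mul s s) 1%BZ &
      if i == j then (p == k) && Z.eqb s c
      else if (k < 6) && (k == i) then (p == j) && Z.eqb c (Z.opp s)
      else match E6_down i k with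
      | Some (c1, q) => [&& Z.eqb (E6_cartan j i) 0%BZ, q < k,
          E6_up i q == Some (c1, k),
          if E6_up j q is Some (c2, p') then
            (p' == p) && Z.eqb (Z.mul (Z.mul c1 c2) s) c else false &
          Z.eqb (Z.mul c1 c1) 1%BZ]
      | None => false end]
  | None => if Z.eqb (E6_pair j k) 2%BZ then k == j
            else if Z.eqb (E6_pair j k) 1%BZ then true
            else Z.eqb (E6_pair j k) 0%BZ && (k != j)
  end.

(** If k can be lowered by alpha_j, the lower root must start its string. If not, [f_j] passes
    through the [e_i] of the parent with i distinct from j, and [e_i] must annihilate whatever [f_j]
    makes of [X_p]. *)
Definition E6_down_ok (j k : nat) : bool :=
  match E6_down j k with
  | Some (c, m) => [&& m < k, 6 <= k, E6_up j m == Some (c, k),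
      E6_down j m == None, m != j, Z.eqb (E6_pair j m) (-1)%BZ &
      Z.eqb (Z.mul c c) 1%BZ]
  | None => (k < 6) ||
      let: (i, (s, p)) := E6_parent k in
      (i != j) &&
      (if E6_down j p is Some (c, q) then (q < k) && (E6_up i q == None)
       else p != j)
  end.

Definition E6_parent_ok (k : nat) : bool :=
  let: (i, (s, p)) := E6_parent k in
  [&& i < 6, p < k &
      all (fun j => Z.eqb (E6_pair j k) (Z.add (E6_cartan j i) (E6_pair j p)))
        (iota 0 6)].

Lemma E6_data_ok :
  all (fun k => ((k < 6) || E6_parent_ok k) &&
    all (fun j => E6_up_ok j k && E6_down_ok j k) (iota 0 6)) (iota 0 36).
Proof. by vm_compute. Qed.

Lemma E6_pair_simple :
  all (fun k => all (fun j => Z.eqb (E6_pair j k) (E6_cartan j k)) (iota 0 6))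
    (iota 0 6).
Proof. by vm_compute. Qed.

Lemma E6_cartan_diag j : E6_cartan j j = 2%BZ.
Proof. by rewrite /E6_cartan eqxx. Qed.

Lemma E6_down_none j k : Z.eqb (E6_pair j k) 1%BZ = false -> E6_down j k = None.
Proof. by rewrite /E6_down => ->. Qed.

Lemma E6_downE j k : Z.eqb (E6_pair j k) 1%BZ -> E6_down j k != None.
Proof. by rewrite /E6_down => ->. Qed.

Lemma E6_move_lt36 :
  all (fun k => all (fun j => (oapp (fun p : Z * nat => p.2 < 36) true (E6_up j k))
    && (oapp (fun p : Z * nat => p.2 < 36) true (E6_down j k))) (iota 0 6))
    (iota 0 36).
Proof. by vm_compute. Qed.

Lemma E6_up_lt36 j k c m : (j < 6)%N -> (k < 36)%N ->
  E6_up j k = Some (c, m) -> (m < 36)%N.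
Proof.
move=> j6 k36 E; have /allP/(_ k) := E6_move_lt36; rewrite mem_iota => /(_ k36).
by move=> /allP/(_ j); rewrite mem_iota => /(_ j6)/andP[]; rewrite E.
Qed.

Lemma E6_down_lt36 j k c m : (j < 6)%N -> (k < 36)%N ->
  E6_down j k = Some (c, m) -> (m < 36)%N.
Proof.
move=> j6 k36 E; have /allP/(_ k) := E6_move_lt36; rewrite mem_iota => /(_ k36).
by move=> /allP/(_ j); rewrite mem_iota => /(_ j6)/andP[_]; rewrite E.
Qed.

End E6Data.

Section ZtoK.
Context {K : nzRingType}.

(** The tables use binary integers for efficient reduction; [zr] carries their values to the
    ring. *)
Definition zr (z : Z) : K := (int_of_Z z)%:~R.

Lemma zrD a b : zr (Z.add a b) = zr a + zr b.
Proof. by rewrite /zr -[Z.add a b]/(a + b) !rmorphD. Qed.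

Lemma zrM a b : zr (Z.mul a b) = zr a * zr b.
Proof. by rewrite /zr -[Z.mul a b]/(a * b) !rmorphM. Qed.

Lemma zrN a : zr (Z.opp a) = - zr a.
Proof. by rewrite /zr -[Z.opp a]/(- a) !rmorphN. Qed.

Lemma zrB a b : zr (Z.sub a b) = zr a - zr b.
Proof. by rewrite -Z.add_opp_r zrD zrN. Qed.

Lemma zr0 : zr Z0 = 0. Proof. by []. Qed.
Lemma zr1 : zr 1%BZ = 1. Proof. by []. Qed.
Lemma zrN1 : zr (-1)%BZ = -1. Proof. by []. Qed.

Lemma zr2 : zr 2%BZ = 2%:R. Proof. by []. Qed.

End ZtoK.

Lemma zr_eq0 (K : numDomainType) (z : Z) : (zr z == 0 :> K) = (z == Z0).
Proof.
by rewrite /zr intr_eq0 -(inj_eq (can_inj int_of_ZK)).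
Qed.

Lemma zr_inj (K : numDomainType) : injective (@zr K).
Proof. by move=> a b /intr_inj /(can_inj int_of_ZK). Qed.

(** * Generators acting on the root vectors of the positive roots *)

Section PositiveRootVectors.
Local Opaque E6_cartan E6_pair E6_parent E6_up E6_down.
Context {K : numFieldType} {L : finLieType K}.
Variables e f : nat -> L.
Let h j := [lie e j, f j].
Hypothesis he : forall i j, (i < 6)%N -> (j < 6)%N ->
  [lie h i, e j] = zr (E6_cartan i j) *: e j.
Hypothesis ef : forall i j, (i < 6)%N -> (j < 6)%N -> i != j -> [lie e i, f j] = 0.
Hypothesis ee : forall i j, (i < 6)%N -> (j < 6)%N ->
  E6_cartan i j = Z0 -> [lie e i, e j] = 0.

Definition root_vector_step (s : seq L) (k : nat) : L :=
  if (k < 6)%N then e k else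
  let: (i, (c, p)) := E6_parent k in zr c *: [lie e i, nth 0 s p].

(** A growing list, because the parent of k is an arbitrary smaller index: this is course-of-values
    recursion. *)
Fixpoint root_vectors (n : nat) : seq L :=
  if n is m.+1 then
    rcons (root_vectors m) (root_vector_step (root_vectors m) m)
  else [::].

Definition root_vector (k : nat) : L := nth 0 (root_vectors 36) k.
Local Notation X := root_vector.

Lemma size_root_vectors n : size (root_vectors n) = n.
Proof. by elim: n => //= n IHn; rewrite size_rcons IHn. Qed.

Lemma nth_root_vectors n m k : (k < m)%N -> (m <= n)%N ->
  nth 0 (root_vectors n) k = nth 0 (root_vectors m) k.
Proof.
move=> km; elim: n => [|n IHn]; first by rewrite leqn0 => /eqP ->.
rewrite leq_eqVlt => /orP[/eqP -> //|mn] /=.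
by rewrite nth_rcons size_root_vectors (leq_trans km mn) IHn.
Qed.

Lemma E6_parent_lt k i s p : (6 <= k)%N -> (k < 36)%N ->
  E6_parent k = (i, (s, p)) ->
  [/\ (i < 6)%N, (p < k)%N & forall j, (j < 6)%N ->
    E6_pair j k = Z.add (E6_cartan j i) (E6_pair j p)].
Proof.
move=> k6 k36; have /allP/(_ k) := E6_data_ok.
rewrite mem_iota k36 => /(_ isT)/andP[]; rewrite ltnNge k6 => + _.
rewrite /E6_parent_ok => + E; rewrite E => /and3P[-> -> /allP h6].
by split=> // j j6; apply/Z.eqb_eq/h6; rewrite mem_iota.
Qed.

Lemma root_vector_simple k : (k < 6)%N -> X k = e k.
Proof.
move=> k6; have k36 : (k < 36)%N by apply: leq_trans k6 _.
rewrite /X (@nth_root_vectors 36 k.+1 k (ltnSn k) k36) /=.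
by rewrite nth_rcons size_root_vectors ltnn eqxx /root_vector_step k6.
Qed.

Lemma root_vector_rec k i c p : (6 <= k)%N -> (k < 36)%N ->
  E6_parent k = (i, (c, p)) -> X k = zr c *: [lie e i, X p].
Proof.
move=> k6 k36 E; have [_ pk _] := E6_parent_lt k6 k36 E.
have -> : X k = root_vector_step (root_vectors k) k.
  rewrite /X (@nth_root_vectors _ k.+1) //=.
  by rewrite nth_rcons size_root_vectors ltnn eqxx.
rewrite /root_vector_step [(k < 6)%N]ltnNge k6 E /=.
by rewrite /X (@nth_root_vectors 36 k) // ltnW.
Qed.

Lemma lie_h_root_vector k j : (k < 36)%N -> (j < 6)%N ->
  [lie h j, X k] = zr (E6_pair j k) *: X k.
Proof.
elim/ltn_ind: k => k IHk k36 j6; case: (ltnP k 6) => k6.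
  rewrite root_vector_simple // he //.
  have /allP/(_ k) := E6_pair_simple; rewrite mem_iota => /(_ k6)/allP/(_ j).
  by rewrite mem_iota => /(_ j6)/Z.eqb_eq ->.
case E: (E6_parent k) => [i [s p]]; rewrite (root_vector_rec k6 k36 E).
have [i6 pk /(_ j j6) ->] := E6_parent_lt k6 k36 E.
rewrite lieZr lieA he // (IHk p pk (ltn_trans pk k36) j6) lieZl lieZr -scalerDl.
by rewrite zrD !scalerA mulrC.
Qed.

Definition up_spec j k := [lie e j, X k] =
  if E6_up j k is Some (c, m) then zr c *: X m else 0.

Definition down_spec j k := [lie f j, X k] =
  if E6_down j k is Some (c, m) then zr c *: X m
  else if k == j then - h j else 0.

Lemma zr_sqr_one c : Z.eqb (Z.mul c c) 1%BZ -> zr c * zr c = 1 :> K.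
Proof. by move=> /Z.eqb_eq; rewrite -zrM => ->. Qed.

(* If <beta, alpha_j^vee> = 1 then beta - alpha_j is a root, and it is the
   lowest weight of its alpha_j-string. *)
Lemma down_string k j c m : (k < 36)%N -> (j < 6)%N ->
  (forall l, (l < k)%N -> forall i, (i < 6)%N -> up_spec i l /\ down_spec i l) ->
  E6_down_ok j k -> E6_down j k = Some (c, m) ->
  [/\ X k = zr c *: [lie e j, X m], [lie f j, X m] = 0,
      [lie h j, X m] = - X m & zr c * zr c = 1 :> K].
Proof.
move=> k36 j6 IHk + E; rewrite /E6_down_ok E.
case/and5P=> mk k6 /eqP upm /eqP downm /and3P[mj /Z.eqb_eq pairm c1].
have cc := zr_sqr_one c1.
have [upE downE] := IHk _ mk _ j6.
rewrite /up_spec upm in upE; rewrite /down_spec downm (negbTE mj) in downE.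
split => //; first by rewrite upE scalerA cc scale1r.
by rewrite lie_h_root_vector ?(ltn_trans mk) // pairm zrN1 scaleN1r.
Qed.

(** The lowering formula at k comes first, since the vanishing of [[e_j, X k]] is deduced from
    strings that start with a vector killed by [f_j]. *)
Lemma root_vector_up_down k : (k < 36)%N ->
  forall j, (j < 6)%N -> up_spec j k /\ down_spec j k.
Proof.
elim/ltn_ind: k => k IH k36 j j6.
have {}IH l : (l < k)%N -> forall i, (i < 6)%N -> up_spec i l /\ down_spec i l.
  by move=> lk; apply: IH => //; apply: ltn_trans k36.
have ok i : (i < 6)%N -> E6_up_ok i k && E6_down_ok i k.
  move=> i6; have /allP/(_ k) := E6_data_ok.
  rewrite mem_iota k36 => /(_ isT)/andP[_] /allP; apply.
  by rewrite mem_iota.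
have down i : (i < 6)%N -> down_spec i k.
  move=> i6; have /andP[_ ok_i] := ok i i6; rewrite /down_spec.
  case E: (E6_down i k) => [[c m]|].
    have [-> fm hm cc] := down_string k36 i6 IH ok_i E.
    by rewrite lieZr lieA fm liex0 addr0 [[lie f i, e i]]lieC lieNl hm opprK.
  case: (ltnP k 6) => k6.
    rewrite root_vector_simple // lieC; case: eqVneq => [-> //|ki].
    by rewrite ef // oppr0.
  move: ok_i; rewrite /E6_down_ok E ltnNge k6 /=.
  rewrite gtn_eqF ?(leq_trans i6) //.
  case Ep: (E6_parent k) => [i' [s p]]; rewrite (root_vector_rec k6 k36 Ep).
  have [i'6 pk _] := E6_parent_lt k6 k36 Ep; case/andP=> i'i.
  have [_] := IH p pk i i6; rewrite /down_spec lieZr lieA.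
  rewrite [[lie f i, e i']]lieC ef // oppr0 lie0x add0r.
  case: (E6_down i p) => [[c q]|] -> => [/andP[qk /eqP upq]|/negbTE ->].
    have [+ _] := IH q qk i' i'6; rewrite /up_spec upq lieZr => ->.
    by rewrite !scaler0.
  by rewrite liex0 scaler0.
split; last exact: down.
have /andP[ok_j dok_j] := ok j j6; rewrite /up_spec.
have hej : [lie h j, e j] = 2%:R *: e j.
  by rewrite he // E6_cartan_diag.
move: ok_j; rewrite /E6_up_ok; case E: (E6_up j k) => [[c m]|].
  case Em: (E6_parent m) => [i [s p]] /and5P[m6 m36 i6 /zr_sqr_one ss].
  rewrite (root_vector_rec m6 m36 Em).
  case: eqVneq => [-> /andP[/eqP -> /Z.eqb_eq <-]|ij].
    by rewrite scalerA ss scale1r.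
  case: ifP => [/andP[k6 /eqP ki] /andP[/eqP -> /Z.eqb_eq ->]|_].
    rewrite ki zrN !root_vector_simple // [[lie e j, e i]]lieC.
    by rewrite scalerA mulNr ss scaleN1r.
  case E': (E6_down i k) => [[c1 q]|] //.
  case/and5P=> /Z.eqb_eq cart0 qk /eqP upq.
  have [upi _] := IH q qk i i6; have [] := IH q qk j j6.
  rewrite /up_spec upq in upi; rewrite /up_spec.
  case: (E6_up j q) => [[c2 p']|] // upj _ /andP[/eqP p'p /Z.eqb_eq <-].
  move=> /zr_sqr_one cc1; rewrite p'p in upj.
  have -> : X k = zr c1 *: [lie e i, X q] by rewrite upi scalerA cc1 scale1r.
  rewrite lieZr lieA (ee j6 i6 cart0) lie0x add0r upj lieZr !zrM !scalerA.
  by rewrite -[_ * zr c2 * zr s * zr s]mulrA ss mulr1.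
case: ifP => [_ /eqP ->|_]; first by rewrite root_vector_simple // liexx.
case: ifP => [/E6_downE down1 _|_ /andP[/Z.eqb_eq pair0 kj]].
  (* [X k] is the upper end of a two-term alpha_j-string, so [sl2_raise] applies with m = 1. *)
  case E': (E6_down j k) => [[c m]|]; last by rewrite E' in down1.
  have [-> fm hm cc] := down_string k36 j6 IH dok_j E'.
  rewrite lieZr; have := @sl2_raise _ _ (e j) (f j) (h j) (X m) 1 hej erefl fm.
  by rewrite hm scaleN1r => /(_ erefl) /= ->; rewrite scaler0.
(* The string through k is a single vector, the case m = 0. *)
have fk := down j j6; rewrite /down_spec E6_down_none ?pair0 // (negbTE kj) in fk.
have := @sl2_raise _ _ (e j) (f j) (h j) (X k) 0 hej erefl fk.
by rewrite lie_h_root_vector // pair0 oppr0 => /(_ erefl).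
Qed.

End PositiveRootVectors.

Global Opaque root_vector.

(** * Exact computation in the root basis of E6 *)

Section SparseVectors.

(* a + b w, where w is a primitive cube root of unity *)
Definition eis : Type := (Z * Z)%type.

Definition eis_add (x y : eis) : eis := (Z.add x.1 y.1, Z.add x.2 y.2).

Definition eis_mul (x y : eis) : eis :=
  let bd := Z.mul x.2 y.2 in
  (Z.sub (Z.mul x.1 y.1) bd,
   Z.sub (Z.add (Z.mul x.1 y.2) (Z.mul x.2 y.1)) bd).

Definition eis_zero (x : eis) : bool := Z.eqb x.1 Z0 && Z.eqb x.2 Z0.

(** The operations keep keys increasing and drop zero coefficients, so that equal vectors tend to
    equal lists and [==] can certify identities; the evaluation lemmas are valid for every list,
    normalized or not. *)
Definition svec : Type := seq (N * eis).

Definition scons (k : N) (c : eis) (v : svec) : svec :=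
  if eis_zero c then v else (k, c) :: v.

Fixpoint sadd (u : svec) : svec -> svec :=
  fix sadd_u (v : svec) : svec :=
    match u, v with
    | [::], _ => v
    | _, [::] => u
    | (k, c) :: u', (l, d) :: v' =>
        match N.compare k l with
        | Lt => (k, c) :: sadd u' v
        | Gt => (l, d) :: sadd_u v'
        | Eq => scons k (eis_add c d) (sadd u' v')
        end
    end.

Definition sscale (c : eis) (v : svec) : svec :=
  foldr (fun p acc => scons p.1 (eis_mul c p.2) acc) [::] v.

(** [M] lists the images of the basis vectors. *)
Definition slin (M : seq svec) (v : svec) : svec :=
  foldr (fun p acc => sadd (sscale p.2 (nth [::] M (N.to_nat p.1))) acc) [::] v.

Definition smx_scale (c : eis) (M : seq svec) : seq svec := map (sscale c) M.

Definition eisN1 : eis := ((-1)%BZ, Z0).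

Definition smx_comm (M N : seq svec) : seq svec :=
  mkseq (fun b => sadd (slin M (nth [::] N b)) (sscale eisN1 (slin N (nth [::] M b)))) 78.

Definition skey (k : nat) (c : Z) : svec := [:: (N.of_nat k, (c, Z0))].

(* The basis is x_0 .. x_35, y_0 .. y_35, h_0 .. h_5; [E6_gen true j] is the
   action of e_j on it and [E6_gen false j] that of f_j. *)
Definition E6_gen (s : bool) (j : nat) : seq svec := mkseq (fun b =>
  if (b < 72)%N then
    let side := (b < 36)%N in
    let k := if side then b else (b - 36)%N in
    let key m := if side then m else (m + 36)%N in
    if side == s then
      if E6_up j k is Some (c, m) then skey (key m) c else [::]
    else if E6_down j k is Some (c, m) then skey (key m) c
    else if k == j then skey (72 + j) (if s then 1%BZ else (-1)%BZ) else [::]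
  else
    let c := E6_cartan (b - 72) j in
    if Z.eqb c Z0 then [::]
    else skey (if s then j else j + 36)%N (if s then Z.opp c else c)) 78.

Definition smx_root_step (g : nat -> seq svec) (s : seq (seq svec)) (k : nat) :=
  if (k < 6)%N then g k else
  let: (i, (c, p)) := E6_parent k in
  smx_scale (c, Z0) (smx_comm (g i) (nth [::] s p)).

Fixpoint smx_roots (g : nat -> seq svec) (n : nat) : seq (seq svec) :=
  if n is m.+1 then
    let s := smx_roots g m in rcons s (smx_root_step g s m)
  else [::].

(** Only the generators have a known action; the matrices of the other 66 basis elements arise from
    commutators, by the recursion that defines the root vectors. *)
Definition E6_mktab : seq (seq svec) :=
  smx_roots (E6_gen true) 36 ++ smx_roots (E6_gen false) 36 ++
  mkseq (fun i => smx_comm (E6_gen true i) (E6_gen false i)) 6.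

Definition E6_tab : seq (seq svec) := Eval vm_compute in E6_mktab.

Definition sbr (u v : svec) : svec :=
  foldr (fun p acc =>
    sadd (sscale p.2 (slin (nth [::] E6_tab (N.to_nat p.1)) v)) acc) [::] u.

End SparseVectors.

Lemma E6_tabE : E6_tab = E6_mktab.
Proof. by vm_compute. Qed.

Section Evaluation.
Context {K : numFieldType} {L : vectType K}.
Variable w : K.
Hypothesis ww : w ^+ 2 + w + 1 = 0.

Definition eval_eis (c : eis) : K := zr c.1 + zr c.2 * w.

Lemma eval_eisD c d : eval_eis (eis_add c d) = eval_eis c + eval_eis d.
Proof. by rewrite /eval_eis /= !zrD; ring. Qed.

Lemma eval_eisM c d : eval_eis (eis_mul c d) = eval_eis c * eval_eis d.
Proof.
rewrite /eval_eis /= !(zrD, zrB, zrM).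
have w2 : w ^+ 2 = - w - 1 by apply/eqP; rewrite -subr_eq0 -ww; apply/eqP; ring.
have -> : (zr c.1 + zr c.2 * w) * (zr d.1 + zr d.2 * w) =
  zr c.1 * zr d.1 + (zr c.1 * zr d.2 + zr c.2 * zr d.1) * w
    + zr c.2 * zr d.2 * w ^+ 2 :> K by ring.
by rewrite w2; ring.
Qed.

Lemma eval_eis0 c : eis_zero c -> eval_eis c = 0.
Proof.
by case/andP=> /Z.eqb_eq c1 /Z.eqb_eq c2; rewrite /eval_eis c1 c2 mul0r addr0.
Qed.

Lemma eval_eisZ (c : Z) : eval_eis (c, Z0) = zr c.
Proof. by rewrite /eval_eis mul0r addr0. Qed.

Lemma eval_eisN1 : eval_eis eisN1 = -1.
Proof. exact: eval_eisZ. Qed.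

Section Vectors.
Variable B : seq L.

Definition seval (v : svec) : L :=
  \sum_(p <- v) eval_eis p.2 *: B`_(N.to_nat p.1).

Lemma seval_nil : seval [::] = 0.
Proof. exact: big_nil. Qed.

Lemma seval_cons k c v : seval ((k, c) :: v) = eval_eis c *: B`_(N.to_nat k) + seval v.
Proof. exact: big_cons. Qed.

Lemma seval_scons k c v : seval (scons k c v) = eval_eis c *: B`_(N.to_nat k) + seval v.
Proof.
rewrite /scons; case: ifP => [/eval_eis0 ->|_]; last exact: seval_cons.
by rewrite scale0r add0r.
Qed.

Lemma sevalD u v : seval (sadd u v) = seval u + seval v.
Proof.
elim: u v => [|[k c] u IHu]; first by case=> *; rewrite seval_nil add0r.
elim=> [|[l d] v IHv]; first by rewrite seval_nil addr0.
rewrite /sadd -/sadd; case: (N.compare_spec k l) => [->|_|_].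
- rewrite seval_scons IHu !seval_cons eval_eisD scalerDl.
  by rewrite addrACA !addrA.
- by rewrite !seval_cons IHu seval_cons addrA.
rewrite seval_cons [X in _ + X]IHv !seval_cons.
by rewrite addrCA.
Qed.

Lemma sevalZ c v : seval (sscale c v) = eval_eis c *: seval v.
Proof.
elim: v => [|[k d] v IHv]; first by rewrite !seval_nil scaler0.
by rewrite [LHS]seval_scons IHv seval_cons eval_eisM scalerDr scalerA.
Qed.

Lemma sevalN v : seval (sscale eisN1 v) = - seval v.
Proof. by rewrite sevalZ eval_eisN1 scaleN1r. Qed.

Lemma seval_slin M v :
  seval (slin M v) = \sum_(p <- v) eval_eis p.2 *: seval (nth [::] M (N.to_nat p.1)).
Proof.
elim: v => [|[k d] v IHv]; first by rewrite big_nil seval_nil.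
by rewrite [LHS]sevalD IHv big_cons sevalZ.
Qed.

Lemma seval_skey k c : seval (skey k c) = zr c *: B`_k.
Proof. by rewrite seval_cons seval_nil addr0 eval_eisZ Nnat.Nat2N.id. Qed.

End Vectors.
End Evaluation.

(** * From the action of the generators to the full bracket table *)

Section Representation.
Context {K : numFieldType} {L : finLieType K}.
Variable w : K.
Hypothesis ww : w ^+ 2 + w + 1 = 0.
Variable B : seq L.
Hypothesis szB : size B = 78%N.
Local Notation ev := (seval w B).

(** [B] is not assumed free: [M] merely provides one expression for each bracket, so the table is
    available before linear independence is proved with its help. *)
Definition represents (M : seq svec) (x : L) :=
  size M = 78%N /\ forall b, (b < 78)%N -> [lie x, B`_b] = ev (nth [::] M b).

Lemma represents_lin M x v : represents M x -> [lie x, ev v] = ev (slin M v).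
Proof.
case=> szM Mx; rewrite seval_slin // lie_sumr; apply: eq_bigr => p _.
rewrite lieZr; case: (ltnP (N.to_nat p.1) 78) => k78; first by rewrite Mx.
by rewrite !nth_default ?szM ?szB // seval_nil liex0.
Qed.

Lemma represents_comm M N x y : represents M x -> represents N y ->
  represents (smx_comm M N) [lie x, y].
Proof.
move=> Mx Ny; split=> [|b b78]; first by rewrite size_mkseq.
rewrite (nth_mkseq [::]) // sevalD // sevalN // -(represents_lin _ Mx) -(represents_lin _ Ny).
by case: Mx Ny => _ Mx [_ Ny]; rewrite -Mx // -Ny // lieAl.
Qed.

Lemma represents_scale M x c : represents M x ->
  represents (smx_scale c M) (eval_eis w c *: x).
Proof.
case=> szM Mx; split=> [|b b78]; first by rewrite size_map.
by rewrite (nth_map [::]) ?szM // sevalZ // lieZl Mx.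
Qed.

End Representation.

Lemma eq_represents (K : numFieldType) (L : finLieType K) w (B : seq L) M x y :
  x = y -> represents w B M x -> represents w B M y.
Proof. by move=> ->. Qed.

Section RootBasis.
Context {K : numFieldType} {L : finLieType K}.
Variable w : K.
Hypothesis ww : w ^+ 2 + w + 1 = 0.
Variables e f : nat -> L.
Let h j := [lie e j, f j].
Hypothesis he : forall i j, (i < 6)%N -> (j < 6)%N ->
  [lie h i, e j] = zr (E6_cartan i j) *: e j.
Hypothesis hf : forall i j, (i < 6)%N -> (j < 6)%N ->
  [lie h i, f j] = - zr (E6_cartan i j) *: f j.
Hypothesis ef : forall i j, (i < 6)%N -> (j < 6)%N -> i != j -> [lie e i, f j] = 0.
Hypothesis ee : forall i j, (i < 6)%N -> (j < 6)%N ->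
  E6_cartan i j = Z0 -> [lie e i, e j] = 0.
Hypothesis ff : forall i j, (i < 6)%N -> (j < 6)%N ->
  E6_cartan i j = Z0 -> [lie f i, f j] = 0.

Let h' j := [lie f j, e j].

(** Exchanging the e's and f's replaces h by -h and preserves the relations, so the negative root
    vectors obey the formulas proved for the positive ones. *)
Lemma swapped_h_f i j : (i < 6)%N -> (j < 6)%N ->
  [lie h' i, f j] = zr (E6_cartan i j) *: f j.
Proof. by move=> i6 j6; rewrite /h' [[lie f i, e i]]lieC lieNl -/(h i) hf // scaleNr opprK. Qed.

Lemma swapped_f_e i j : (i < 6)%N -> (j < 6)%N -> i != j -> [lie f i, e j] = 0.
Proof. by move=> i6 j6 ij; rewrite lieC ef ?oppr0 // eq_sym. Qed.

Definition root_basis_vector (b : nat) : L :=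
  if (b < 36)%N then root_vector e b
  else if (b < 72)%N then root_vector f (b - 36) else h (b - 72).

Definition root_basis : seq L := mkseq root_basis_vector 78.
Local Notation B := root_basis.
Local Notation ev := (seval w B).

Lemma size_root_basis : size B = 78%N.
Proof. exact: size_mkseq. Qed.

Lemma root_basis_pos k : (k < 36)%N -> B`_k = root_vector e k.
Proof.
move=> k36; rewrite nth_mkseq; last exact: leq_trans k36 _.
by rewrite /root_basis_vector k36.
Qed.

Lemma root_basis_neg k : (k < 36)%N -> B`_(k + 36) = root_vector f k.
Proof.
move=> k36; rewrite nth_mkseq; last by rewrite -[78%N]/(42 + 36)%N ltn_add2r (leq_trans k36).
by rewrite /root_basis_vector ltnNge leq_addl /= -[72%N]/(36 + 36)%N ltn_add2r k36 addnK.
Qed.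

Lemma root_basis_h k : (k < 6)%N -> B`_(72 + k) = h k.
Proof.
move=> k6; rewrite nth_mkseq; last by rewrite -[78%N]/(72 + 6)%N ltn_add2l.
by rewrite /root_basis_vector addKn; case: ltnP => [|_]; [lia|case: ltnP => //; lia].
Qed.

Lemma seval_option (o : option (Z * nat)) (g : nat -> nat) (X : nat -> L)
    (v : svec) x :
  (forall c m, o = Some (c, m) -> B`_(g m) = X m) -> ev v = x ->
  (if o is Some (c, m) then zr c *: X m else x)
  = ev (if o is Some (c, m) then skey (g m) c else v).
Proof.
move=> gX vx; case E: o => [[c m]|]; last by rewrite vx.
by rewrite seval_skey (gX _ _ E).
Qed.

Local Opaque E6_cartan E6_pair E6_parent E6_up E6_down.

Lemma represents_gen s j : (j < 6)%N ->
  represents w B (E6_gen s j) (if s then e j else f j).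
Proof.
move=> j6; split=> [|b b78]; first by rewrite size_mkseq.
rewrite (nth_mkseq [::]) //; case: (ltnP b 72) => [b72|b72]; last first.
  have [i6 ->] : (b - 72 < 6)%N /\ b = (72 + (b - 72))%N by lia.
  move: (b - 72)%N i6 => i i6; rewrite root_basis_h // addKn lieC.
  have -> : [lie h i, (if s then e j else f j)] =
    (if s then 1 else -1) *: (zr (E6_cartan i j) *: (if s then e j else f j)).
    by case: s; rewrite ?he // ?hf // ?scale1r // scaleN1r scaleNr.
  cbv zeta; case Ec: (Z.eqb _ _).
    by move/Z.eqb_eq: Ec => ->; rewrite seval_nil scale0r scaler0 oppr0.
  have j36 : (j < 36)%N by apply: leq_trans j6 _.
  rewrite seval_skey; case: s; [rewrite root_basis_pos|rewrite root_basis_neg] => //.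
    by rewrite root_vector_simple // zrN scale1r scaleNr.
  by rewrite root_vector_simple // scaleN1r opprK.
have upd n (c : bool) : ev (if n == j then
      skey (72 + j) (if c then 1%BZ else (-1)%BZ) else [::])
    = if n == j then (if c then 1 else -1) *: h j else 0.
  case: eqP => _; last by rewrite seval_nil.
  by rewrite seval_skey root_basis_h //; case: c.
cbv zeta; case: (ltnP b 36) => [b36|b36].
  have [up down] := root_vector_up_down he ef ee b36 j6.
  rewrite root_basis_pos //; case: s => /=.
    rewrite [LHS]up; apply: (seval_option (g := id)); last exact: seval_nil.
    by move=> c m /(E6_up_lt36 j6 b36) m36; rewrite root_basis_pos.
  rewrite [LHS]down; apply: (seval_option (g := id)).
    by move=> c m /(E6_down_lt36 j6 b36) m36; rewrite root_basis_pos.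
  by rewrite (upd b false); case: ifP => // _; rewrite scaleN1r.
have [k36 ->] : (b - 36 < 36)%N /\ b = ((b - 36) + 36)%N by lia.
move: (b - 36)%N k36 => k k36; rewrite addnK root_basis_neg //.
have [up down] := root_vector_up_down swapped_h_f swapped_f_e ff k36 j6.
case: s => /=.
  rewrite [LHS]down; apply: (seval_option (g := fun m => (m + 36)%N)).
    by move=> c m /(E6_down_lt36 j6 k36) m36; rewrite root_basis_neg.
  by rewrite (upd k true); case: ifP => // _; rewrite scale1r -lieC.
rewrite [LHS]up; apply: (seval_option (g := fun m => (m + 36)%N)).
  by move=> c m /(E6_up_lt36 j6 k36) m36; rewrite root_basis_neg.
exact: seval_nil.
Qed.

Lemma represents_roots s n k : (n <= 36)%N -> (k < n)%N ->
  represents w B (nth [::] (smx_roots (E6_gen s) n) k)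
    (root_vector (if s then e else f) k).
Proof.
elim: n k => // n IHn k n36; rewrite ltnS => kn /=.
have sz m : size (smx_roots (E6_gen s) m) = m.
  by elim: m => //= m IHm; rewrite size_rcons IHm.
rewrite nth_rcons sz; case: ltngtP kn => // [kn _|-> _].
  by apply: IHn => //; apply: ltnW.
rewrite /smx_root_step; case: ltnP => n6.
  rewrite root_vector_simple //.
  by apply: eq_represents (represents_gen s n6); case: (s).
case E: (E6_parent n) => [i [c p]].
have [i6 pn _] := E6_parent_lt n6 n36 E.
rewrite (root_vector_rec _ n6 n36 E) -(eval_eisZ w).
apply: (represents_scale ww); apply: (represents_comm ww size_root_basis).
  by apply: eq_represents (represents_gen s i6); case: (s).
by apply: IHn => //; apply: ltnW.
Qed.

Lemma represents_tab b : (b < 78)%N -> represents w B (nth [::] E6_tab b) B`_b.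
Proof.
have sz s n : size (smx_roots (E6_gen s) n) = n.
  by elim: n => //= n IHn; rewrite size_rcons IHn.
move=> b78; rewrite E6_tabE /E6_mktab nth_cat sz.
case: ltnP => b36; first by rewrite root_basis_pos //; apply: (represents_roots true).
rewrite nth_cat sz; case: ltnP => b72.
  have {2}-> : b = ((b - 36) + 36)%N by lia.
  by rewrite root_basis_neg //; apply: (represents_roots false).
have i6 : (b - 36 - 36 < 6)%N by lia.
have {2}-> : b = (72 + (b - 36 - 36))%N by lia.
rewrite (nth_mkseq [::]) // root_basis_h //.
apply: (represents_comm ww size_root_basis).
  exact: (represents_gen true).
exact: (represents_gen false).
Qed.

Lemma seval_br u v : ev (sbr u v) = [lie ev u, ev v].
Proof.
elim: u => [|[k c] u IHu]; first by rewrite !seval_nil lie0x.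
rewrite [sbr _ _]/= sevalD // sevalZ // seval_cons lieDl lieZl IHu.
congr (_ *: _ + _); case: (ltnP (N.to_nat k) 78) => k78.
  by rewrite (represents_lin ww size_root_basis _ (represents_tab k78)).
(* A key beyond 77 denotes the zero vector in [B] and an empty row in the table. *)
rewrite [B`__]nth_default ?size_root_basis // nth_default; last by rewrite E6_tabE.
rewrite seval_slin // lie0x big1 // => p _.
by rewrite nth_nil seval_nil scaler0.
Qed.

End RootBasis.

(** * The root basis of the simple Lie algebra of type E6 *)

(** A torus element on which the 72 roots take pairwise distinct nonzero values; [E6_regular_ok]
    checks this by including index 72, whose eigenvalue is 0, in the uniqueness test. *)
Definition E6_regular : svec :=
  [seq (N.of_nat p.1, (Z.of_nat p.2, Z0)) | p <- zip (iota 72 6) [:: 30; 16; 1; 1; 5; 28]].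

Definition E6_weight (v : svec) (k : nat) : eis :=
  if sbr v (skey k 1%BZ) is [:: (_, c)] then c else (Z0, Z0).

Definition E6_parent_down_ok (k : nat) : bool :=
  let: (i, (c, p)) := E6_parent k in
  (E6_down i k == Some (c, p)) && ~~ Z.eqb c Z0.

Lemma E6_parent_down : all E6_parent_down_ok (iota 6 30).
Proof. by vm_compute. Qed.

Lemma E6_regular_ok :
  all (fun k => sbr E6_regular (skey k 1%BZ) ==
    sscale (E6_weight E6_regular k) (skey k 1%BZ)) (iota 0 78) &&
  uniq (map (E6_weight E6_regular) (iota 0 73)) &&
  all (fun k => Z.eqb (E6_weight E6_regular k).2 Z0) (iota 0 78) &&
  all (fun k => Z.eqb (E6_weight E6_regular k).1 Z0) (iota 72 6).
Proof. by vm_compute. Qed.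

(** Three times the inverse of the Cartan matrix, integral because the determinant is 3. *)
Definition E6_cartan_inv3 : seq (seq Z) := Eval vm_compute in map (map Z.of_nat)
  [:: [:: 4; 3; 5; 6; 4; 2]; [:: 3; 6; 6; 9; 6; 3]; [:: 5; 6; 10; 12; 8; 4]; [:: 6; 9; 12; 18; 12; 6]; [:: 4; 6; 8; 12; 10; 5]; [:: 2; 3; 4; 6; 5; 4] ].

Lemma E6_cartan_inv3_ok :
  all (fun i => all (fun l => Z.eqb
    (Zsum [seq Z.mul (E6_cartan i j) (nth Z0 (nth [::] E6_cartan_inv3 j) l) | j <- iota 0 6])
    (if i == l then 3%BZ else Z0)) (iota 0 6)) (iota 0 6).
Proof. by vm_compute. Qed.

(** Lowering a root vector to its parent has a nonzero coefficient, so nonvanishing passes up from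
    the simple roots. *)
Lemma root_vector_neq0 (K : numFieldType) (L : finLieType K) (e f : nat -> L) :
  (forall k j, (k < 36)%N -> (j < 6)%N -> down_spec e f j k) ->
  (forall j, (j < 6)%N -> e j != 0) ->
  forall k, (k < 36)%N -> root_vector e k != 0.
Proof.
move=> down en0 k; elim/ltn_ind: k => k IHk k36; case: (ltnP k 6) => k6.
  by rewrite root_vector_simple // en0.
case E: (E6_parent k) => [i [c p]].
have [i6 pk _] := E6_parent_lt k6 k36 E.
have /allP/(_ k) := E6_parent_down; rewrite mem_iota k6 => /(_ k36).
rewrite /E6_parent_down_ok E => /andP[/eqP Ed c0].
have := down k i k36 i6; rewrite /down_spec Ed => fk.
apply: contraNneq (IHk p pk (ltn_trans pk k36)) => Xk0.
move: fk; rewrite Xk0 liex0 => /esym/eqP; rewrite scaler_eq0 zr_eq0.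
by case/orP=> // /eqP c00; rewrite c00 in c0.
Qed.

Section E6Algebra.
Local Opaque E6_weight E6_regular sbr.
Context {K : numFieldType} {L : finLieType K}.
Variable w : K.
Hypothesis ww : w ^+ 2 + w + 1 = 0.
Variables e f : 'I_6 -> L.
Hypothesis simpleL : simple_lie {:L}.
Hypothesis chevL : chevalley_generators cartan_E6 {:L} e f.

Definition e_ (k : nat) : L := e (inord k).
Definition f_ (k : nat) : L := f (inord k).

Lemma cartan_E6E i j : (i < 6)%N -> (j < 6)%N ->
  (cartan_E6 (inord i) (inord j))%:~R = zr (E6_cartan i j) :> K.
Proof.
move=> i6 j6; rewrite mxE -val_eqE /= !inordK // /E6_cartan /E6_adj.
by case: ifP => // _; case: ifP.
Qed.

Lemma e_h i j : (i < 6)%N -> (j < 6)%N ->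
  [lie [lie e_ i, f_ i], e_ j] = zr (E6_cartan i j) *: e_ j.
Proof. by move=> i6 j6; rewrite (chevalley_he chevL) cartan_E6E. Qed.

Lemma f_h i j : (i < 6)%N -> (j < 6)%N ->
  [lie [lie e_ i, f_ i], f_ j] = - zr (E6_cartan i j) *: f_ j.
Proof. by move=> i6 j6; rewrite (chevalley_hf chevL) cartan_E6E. Qed.

Lemma e_f i j : (i < 6)%N -> (j < 6)%N -> i != j -> [lie e_ i, f_ j] = 0.
Proof.
move=> i6 j6 ij; rewrite (chevalley_ef chevL) //.
by apply: contra_neq ij => /(congr1 val); rewrite /= !inordK.
Qed.

Lemma cartan_E6_0 i j : (i < 6)%N -> (j < 6)%N -> E6_cartan i j = Z0 ->
  cartan_E6 (inord i) (inord j) = 0 /\ inord i != inord j :> 'I_6.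
Proof.
move=> i6 j6 c0; split.
  have := cartan_E6E i6 j6; rewrite c0 => /eqP.
  by rewrite (_ : zr Z0 = 0) // intr_eq0 => /eqP.
apply: contraPneq c0 => /(congr1 val); rewrite /= !inordK // => ->.
by rewrite E6_cartan_diag.
Qed.

Lemma e_e i j : (i < 6)%N -> (j < 6)%N -> E6_cartan i j = Z0 -> [lie e_ i, e_ j] = 0.
Proof.
move=> i6 j6 /(cartan_E6_0 i6 j6) [c0 /(chevalley_serre_e chevL)].
by rewrite c0.
Qed.

Lemma f_f i j : (i < 6)%N -> (j < 6)%N -> E6_cartan i j = Z0 -> [lie f_ i, f_ j] = 0.
Proof.
move=> i6 j6 /(cartan_E6_0 i6 j6) [c0 /(chevalley_serre_f chevL)].
by rewrite c0.
Qed.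

Definition B6 : seq L := root_basis e_ f_.
Local Notation B := B6.
Local Notation ev := (seval w B).

Lemma size_B6 : size B = 78%N. Proof. exact: size_root_basis. Qed.

Lemma ev_br u v : ev (sbr u v) = [lie ev u, ev v].
Proof. exact: (seval_br ww e_h f_h e_f e_e f_f). Qed.

Lemma ev_skey k : ev (skey k 1%BZ) = B`_k.
Proof. by rewrite seval_skey scale1r. Qed.

Lemma B6_lie a b : (a < 78)%N ->
  [lie B`_a, B`_b] = ev (sbr (skey a 1%BZ) (skey b 1%BZ)).
Proof. by rewrite ev_br !ev_skey. Qed.

Lemma B6_h k : (k < 6)%N -> B`_(72 + k) = [lie e_ k, f_ k].
Proof. exact: root_basis_h. Qed.

Lemma B6_e k : (k < 6)%N -> B`_k = e_ k.
Proof.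
by move=> k6; rewrite root_basis_pos ?root_vector_simple //; apply: leq_trans k6 _.
Qed.

Lemma B6_f k : (k < 6)%N -> B`_(k + 36) = f_ k.
Proof.
by move=> k6; rewrite root_basis_neg ?root_vector_simple //; apply: leq_trans k6 _.
Qed.

Lemma e_inord i : e i = e_ i. Proof. by rewrite /e_ inord_val. Qed.
Lemma f_inord i : f i = f_ i. Proof. by rewrite /f_ inord_val. Qed.

Lemma seval_mem v : ev v \in <<B>>%VS.
Proof.
rewrite /seval; apply: rpred_sum => p _; apply: rpredZ.
case: (ltnP (N.to_nat p.1) (size B)) => [k78|k78].
  by apply: memv_span; apply: mem_nth.
by rewrite nth_default // mem0v.
Qed.

Lemma subalgebra_span (X : seq L) :
  (forall x y, x \in X -> y \in X -> [lie x, y] \in <<X>>%VS) -> subalgebra <<X>>%VS.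
Proof.
move=> Xsub x y xX yX; rewrite (@coord_span _ _ _ (in_tuple X) x xX) lie_suml.
apply: rpred_sum => i _; rewrite lieZl; apply: rpredZ.
rewrite (@coord_span _ _ _ (in_tuple X) y yX) lie_sumr; apply: rpred_sum => j _; rewrite lieZr.
by apply: rpredZ; apply: Xsub; apply: mem_nth.
Qed.

Lemma span_B6 : <<B>>%VS = fullv.
Proof.
apply/eqP; rewrite eqEsubv subvf; apply: (chevalley_gen chevL).
  apply: subalgebra_span => x y /(nthP 0)[a aB <-] /(nthP 0)[b bB <-].
  by rewrite size_B6 in aB; rewrite B6_lie // seval_mem.
move=> i; rewrite e_inord f_inord -B6_e // -B6_f //.
by split; apply: memv_span; apply: mem_nth; rewrite size_B6; have := ltn_ord i; lia.
Qed.

Definition E6_neighbours (s : seq nat) : seq nat :=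
  [seq k <- iota 0 6 | has (fun l => ~~ Z.eqb (E6_cartan l k) Z0) s].

Lemma E6_connected :
  all (fun j => iter 5 E6_neighbours [:: j] == iota 0 6) (iota 0 6).
Proof. by vm_compute. Qed.

(** If [e_j] or [f_j] vanished, so would [h_j], and then [[h_j, e_k] = A_jk e_k] kills the
    generators at all neighbours. The diagram is connected, so all generators would vanish and [L]
    would be zero. *)
Lemma e_neq0 j : (j < 6)%N -> (e_ j != 0) && (f_ j != 0).
Proof.
move=> j6; apply/negPn/negP => ef0.
have h0 : [lie e_ j, f_ j] = 0.
  by move: ef0; rewrite negb_and !negbK => /orP[]/eqP ->; rewrite ?lie0x ?liex0.
pose Z k := (k < 6)%N -> e_ k = 0 /\ f_ k = 0.
have step l k : (l < 6)%N -> ~~ Z.eqb (E6_cartan l k) Z0 ->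
    [lie e_ l, f_ l] = 0 -> Z k.
  move=> l6 c0 hl k6.
  have c1 : zr (E6_cartan l k) != 0 :> K by rewrite zr_eq0; apply/eqP => c00; rewrite c00 in c0.
  have := e_h l6 k6; have := f_h l6 k6; rewrite hl !lie0x => /esym/eqP fk /esym/eqP ek.
  move: fk ek; rewrite !scaler_eq0 oppr_eq0 (negbTE c1) /=.
  by move=> /eqP -> /eqP ->.
have allZ : forall k, (k < 6)%N -> e_ k = 0 /\ f_ k = 0.
  have /allP/(_ j) := E6_connected; rewrite mem_iota => /(_ j6)/eqP conn k k6.
  have : k \in iota 0 6 by rewrite mem_iota.
  rewrite -conn; set g := E6_neighbours.
  have : forall n, all (fun l => (l < 6)%N) (iter n g [:: j]) /\
      {in iter n g [:: j], forall l, [lie e_ l, f_ l] = 0}.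
    elim=> [|n [/allP IH6 IHn]]; first by rewrite /= j6; split=> // l; rewrite inE => /eqP ->.
    rewrite iterS; split.
      by apply/allP => l; rewrite mem_filter mem_iota => /andP[].
    move=> l; rewrite mem_filter mem_iota => /andP[/hasP[m mn c0] l6].
    by have [-> _] := step m l (IH6 m mn) c0 (IHn m mn) l6; rewrite lie0x.
  move=> /(_ 5%N) [/allP P6 Ph].
  move=> kin; have hk := Ph k kin.
  by apply: (step k k k6 _ hk k6); rewrite E6_cartan_diag.
have L0 : ({:L} <= 0)%VS.
  apply: (chevalley_gen chevL) => [x y|i].
    by rewrite !memv0 => /eqP -> _; rewrite lie0x.
  by rewrite e_inord f_inord; have [-> ->] := allZ i (ltn_ord i); rewrite mem0v.
case: simpleL => _ [x [y [_ _ /negP xy0]]] _; apply: xy0.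
by rewrite -memv0 (subvP L0) // memvf.
Qed.

Lemma B6_neq0 k : (k < 72)%N -> B`_k != 0.
Proof.
have ef0 := e_neq0.
move=> k72; case: (ltnP k 36) => k36.
  rewrite root_basis_pos //; apply: (@root_vector_neq0 _ _ e_ f_) => //.
    by move=> l j l36 j6; have [] := root_vector_up_down e_h e_f e_e l36 j6.
  by move=> j /e_neq0 /andP[].
have -> : (k = (k - 36) + 36)%N by lia.
rewrite root_basis_neg; last by lia.
apply: (@root_vector_neq0 _ _ f_ e_) => //; last 1 first.
- by lia.
- move=> l j l36 j6.
  by have [] := root_vector_up_down (swapped_h_f f_h) (swapped_f_e e_f) f_f l36 j6.
by move=> j /e_neq0 /andP[].
Qed.

Lemma E6_regularP k : (k < 78)%N ->
  [lie ev E6_regular, B`_k] = zr (E6_weight E6_regular k).1 *: B`_k.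
Proof.
move=> k78; have /andP[/andP[/andP[/allP/(_ k) h1 _] /allP/(_ k) h2] _] := E6_regular_ok.
rewrite -ev_skey -ev_br; rewrite !mem_iota in h1 h2.
rewrite (eqP (h1 k78)) sevalZ //; congr (_ *: _).
by rewrite /eval_eis; have /Z.eqb_eq -> := h2 k78; rewrite mul0r addr0.
Qed.

(** Bracketing the relation with each [e_j] gives c A = 0 for the Cartan matrix A, which is then
    cancelled by three times its inverse. *)
Lemma h_free (c : nat -> K) : \sum_(i <- iota 0 6) c i *: B`_(72 + i) = 0 ->
  forall i, (i < 6)%N -> c i = 0.
Proof.
move=> sum0 l l6.
have cA j : (j < 6)%N -> \sum_(i <- iota 0 6) c i * zr (E6_cartan i j) = 0.
  move=> j6; have /andP[ej0 _] := e_neq0 j6.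
  apply/eqP; have := congr1 (fun x => [lie x, e_ j]) sum0.
  rewrite lie0x lie_suml.
  have -> : \sum_(i <- iota 0 6) [lie c i *: B`_(72 + i), e_ j] =
      (\sum_(i <- iota 0 6) c i * zr (E6_cartan i j)) *: e_ j.
    rewrite scaler_suml; apply: eq_big_seq => i; rewrite mem_iota => i6.
    by rewrite lieZl B6_h // e_h // scalerA.
  by move/eqP; rewrite scaler_eq0 (negbTE ej0) orbF.
have zsum (s : seq nat) F : zr (Zsum [seq F j | j <- s]) = \sum_(j <- s) zr (F j) :> K.
  by elim: s => [|j s IHs]; rewrite ?big_nil // big_cons /= zrD IHs.
pose D j := zr (nth Z0 (nth [::] E6_cartan_inv3 j) l) : K.
have : \sum_(j <- iota 0 6) (\sum_(i <- iota 0 6) c i * zr (E6_cartan i j)) * D j = 0.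
  rewrite big_seq big1 // => j; rewrite mem_iota => j6.
  by rewrite cA // mul0r.
under eq_bigr => j _ do rewrite mulr_suml.
rewrite exchange_big /=.
have -> : \sum_(i <- iota 0 6) \sum_(j <- iota 0 6) c i * zr (E6_cartan i j) * D j =
    \sum_(i <- iota 0 6) c i * (if i == l then 3%:R else 0).
  apply: eq_big_seq => i i6; under eq_bigr => j _ do rewrite -mulrA -zrM.
  rewrite -mulr_sumr -zsum; congr (_ * _).
  have /allP/(_ i i6)/allP/(_ l) := E6_cartan_inv3_ok.
  by rewrite mem_iota => /(_ l6)/Z.eqb_eq ->; case: ifP.
rewrite (bigD1_seq l) ?iota_uniq ?mem_iota //= eqxx big1 => [|i /negbTE ->].
  by rewrite addr0 => /eqP; rewrite mulf_eq0 pnatr_eq0 orbF => /eqP.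
by rewrite mulr0.
Qed.

Lemma free_B6 : free B.
Proof.
rewrite -(in_tupleE B); apply/freeP => c sum0.
have sz := size_B6.
pose c' k := if insub k is Some i then c i else 0.
have c'E (i : 'I_(size B)) : c' i = c i by rewrite /c' valK.
(* All coroots have eigenvalue 0 under the regular element, so they are gathered into one vector at
   index 72; the 73 eigenvalues are then distinct and [h_free] resolves the last vector. *)
pose v k := if (k < 72)%N then c' k *: B`_k
  else \sum_(i <- iota 0 6) c' (72 + i)%N *: B`_(72 + i).
have vsum : \sum_(k <- iota 0 73) v k = 0.
  rewrite -[RHS]sum0.
  have -> : \sum_(i < size B) c i *: (in_tuple B)`_i = \sum_(i <- iota 0 78) c' i *: B`_i.
    rewrite -[iota 0 78]/(index_iota 0 78) big_mkord -sz.
    by apply: eq_bigr => i _; rewrite c'E.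
  rewrite (iotaD 0 72 6) (iotaD 0 72 1) !big_cat; congr (_ + _); last first.
    by rewrite big_seq1 -[(0 + 72)%N]/(72 + 0)%N iotaDl big_map.
  by apply: eq_big_seq => k; rewrite mem_iota /v => /andP[_ ->].
have /andP[/andP[/andP[_ uniqE] /allP z2] /allP z1] := E6_regular_ok.
have z2' k : (k < 78)%N -> (E6_weight E6_regular k).2 = Z0.
  by move=> k78; apply/Z.eqb_eq/z2; rewrite mem_iota.
have v0 : {in iota 0 73, forall k, v k = 0}.
  refine (@eigen_sum0 _ _ nat (iota 0 73) (linfun (lie (ev E6_regular))) v
    (fun k => zr (E6_weight E6_regular k).1) (iota_uniq 0 73) _ _ vsum).
    move=> a b; rewrite !mem_iota => a73 b73 /zr_inj ab.
    have abE : E6_weight E6_regular a = E6_weight E6_regular b.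
      have ltk k : (k < 73)%N -> (k < 78)%N by move=> k73; apply: leq_trans k73 _.
      rewrite [LHS]surjective_pairing [RHS]surjective_pairing ab.
      by rewrite (z2' a (ltk a a73)) (z2' b (ltk b b73)).
    move: uniqE => /(uniqP (Z0, Z0)) /(_ a b).
    rewrite !inE size_map size_iota => /(_ a73 b73).
    by rewrite !(nth_map 0%N) ?size_iota // !nth_iota //; apply.
  move=> k; rewrite mem_iota => k73; rewrite linfun_lieE /v.
  case: ltnP => k72.
    have k78 : (k < 78)%N by apply: leq_trans k72 _.
    rewrite lieZr (E6_regularP k78) scalerA.
    by rewrite mulrC -scalerA.
  have -> : k = 72%N by apply/eqP; rewrite eqn_leq k72 andbT.
  have Z72 i : (i < 6)%N -> (E6_weight E6_regular (72 + i)).1 = Z0.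
    by move=> i6; apply/Z.eqb_eq/z1; rewrite mem_iota leq_addr /= ltn_add2l.
  have -> : (E6_weight E6_regular 72).1 = Z0 := Z72 0%N isT.
  rewrite zr0 scale0r lie_sumr big_seq; apply: big1 => i; rewrite mem_iota => i6.
  have i78 : (72 + i < 78)%N by rewrite -[78%N]/(72 + 6)%N ltn_add2l.
  by rewrite lieZr (E6_regularP i78) (Z72 i i6) zr0 scale0r scaler0.
move=> i; rewrite -c'E; have i78 : (i < 78)%N by rewrite -sz.
case: (ltnP i 72) => i72.
  have i73 : (i < 73)%N by apply: ltn_trans i72 _.
  have := v0 i; rewrite mem_iota /v i72 => /(_ i73)/eqP.
  by rewrite scaler_eq0 (negbTE (B6_neq0 i72)) orbF => /eqP.
have := v0 72%N; rewrite mem_iota /v ltnn => /(_ isT)/h_free.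
move=> /(_ (i - 72)%N); have -> : (72 + (i - 72) = i)%N by lia.
by apply; lia.
Qed.

Lemma basis_B6 : basis_of fullv B.
Proof. by rewrite /basis_of span_B6 eqxx free_B6. Qed.

Lemma dim_E6 : \dim {:L} = 78%N.
Proof. by rewrite -span_B6 (eqnP free_B6) size_B6. Qed.

End E6Algebra.

(** * The automorphisms and the bigrading *)

Section ProductAutomorphismData.

Definition svecZ (s : seq (Z * Z * Z)) : svec :=
  [seq (Z.to_N p.1.1, (p.1.2, p.2)) | p <- s].

Definition eis_omega (n : nat) : eis :=
  nth (1%BZ, Z0) [:: (1%BZ, Z0); (Z0, 1%BZ); ((-1)%BZ, (-1)%BZ)] n.

Definition ske (i : nat) : svec := skey i 1%BZ.
Definition skf (i : nat) : svec := skey (i + 36) 1%BZ.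

Definition sigma0_step (g : nat -> svec) (s : seq svec) (k : nat) : svec :=
  if (k < 6)%N then g k else
  let: (i, (c, p)) := E6_parent k in
  sscale (c, Z0) (sbr (g i) (nth [::] s p)).

Fixpoint sigma0_roots (g : nat -> svec) (n : nat) : seq svec :=
  if n is m.+1 then
    let s := sigma0_roots g m in rcons s (sigma0_step g s m)
  else [::].

Definition sigma0_e (i : nat) : svec :=
  nth [::] [:: ske 5; ske 2; ske 4; ske 3; ske 1; skey 71 1%BZ] i.

(** The last entry is the basis vector [x_35] of the highest root: this is the normalization of
    e_theta. *)
Definition sigma0_f (i : nat) : svec :=
  nth [::] [:: skf 5; skf 2; skf 4; skf 3; skf 1; skey 35 1%BZ] i.

(** Images of root vectors are forced by the recursion that defines them; that the outcome is a
    homomorphism is checked in [sigma0_auto]. *)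
Definition sigma0_mx : seq svec := Eval vm_compute in
  sigma0_roots sigma0_e 36 ++ sigma0_roots sigma0_f 36 ++
  mkseq (fun i => sbr (sigma0_e i) (sigma0_f i)) 6.

(** The exponent of omega is the sum of the coefficients of alpha_1 and alpha_6, at most 2 in a
    positive root, and its negative modulo 3 for negative roots. *)
Definition sigma1_degree (k : nat) : nat :=
  if (k < 72)%N then
    let r := E6_root (k %% 36)%N in
    let d := Z.to_nat (Z.add (nth Z0 r 0) (nth Z0 r 5)) in
    if (k < 36)%N then d else ((3 - d) %% 3)%N
  else 0%N.

Definition sigma1_mx : seq svec := Eval vm_compute in
  mkseq (fun k => sscale (eis_omega (sigma1_degree k)) (skey k 1%BZ)) 78.

(** Testing the first argument on the generators is enough: the x with [S [x, y] = [S x, S y]] for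
    all y are closed under linear combinations and, by the Jacobi identity, under brackets. *)
Definition smx_automorphism (S : seq svec) : bool :=
  all (fun g => all (fun b =>
    slin S (sbr (skey g 1%BZ) (skey b 1%BZ)) == sbr (nth [::] S g) (nth [::] S b))
    (iota 0 78)) (iota 0 6 ++ iota 36 6).

Definition smx_order3 (S : seq svec) : bool :=
  all (fun b => slin S (slin S (nth [::] S b)) == skey b 1%BZ) (iota 0 78).

(* G_2 is generated by e_4 (long root) and e_2 + e_3 + e_5 (short root); its
   basis is h_l, h_s followed by the positive and the negative root vectors. *)
Definition G2_el : svec := ske 3.
Definition G2_fl : svec := skf 3.
Definition G2_es : svec := sadd (ske 1) (sadd (ske 2) (ske 4)).
Definition G2_fs : svec := sadd (skf 1) (sadd (skf 2) (skf 4)).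

Definition G2_string (es el : svec) : seq svec :=
  let a1 := sbr es el in let a2 := sbr es a1 in let a3 := sbr es a2 in
  [:: el; es; a1; a2; a3; sbr el a3].

Definition G2_vectors : seq svec :=
  sbr G2_el G2_fl :: sbr G2_es G2_fs ::
  G2_string G2_es G2_el ++ G2_string G2_fs G2_fl.

(* For each (p, q) != (0, 0): the vectors w_1 and w_1^* of the octonion basis
   c, w_1, w_2, w_3, w_1^*, w_2^*, w_3^*, and a vector killed by G_2. *)
Definition block_data : seq (seq (Z * Z * Z) * seq (Z * Z * Z) * seq (Z * Z * Z)) :=
  [:: ([:: (28, 1, 0); (30, 1, 0); (58, 1, 0)],
    [:: (0, -1, 0); (5, -1, 0); (71, -1, 0)],
    [:: (16, 1, 0); (17, 1, 0); (19, -1, 0); (20, 1, 0); (67, -1, 0); (68, -1, 0)]);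
   ([:: (35, 1, 0); (36, 1, 0); (41, 1, 0)],
    [:: (22, -1, 0); (64, -1, 0); (66, -1, 0)],
    [:: (31, 1, 0); (32, 1, 0); (52, -1, 0); (53, -1, 0); (55, 1, 0); (56, -1, 0)]);
   ([:: (12, 1, 0); (13, 0, -1); (14, 1, 1)],
    [:: (48, 1, 0); (49, 0, -1); (50, 1, 1)],
    [:: (72, 2, -2); (73, 0, -3); (74, 1, -4); (75, 0, -6); (76, -1, -5); (77, -2, -4)]);
   ([:: (28, 1, 0); (30, -1, -1); (58, 0, 1)],
    [:: (0, -1, 0); (5, 1, 1); (71, 0, -1)],
    [:: (16, 1, 0); (17, 1, 0); (19, 1, 1); (20, -1, -1); (67, 0, -1); (68, 0, -1)]);
   ([:: (35, 1, 0); (36, -1, -1); (41, 0, 1)],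
    [:: (22, -1, 0); (64, 1, 1); (66, 0, -1)],
    [:: (31, 1, 0); (32, 1, 0); (52, 1, 1); (53, 1, 1); (55, 0, 1); (56, 0, -1)]);
   ([:: (12, 1, 0); (13, 1, 1); (14, 0, -1)],
    [:: (48, 1, 0); (49, 1, 1); (50, 0, -1)],
    [:: (72, 4, 2); (73, 3, 3); (74, 5, 4); (75, 6, 6); (76, 4, 5); (77, 2, 4)]);
   ([:: (28, 1, 0); (30, 0, 1); (58, -1, -1)],
    [:: (0, -1, 0); (5, 0, -1); (71, 1, 1)],
    [:: (16, 1, 0); (17, 1, 0); (19, 0, -1); (20, 0, 1); (67, 1, 1); (68, 1, 1)]);
   ([:: (35, 1, 0); (36, 0, 1); (41, -1, -1)],
    [:: (22, -1, 0); (64, 0, -1); (66, 1, 1)],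
    [:: (31, 1, 0); (32, 1, 0); (52, 0, -1); (53, 0, -1); (55, -1, -1); (56, 1, 1)])]%BZ.

Definition block_vectors (d : seq (Z * Z * Z) * seq (Z * Z * Z) * seq (Z * Z * Z)) :=
  let w1 := svecZ d.1.1 in let w1s := svecZ d.1.2 in
  let w3s := sbr G2_fs w1 in
  let w2s := sscale eisN1 (sbr G2_fl w3s) in
  let w3 := sscale eisN1 (sbr G2_es w1s) in
  [:: sbr G2_fs w2s; w1; sbr G2_el w3; w3; w1s; w2s; w3s; svecZ d.2].

Definition graded_vectors : seq svec := Eval vm_compute in
  G2_vectors ++ flatten (map block_vectors block_data).

(* The degree (p, q) of the k-th vector, encoded as 3 p + q. *)
Definition graded_degree (k : nat) : nat :=
  if (k < 14)%N then 0%N else ((k - 14) %/ 8)%N.+1.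

(** Six times each root basis vector in terms of the graded vectors; the factor 6 clears the
    denominators. *)
Definition graded_inverse : seq svec := Eval vm_compute in map svecZ
  [:: [:: (18, -2, 0); (42, -2, 0); (66, -2, 0)];
   [:: (3, 2, 0); (35, 0, -2); (59, 2, 2)];
   [:: (3, 2, 0); (35, 2, 2); (59, 0, -2)];
   [:: (2, 6, 0)];
   [:: (3, 2, 0); (35, -2, 0); (59, -2, 0)];
   [:: (18, -2, 0); (42, 0, -2); (66, 2, 2)];
   [:: (17, 2, 0); (41, 2, 0); (65, 2, 0)];
   [:: (4, -2, 0); (36, 0, 2); (60, -2, -2)];
   [:: (4, -2, 0); (36, -2, -2); (60, 0, 2)];
   [:: (4, 2, 0); (36, -2, 0); (60, -2, 0)];
   [:: (17, -2, 0); (41, 0, -2); (65, 2, 2)];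
   [:: (16, 2, 0); (40, 2, 0); (64, 2, 0)];
   [:: (5, 1, 0); (31, 2, 0); (55, 2, 0)];
   [:: (5, -1, 0); (31, 2, 2); (55, 0, -2)];
   [:: (5, -1, 0); (31, 0, -2); (55, 2, 2)];
   [:: (16, 2, 0); (40, 0, 2); (64, -2, -2)];
   [:: (14, 1, 0); (21, 1, 0); (38, 1, 0); (45, 1, 0); (62, 1, 0); (69, 1, 0)];
   [:: (14, -1, 0); (21, 1, 0); (38, -1, 0); (45, 1, 0); (62, -1, 0); (69, 1, 0)];
   [:: (6, 1, 0)];
   [:: (14, 1, 0); (21, -1, 0); (38, 0, 1); (45, 0, -1); (62, -1, -1); (69, 1, 1)];
   [:: (14, 1, 0); (21, 1, 0); (38, 0, 1); (45, 0, 1); (62, -1, -1); (69, -1, -1)];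
   [:: (19, 2, 0); (43, 2, 0); (67, 2, 0)];
   [:: (26, -2, 0); (50, -2, 0); (74, -2, 0)];
   [:: (7, 1, 0)];
   [:: (19, -2, 0); (43, 0, -2); (67, 2, 2)];
   [:: (20, -2, 0); (44, -2, 0); (68, -2, 0)];
   [:: (25, -2, 0); (49, -2, 0); (73, -2, 0)];
   [:: (20, 2, 0); (44, 0, 2); (68, -2, -2)];
   [:: (15, 2, 0); (39, 2, 0); (63, 2, 0)];
   [:: (24, -2, 0); (48, -2, 0); (72, -2, 0)];
   [:: (15, 2, 0); (39, 0, 2); (63, -2, -2)];
   [:: (22, -1, 0); (29, 1, 0); (46, -1, 0); (53, 1, 0); (70, -1, 0); (77, 1, 0)];
   [:: (22, 1, 0); (29, 1, 0); (46, 1, 0); (53, 1, 0); (70, 1, 0); (77, 1, 0)];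
   [:: (27, -2, 0); (51, -2, 0); (75, -2, 0)];
   [:: (28, 2, 0); (52, 2, 0); (76, 2, 0)];
   [:: (23, 2, 0); (47, 2, 0); (71, 2, 0)];
   [:: (23, 2, 0); (47, 0, 2); (71, -2, -2)];
   [:: (9, 2, 0); (32, 0, -2); (56, 2, 2)];
   [:: (9, 2, 0); (32, 2, 2); (56, 0, -2)];
   [:: (8, 6, 0)];
   [:: (9, 2, 0); (32, -2, 0); (56, -2, 0)];
   [:: (23, 2, 0); (47, -2, -2); (71, 0, 2)];
   [:: (28, 2, 0); (52, 0, 2); (76, -2, -2)];
   [:: (10, -2, 0); (33, 0, -2); (57, 2, 2)];
   [:: (10, -2, 0); (33, 2, 2); (57, 0, -2)];
   [:: (10, 2, 0); (33, 2, 0); (57, 2, 0)];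
   [:: (28, -2, 0); (52, 2, 2); (76, 0, -2)];
   [:: (27, -2, 0); (51, 0, -2); (75, 2, 2)];
   [:: (11, 1, 0); (34, 2, 0); (58, 2, 0)];
   [:: (11, -1, 0); (34, 2, 2); (58, 0, -2)];
   [:: (11, -1, 0); (34, 0, -2); (58, 2, 2)];
   [:: (27, -2, 0); (51, 2, 2); (75, 0, -2)];
   [:: (22, 1, 0); (29, -1, 0); (46, 0, 1); (53, 0, -1); (70, -1, -1); (77, 1, 1)];
   [:: (22, -1, 0); (29, -1, 0); (46, 0, -1); (53, 0, -1); (70, 1, 1); (77, 1, 1)];
   [:: (12, 1, 0)];
   [:: (22, 1, 0); (29, 1, 0); (46, -1, -1); (53, -1, -1); (70, 0, 1); (77, 0, 1)];
   [:: (22, 1, 0); (29, -1, 0); (46, -1, -1); (53, 1, 1); (70, 0, 1); (77, 0, -1)];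
   [:: (24, -2, 0); (48, 0, -2); (72, 2, 2)];
   [:: (15, 2, 0); (39, -2, -2); (63, 0, 2)];
   [:: (13, 1, 0)];
   [:: (24, 2, 0); (48, -2, -2); (72, 0, 2)];
   [:: (25, -2, 0); (49, 0, -2); (73, 2, 2)];
   [:: (20, -2, 0); (44, 2, 2); (68, 0, -2)];
   [:: (25, 2, 0); (49, -2, -2); (73, 0, 2)];
   [:: (26, -2, 0); (50, 0, -2); (74, 2, 2)];
   [:: (19, 2, 0); (43, -2, -2); (67, 0, 2)];
   [:: (26, -2, 0); (50, 2, 2); (74, 0, -2)];
   [:: (14, -1, 0); (21, -1, 0); (38, 1, 1); (45, 1, 1); (62, 0, -1); (69, 0, -1)];
   [:: (14, 1, 0); (21, -1, 0); (38, -1, -1); (45, 1, 1); (62, 0, 1); (69, 0, -1)];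
   [:: (16, 2, 0); (40, -2, -2); (64, 0, 2)];
   [:: (17, 2, 0); (41, -2, -2); (65, 0, 2)];
   [:: (18, -2, 0); (42, 2, 2); (66, 0, -2)];
   [:: (0, -6, 0); (1, -4, 0); (30, 1, 1); (37, 1, 0); (54, 0, -1); (61, 1, 0)];
   [:: (1, 2, 0); (30, 0, 2); (54, -2, -2)];
   [:: (1, 2, 0); (30, -2, -2); (54, 0, 2)];
   [:: (0, 6, 0)];
   [:: (1, 2, 0); (30, 2, 0); (54, 2, 0)];
   [:: (0, -6, 0); (1, -4, 0); (30, -1, 0); (37, 0, 1); (54, -1, 0); (61, -1, -1)]]%BZ.

End ProductAutomorphismData.

Lemma sigma0_auto : smx_automorphism sigma0_mx.
Proof. by vm_compute. Qed.

Lemma sigma1_auto : smx_automorphism sigma1_mx.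
Proof. by vm_compute. Qed.

Lemma sigma0_order3 : smx_order3 sigma0_mx.
Proof. by vm_compute. Qed.

Lemma sigma1_order3 : smx_order3 sigma1_mx.
Proof. by vm_compute. Qed.

Lemma graded_inverse_ok :
  all (fun b => slin graded_vectors (nth [::] graded_inverse b) == skey b 6%BZ)
    (iota 0 78).
Proof. by vm_compute. Qed.

Lemma graded_degree_ok :
  all (fun k => let v := nth [::] graded_vectors k in
    (slin sigma0_mx v == sscale (eis_omega (graded_degree k %/ 3)%N) v) &&
    (slin sigma1_mx v == sscale (eis_omega (graded_degree k %% 3)%N) v)) (iota 0 78).
Proof. by vm_compute. Qed.

(** Among the subspaces contained in [P] take one of maximal dimension: a vector of [P] outside it
    could be adjoined. *)
Lemma prop_vspace (K : fieldType) (V : vectType K) (P : V -> Prop) :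
  P 0 -> (forall a x y, P x -> P y -> P (a *: x + y)) ->
  exists W : {vspace V}, forall x, x \in W <-> P x.
Proof.
move=> P0 PD.
pose Q n := `[< exists W : {vspace V}, \dim W = n /\ forall x, x \in W -> P x >].
have Q0 : exists n, Q n.
  exists 0%N; apply/asboolP; exists 0%VS; rewrite dimv0; split=> // x.
  by rewrite memv0 => /eqP ->.
have Qb n : Q n -> (n <= \dim {:V})%N.
  by move=> /asboolP[W [<- _]]; apply: dimvS; apply: subvf.
case: (ex_maxnP Q0 Qb) => n /asboolP[W [dW PW]] maxn.
exists W => x; split=> [/PW //|Px]; apply/negPn/negP => xW.
have /maxn : Q (\dim (W + <[x]>)%VS).
  apply/asboolP; exists (W + <[x]>)%VS; split=> // _ /memv_addP[u uW [_ /vlineP[a ->] ->]].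
  by rewrite addrC; apply: PD => //; apply: PW.
have x0 : x != 0 by apply: contraNneq xW => ->; rewrite mem0v.
rewrite -dW dimv_disjoint_sum ?dim_vline ?x0 ?addn1 ?ltnn //.
apply/eqP; rewrite -subv0; apply/subvP => y /memv_capP[yW /vlineP[a yE]].
rewrite memv0 yE; have [->|a0] := eqVneq a 0; first by rewrite scale0r.
by move: yW; rewrite yE rpredZeq (negbTE a0) (negbTE xW).
Qed.

(** * Linear maps of E6 given by sparse matrices *)

Section LinearMaps.
Context {K : numFieldType} {L : finLieType K}.
Variable w : K.
Hypothesis ww : w ^+ 2 + w + 1 = 0.
Variables e f : 'I_6 -> L.
Hypothesis simpleL : simple_lie {:L}.
Hypothesis chevL : chevalley_generators cartan_E6 {:L} e f.
Local Notation B := (B6 e f).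
Local Notation ev := (seval w B).

Lemma size_B : size B == 78%N. Proof. by rewrite size_B6. Qed.
Definition B_tuple : 78.-tuple L := Tuple size_B.

Lemma B_coord (x : L) : x = \sum_(i < 78) coord B_tuple i x *: B`_i.
Proof.
have bB : basis_of fullv B_tuple := basis_B6 ww simpleL chevL.
exact: coord_basis bB (memvf x).
Qed.

Lemma chevalley_ind (P : L -> Prop) :
  P 0 -> (forall a x y, P x -> P y -> P (a *: x + y)) ->
  (forall x y, P x -> P y -> P [lie x, y]) ->
  (forall i, P (e i) /\ P (f i)) -> forall x, P x.
Proof.
move=> P0 PD Pl Pg x; have [W WP] := prop_vspace P0 PD.
apply/WP/(subvP (chevalley_gen chevL _ _)); last exact: memvf.
  by move=> y z /WP Py /WP Pz; apply/WP/Pl.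
by move=> i; split; apply/WP; case: (Pg i).
Qed.

Lemma chevalley_gens (P : L -> Prop) :
  (forall k, k \in iota 0 6 ++ iota 36 6 -> P B`_k) ->
  forall i, P (e i) /\ P (f i).
Proof.
move=> Pk i; rewrite e_inord f_inord -(B6_e e f) // -(B6_f e f) //.
by split; apply: Pk; rewrite mem_cat !mem_iota; have := ltn_ord i; lia.
Qed.

Definition smx_fun (S : seq svec) (x : L) : L :=
  \sum_(i < 78) coord B_tuple i x *: ev (nth [::] S i).

Lemma smx_fun_linear S : linear (smx_fun S).
Proof.
move=> a x y; rewrite /smx_fun scaler_sumr -big_split /=.
by apply: eq_bigr => i _; rewrite linearP scalerDl scalerA.
Qed.

HB.instance Definition _ S :=
  GRing.isLinear.Build K L L *:%R (smx_fun S) (smx_fun_linear S).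

Definition lmap S : 'End(L) := linfun (smx_fun S).

Lemma lmap_B S b : (b < 78)%N -> lmap S B`_b = ev (nth [::] S b).
Proof.
move=> b78; rewrite lfunE /= /smx_fun (bigD1 (Ordinal b78)) //=.
have fB : free B_tuple := free_B6 ww simpleL chevL.
rewrite (coord_free (Ordinal b78)  (Ordinal b78) fB) eqxx scale1r big1 ?addr0 // => i ib.
by rewrite (coord_free (Ordinal b78) i fB) eq_sym (negbTE ib) scale0r.
Qed.

Lemma lmap_ev S v : size S = 78%N -> lmap S (ev v) = ev (slin S v).
Proof.
move=> szS; rewrite seval_slin // linear_sum; apply: eq_bigr => p _.
rewrite linearZ /=; case: (ltnP (N.to_nat p.1) 78) => p78; first by rewrite lmap_B.
by rewrite !nth_default ?size_B6 ?szS // linear0 seval_nil.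
Qed.

Lemma eq_lfun_B (g g' : 'End(L)) : (forall b, (b < 78)%N -> g B`_b = g' B`_b) -> g = g'.
Proof.
move=> gg; apply/lfunP => x; rewrite (B_coord x) !linear_sum.
by apply: eq_bigr => i _; rewrite !linearZ /= gg.
Qed.

Lemma lmap_lie S : size S = 78%N -> smx_automorphism S ->
  forall x y, lmap S [lie x, y] = [lie lmap S x, lmap S y].
Proof.
move=> szS /allP autoS; apply: chevalley_ind => [y|a x y IHx IHy z|x y IHx IHy z|].
- by rewrite lie0x linear0 lie0x.
- by rewrite lieDl lieZl !linearP /= IHx IHy lieDl lieZl.
- by rewrite IHx lieAl linearB /= !(IHx, IHy) -lieAl.
apply: (@chevalley_gens (fun x => forall y, lmap S [lie x, y] = [lie lmap S x, lmap S y])) => k kg y.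
have k78 : (k < 78)%N by move: kg; rewrite mem_cat !mem_iota; lia.
rewrite (B_coord y) !linear_sum /=; apply: eq_bigr => i _.
have {autoS} := autoS k kg => /allP/(_ (val i)).
rewrite mem_iota (ltn_ord i) => /(_ isT) /eqP autoSi.
rewrite !linearZ /= (B6_lie ww chevL) // lmap_ev // autoSi.
by rewrite (ev_br ww chevL) !lmap_B.
Qed.

Lemma lmap_order3 S : size S = 78%N -> smx_order3 S -> forall x, iter 3 (lmap S) x = x.
Proof.
move=> szS /allP S3 x.
have -> : iter 3 (lmap S) x = (lmap S \o lmap S \o lmap S)%VF x.
  by rewrite !comp_lfunE.
rewrite [X in fun_of_lfun X](@eq_lfun_B _ \1%VF) ?id_lfunE // => b b78.
rewrite !comp_lfunE lmap_B // !lmap_ev // id_lfunE.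
by have := S3 b; rewrite mem_iota => /(_ b78)/eqP ->; rewrite seval_skey scale1r.
Qed.

Lemma lmap_auto S : size S = 78%N -> smx_automorphism S -> smx_order3 S ->
  lie_automorphism (lmap S).
Proof.
move=> szS autoS S3; split; last exact: lmap_lie.
by exists (fun x => lmap S (lmap S x)) => x; have /= := lmap_order3 szS S3 x.
Qed.

Lemma lie_automorphism_ext (g g' : 'End(L)) :
  lie_automorphism g -> lie_automorphism g' ->
  (forall k, k \in iota 0 6 ++ iota 36 6 -> g B`_k = g' B`_k) -> g = g'.
Proof.
move=> [_ gl] [_ g'l] gg; apply/lfunP; apply: chevalley_ind.
- by rewrite !linear0.
- by move=> a x y IHx IHy; rewrite !linearP /= IHx IHy.
- by move=> x y IHx IHy; rewrite gl g'l IHx IHy.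
exact: (@chevalley_gens (fun x => g x = g' x)).
Qed.

Definition sigma0 : 'End(L) := lmap sigma0_mx.
Definition sigma1 : 'End(L) := lmap sigma1_mx.

Lemma iter_sigma0 x : iter 3 sigma0 x = x.
Proof. exact: lmap_order3 sigma0_order3 x. Qed.

Lemma iter_sigma1 x : iter 3 sigma1 x = x.
Proof. exact: lmap_order3 sigma1_order3 x. Qed.

Lemma sigma0_lie x y : sigma0 [lie x, y] = [lie sigma0 x, sigma0 y].
Proof. exact: lmap_lie sigma0_auto x y. Qed.

Lemma sigma1_lie x y : sigma1 [lie x, y] = [lie sigma1 x, sigma1 y].
Proof. exact: lmap_lie sigma1_auto x y. Qed.

Lemma eval_omega n : (n < 3)%N -> eval_eis w (eis_omega n) = w ^+ n.
Proof.
have w2 : w ^+ 2 = - w - 1 by apply/eqP; rewrite -subr_eq0 -ww; apply/eqP; ring.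
case: n => [|[|[|]]] // _; rewrite /eval_eis /=.
- by rewrite zr0 zr1 mul0r addr0.
- by rewrite zr0 zr1 mul1r add0r.
by rewrite w2 zrN1; ring.
Qed.

Lemma w_order3 : w ^+ 3 = 1.
Proof.
apply/eqP; rewrite -subr_eq0; have -> : w ^+ 3 - 1 = (w - 1) * (w ^+ 2 + w + 1) by ring.
by rewrite ww mulr0.
Qed.

Lemma w_neq1 : w != 1.
Proof.
apply: contra_eq_neq ww => ->; have -> : 1 ^+ 2 + 1 + 1 = 3%:R :> K by ring.
by rewrite pnatr_eq0.
Qed.

Definition Gv (k : nat) : L := ev (nth [::] graded_vectors k).

Definition G_seq : seq L := mkseq Gv 78.

Lemma size_G : size G_seq == 78%N. Proof. by rewrite size_mkseq. Qed.
Definition G_tuple : 78.-tuple L := Tuple size_G.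

Lemma nth_G k : (k < 78)%N -> G_tuple`_k = Gv k.
Proof. by move=> k78; rewrite nth_mkseq. Qed.

(** There are 78 graded vectors, and they span because 6 is invertible. *)
Lemma basis_G : basis_of fullv G_tuple.
Proof.
rewrite basisEdim; apply/andP; split; last first.
  by rewrite size_mkseq (dim_E6 ww simpleL chevL).
rewrite -(span_B6 ww chevL); apply/span_subvP => _ /(nthP 0)[b bB <-].
have b78 : (b < 78)%N by rewrite size_B6 in bB.
have /allP/(_ b) := graded_inverse_ok; rewrite mem_iota => /(_ b78)/eqP.
move/(congr1 ev); rewrite seval_skey seval_slin // => E.
have n6 : zr 6%BZ != 0 :> K by rewrite zr_eq0.
rewrite -[B`_b](scalerK n6) -E; apply: rpredZ; apply: rpred_sum => p _.
apply: rpredZ; case: (ltnP (N.to_nat p.1) 78) => p78.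
  by rewrite -/(Gv _) -nth_G //; apply: memv_span; apply: mem_nth; rewrite size_mkseq.
by rewrite nth_default // seval_nil mem0v.
Qed.

End LinearMaps.

(** * The split octonions and the 7-dimensional module of G2 *)

Section OctonionData.

(* Entry (i, j) is (k, c) when e_i e_j - e_j e_i has imaginary part c e_k, in the
   basis c, w_1, w_2, w_3, w_1^*, w_2^*, w_3^* of Zorn vector matrices. *)
Definition oct_table : seq (seq (Z * Z)) :=
  [:: [:: (0, 0); (1, 2); (2, 2); (3, 2); (4, -2); (5, -2); (6, -2)];
      [:: (1, -2); (0, 0); (6, 2); (5, -2); (0, 1); (0, 0); (0, 0)];
      [:: (2, -2); (6, -2); (0, 0); (4, 2); (0, 0); (0, 1); (0, 0)];
      [:: (3, -2); (5, 2); (4, -2); (0, 0); (0, 0); (0, 0); (0, 1)];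
      [:: (4, 2); (0, -1); (0, 0); (0, 0); (0, 0); (3, -2); (2, 2)];
      [:: (5, 2); (0, 0); (0, -1); (0, 0); (3, 2); (0, 0); (1, -2)];
      [:: (6, 2); (0, 0); (0, 0); (0, -1); (2, -2); (1, 2); (0, 0)]]%BZ.

Definition oct_mul (i j : nat) : svec :=
  let: (k, c) := nth (Z0, Z0) (nth [::] oct_table i) j in
  if Z.eqb c Z0 then [::] else [:: (Z.to_N k, (c, Z0))].

Definition oct_gram (i j : nat) : Z :=
  if ~~ ((i < 7)%N && (j < 7)%N) then Z0
  else if (i == 0%N) && (j == 0%N) then 2%BZ
  else if [&& i != 0%N, j != 0%N & (i == j + 3)%N || (j == i + 3)%N] then 1%BZ else Z0.

Definition sstar (u v : svec) : svec :=
  foldr (fun p acc => foldr (fun q acc' =>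
    sadd (sscale (eis_mul p.2 q.2) (oct_mul (N.to_nat p.1) (N.to_nat q.1))) acc')
    acc v) [::] u.

Definition rho_comm (M N : seq svec) : seq svec :=
  mkseq (fun b => sadd (slin M (nth [::] N b)) (sscale eisN1 (slin N (nth [::] M b)))) 7.

Definition rho_string (es el : seq svec) : seq (seq svec) :=
  let a1 := rho_comm es el in let a2 := rho_comm es a1 in
  let a3 := rho_comm es a2 in [:: el; es; a1; a2; a3; rho_comm el a3].

(* The action of [G2_vectors] on the octonion basis. *)
Definition G2_rho : seq (seq svec) := Eval vm_compute in
  let el := map svecZ [:: [::]; [::]; [::]; [:: (2, 1, 0)]; [::]; [:: (6, -1, 0)]; [::]]%BZ in
  let fl := map svecZ [:: [::]; [::]; [:: (3, 1, 0)]; [::]; [::]; [::]; [:: (5, -1, 0)]]%BZ in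
  let es := map svecZ [:: [:: (5, 2, 0)]; [::]; [:: (0, -1, 0)]; [::]; [:: (3, -1, 0)]; [::]; [:: (1, 1, 0)]]%BZ in
  let fs := map svecZ [:: [:: (2, -2, 0)]; [:: (6, 1, 0)]; [::]; [:: (4, -1, 0)]; [::]; [:: (0, 1, 0)]; [::]]%BZ in
  rho_comm el fl :: rho_comm es fs :: rho_string es el ++ rho_string fs fl.

Definition oct (i : nat) : svec := skey i 1%BZ.

Definition forall7 (P : nat -> bool) : bool := all P (iota 0 7).

Definition skeyz (k : nat) (c : Z) : svec := if Z.eqb c Z0 then [::] else skey k c.

(** The polarization in u of the rule u(uv) = 2(u,u)v - 2(u,v)u for the commutator product, which
    stems from the alternative law of the octonions. Most of the later algebra of adapted bases is
    deduced from this identity, skewness and invariance of the form. *)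
Lemma oct_alternative :
  forall7 (fun i => forall7 (fun j => forall7 (fun k =>
    sadd (sstar (oct i) (sstar (oct j) (oct k))) (sstar (oct j) (sstar (oct i) (oct k)))
    == sadd (skeyz k (Z.mul 4%BZ (oct_gram i j)))
       (sadd (skeyz j (Z.mul (-2)%BZ (oct_gram i k))) (skeyz i (Z.mul (-2)%BZ (oct_gram j k))))))).
Proof. by vm_compute. Qed.

Lemma oct_skew :
  forall7 (fun i => forall7 (fun j =>
    sadd (sstar (oct i) (oct j)) (sstar (oct j) (oct i)) == [::])).
Proof. by vm_compute. Qed.

Definition scoef (k : nat) (v : svec) : eis :=
  foldr (fun p acc => if N.to_nat p.1 == k then eis_add p.2 acc else acc) (Z0, Z0) v.

Definition sgram (u v : svec) : eis :=
  foldr (fun p acc => foldr (fun q acc' =>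
    eis_add (eis_mul (eis_mul p.2 q.2) (oct_gram (N.to_nat p.1) (N.to_nat q.1), Z0)) acc')
    acc v) (Z0, Z0) u.

Lemma oct_assoc :
  forall7 (fun i => forall7 (fun j => forall7 (fun k =>
    sgram (sstar (oct i) (oct j)) (oct k) == sgram (oct i) (sstar (oct j) (oct k))))).
Proof. by vm_compute. Qed.

(** Multiplications are traceless; this will force the eigenvalues 2 and -2 of multiplication by c
    to have equal multiplicities. *)
Lemma oct_trace :
  forall7 (fun i => eis_zero (foldr (fun j acc =>
    eis_add (scoef j (sstar (oct i) (oct j))) acc) (Z0, Z0) (iota 0 7))).
Proof. by vm_compute. Qed.

Definition rho_row (a i : nat) : svec := nth [::] (nth [::] G2_rho a) i.

Lemma rho_derivation :
  all (fun a => forall7 (fun i => forall7 (fun j =>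
    slin (nth [::] G2_rho a) (sstar (oct i) (oct j))
    == sadd (sstar (rho_row a i) (oct j)) (sstar (oct i) (rho_row a j))))) (iota 0 14).
Proof. by vm_compute. Qed.

Lemma rho_skew :
  all (fun a => forall7 (fun i => forall7 (fun j =>
    eis_zero (eis_add (sgram (rho_row a i) (oct j)) (sgram (oct i) (rho_row a j))))))
   (iota 0 14).
Proof. by vm_compute. Qed.

(** All eight degrees carry the same seven-dimensional matrices, so statements about G2-modules need
    one proof only. *)
Lemma rho_blocks :
  all (fun a => all (fun b => all (fun k =>
    sbr (nth [::] graded_vectors a) (nth [::] graded_vectors (14 + 8 * b + k)%N) ==
    if (k < 7)%N then slin (take 7 (drop (14 + 8 * b) graded_vectors)) (rho_row a k)
    else [::]) (iota 0 8)) (iota 0 8)) (iota 0 14).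
Proof. by vm_compute. Qed.

End OctonionData.

Section Octonions.
Context {K : numFieldType}.
Variable w : K.
Hypothesis ww : w ^+ 2 + w + 1 = 0.
Local Notation V7 := 'rV[K]_7.

Definition oct_basis : seq V7 := mkseq (fun i => delta_mx 0 (inord i)) 7.
Local Notation OB := oct_basis.
Local Notation evo := (seval w OB).

Lemma size_oct : size OB = 7%N. Proof. exact: size_mkseq. Qed.

Lemma oct_nth (i : 'I_7) : OB`_i = delta_mx 0 i.
Proof. by rewrite nth_mkseq ?ltn_ord // inord_val. Qed.

Lemma oct_sum (u : V7) : u = \sum_(i < 7) u 0 i *: OB`_i.
Proof.
by rewrite [LHS]row_sum_delta; apply: eq_bigr => i _; rewrite oct_nth.
Qed.

Lemma evo_oct i : evo (oct i) = OB`_i.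
Proof. by rewrite seval_skey scale1r. Qed.

Lemma oct_ext (W : lmodType K) (F : V7 -> W) :
  linear F -> (forall i, (i < 7)%N -> F (evo (oct i)) = 0) -> forall u, F u = 0.
Proof.
move=> linF F0 u.
pose G : {linear V7 -> W} := HB.pack F (GRing.isLinear.Build K V7 W *:%R F linF).
rewrite -[F u]/(G u) (oct_sum u) linear_sum big1 // => i _.
by rewrite linearZ /= -evo_oct F0 ?scaler0 // ltn_ord.
Qed.

Definition star (u v : V7) : V7 :=
  \sum_(i < 7) \sum_(j < 7) (u 0 i * v 0 j) *: evo (oct_mul i j).

Definition gram (u v : V7) : K :=
  \sum_(i < 7) \sum_(j < 7) u 0 i * v 0 j * zr (oct_gram i j).

Lemma star_linear_r u : linear (star u).
Proof.
move=> a x y; rewrite /star scaler_sumr -big_split; apply: eq_bigr => i _ /=.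
rewrite scaler_sumr -big_split; apply: eq_bigr => j _ /=.
by rewrite !mxE scalerA -scalerDl; congr (_ *: _); ring.
Qed.

Lemma star_linear_l u : linear (star^~ u).
Proof.
move=> a x y; rewrite /star scaler_sumr -big_split; apply: eq_bigr => i _ /=.
rewrite scaler_sumr -big_split; apply: eq_bigr => j _ /=.
by rewrite !mxE scalerA -scalerDl; congr (_ *: _); ring.
Qed.

Lemma gram_linear_r u : linear (gram u : V7 -> K^o).
Proof.
move=> a x y; rewrite /gram scaler_sumr -big_split; apply: eq_bigr => i _ /=.
rewrite scaler_sumr -big_split; apply: eq_bigr => j _ /=.
by rewrite !mxE -[_ *: _]/(_ * _); ring.
Qed.

Lemma gramC u v : gram u v = gram v u.
Proof.
rewrite /gram exchange_big; apply: eq_bigr => j _; apply: eq_bigr => i _ /=.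
rewrite [u 0 i * _]mulrC; congr (_ * zr _); rewrite /oct_gram.
rewrite [(i < 7)%N && _]andbC [(i == 0%N :> nat) && (j == 0%N :> nat)]andbC.
by rewrite [[&& (i : nat) != 0%N, _ & _]]andbCA [(_ == _ + 3)%N || _]orbC.
Qed.

HB.instance Definition _ u :=
  GRing.isLinear.Build K V7 V7 *:%R (star u) (star_linear_r u).
HB.instance Definition _ u :=
  GRing.isLinear.Build K V7 K^o *:%R (gram u : V7 -> K^o) (gram_linear_r u).

Lemma starPl a x y v : star (a *: x + y) v = a *: star x v + star y v.
Proof. exact: star_linear_l. Qed.
Lemma starPr u a x y : star u (a *: x + y) = a *: star u x + star u y.
Proof. exact: star_linear_r. Qed.
Lemma gramPr u a x y : gram u (a *: x + y) = a * gram u x + gram u y.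
Proof. exact: gram_linear_r. Qed.
Lemma gramPl u a x y : gram (a *: x + y) u = a * gram x u + gram y u.
Proof. by rewrite gramC gramPr ![gram u _]gramC. Qed.

Lemma star0l v : star 0 v = 0.
Proof. by have := starPl (-1) 0 0 v; rewrite scaler0 addr0 scaleN1r addNr. Qed.
Lemma star0r v : star v 0 = 0. Proof. exact: linear0. Qed.
Lemma starDl x y v : star (x + y) v = star x v + star y v.
Proof. by have := starPl 1 x y v; rewrite !scale1r. Qed.
Lemma starDr x y v : star v (x + y) = star v x + star v y.
Proof. exact: linearD. Qed.
Lemma starZl a x v : star (a *: x) v = a *: star x v.
Proof. by have := starPl a x 0 v; rewrite star0l !addr0. Qed.
Lemma starZr a x v : star v (a *: x) = a *: star v x.
Proof. exact: linearZ. Qed.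
Lemma starNl x v : star (- x) v = - star x v.
Proof. by rewrite -scaleN1r starZl scaleN1r. Qed.
Lemma starNr x v : star v (- x) = - star v x.
Proof. exact: linearN. Qed.
Lemma star_suml I (r : seq I) (P : pred I) F v :
  star (\sum_(i <- r | P i) F i) v = \sum_(i <- r | P i) star (F i) v.
Proof. exact: (big_morph (star^~ v) (fun x y => starDl x y v) (star0l v)). Qed.
Lemma gram0r v : gram v 0 = 0. Proof. exact: (linear0 (gram v : V7 -> K^o)). Qed.
Lemma gram0l v : gram 0 v = 0. Proof. by rewrite gramC gram0r. Qed.
Lemma gramZr a x v : gram v (a *: x) = a * gram v x.
Proof. by have := gramPr v a x 0; rewrite gram0r !addr0. Qed.
Lemma gramZl a x v : gram (a *: x) v = a * gram x v.
Proof. by rewrite gramC gramZr gramC. Qed.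
Lemma gramDr x y v : gram v (x + y) = gram v x + gram v y.
Proof. by have := gramPr v 1 x y; rewrite scale1r mul1r. Qed.
Lemma gramDl x y v : gram (x + y) v = gram x v + gram y v.
Proof. by rewrite gramC gramDr ![gram v _]gramC. Qed.
Lemma gramNr x v : gram v (- x) = - gram v x.
Proof. by rewrite -scaleN1r gramZr mulN1r. Qed.
Lemma gramNl x v : gram (- x) v = - gram x v.
Proof. by rewrite gramC gramNr gramC. Qed.

Lemma star_oct i j : star OB`_i OB`_j = evo (oct_mul i j).
Proof.
case: (ltnP i 7) => i7; last first.
  rewrite [OB`_i]nth_default ?size_oct // star0l /oct_mul.
  by rewrite (@nth_default _ [::] oct_table) // nth_nil seval_nil.
case: (ltnP j 7) => j7; last first.
  rewrite [OB`_j]nth_default ?size_oct // star0r /oct_mul (@nth_default _ (Z0, Z0)) ?seval_nil //.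
  by move: i i7; do 7!case=> //.
rewrite -[ i]/(val (Ordinal i7)) -[j]/(val (Ordinal j7)) !oct_nth /star.
rewrite (bigD1 (Ordinal i7)) //= (bigD1 (Ordinal j7)) //= !mxE !eqxx mulr1 scale1r.
rewrite big1 ?addr0 => [|l /negbTE lj]; last by rewrite !mxE eqxx lj mulr0 scale0r.
rewrite big1 ?addr0 // => l /negbTE li; rewrite big1 // => m _.
by rewrite !mxE li mul0r scale0r.
Qed.

Lemma gram_oct i j : gram OB`_i OB`_j = zr (oct_gram i j).
Proof.
case: (ltnP i 7) => i7; last first.
  by rewrite [OB`_i]nth_default ?size_oct // gram0l /oct_gram ltnNge i7.
case: (ltnP j 7) => j7; last first.
  by rewrite [OB`_j]nth_default ?size_oct // gram0r /oct_gram andbC ltnNge j7.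
rewrite -[ i]/(val (Ordinal i7)) -[j]/(val (Ordinal j7)) !oct_nth /gram.
rewrite (bigD1 (Ordinal i7)) //= (bigD1 (Ordinal j7)) //= !mxE !eqxx mulr1 mul1r.
rewrite big1 ?addr0 => [|l /negbTE lj]; last by rewrite !mxE eqxx lj mulr0 mul0r.
rewrite big1 ?addr0 // => l /negbTE li; rewrite big1 // => m _.
by rewrite !mxE li !mul0r.
Qed.

Lemma star_ev u v : star (evo u) (evo v) = evo (sstar u v).
Proof.
elim: u => [|[k c] u IHu]; first by rewrite !seval_nil star0l.
rewrite seval_cons starPl IHu /= -/(sstar u v).
elim: v (sstar u v) {IHu} => [|[l d] v IHv] z.
  by rewrite seval_nil star0r scaler0 add0r.
rewrite seval_cons starPr /= sevalD // sevalZ // -IHv eval_eisM // star_oct.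
by rewrite scalerDr scalerA addrA.
Qed.

Lemma gram_ev u v : gram (evo u) (evo v) = eval_eis w (sgram u v).
Proof.
elim: u => [|[k c] u IHu]; first by rewrite !seval_nil gram0l eval_eis0.
rewrite seval_cons gramPl IHu /= -/(sgram u v).
elim: v (sgram u v) {IHu} => [|[l d] v IHv] z.
  by rewrite seval_nil gram0r mulr0 add0r.
rewrite seval_cons gramPr /= eval_eisD !eval_eisM // -IHv gram_oct eval_eisZ.
by ring.
Qed.

Lemma evo_skeyz k c : evo (skeyz k c) = zr c *: OB`_k.
Proof.
rewrite /skeyz; case: ifP => [/Z.eqb_eq ->|_]; last exact: seval_skey.
by rewrite seval_nil zr0 scale0r.
Qed.

Lemma forall7P P : forall7 P -> forall i, (i < 7)%N -> P i.
Proof. by move=> /allP PP i i7; apply: PP; rewrite mem_iota. Qed.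

Lemma star_alternative u t v :
  star u (star t v) + star t (star u v) =
  4%:R * gram u t *: v - 2%:R * gram u v *: t - 2%:R * gram t v *: u.
Proof.
apply/eqP; rewrite -subr_eq0; apply/eqP; move: u; apply: oct_ext => [a x y|i i7].
  apply/rowP => k; rewrite !(starPl, starPr, gramPl) !mxE; ring.
move: t; apply: oct_ext => [a x y|j j7].
  apply/rowP => k; rewrite !(starPl, starPr, gramPl, gramPr) !mxE; ring.
move: v; apply: oct_ext => [a x y|k k7].
  apply/rowP => l; rewrite !(starPl, starPr, gramPl, gramPr) !mxE; ring.
have /eqP := forall7P (forall7P (forall7P oct_alternative i7) j7) k7.
move/(congr1 evo); rewrite !sevalD // !evo_skeyz -!star_ev => ->.
rewrite !evo_oct !gram_oct !zrM (_ : zr 4%BZ = 4%:R) // (_ : zr (-2)%BZ = - 2%:R) //.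
by rewrite !mulNr !scaleNr !addrA subrr.
Qed.

Lemma star_skew u v : star u v = - star v u.
Proof.
apply/eqP; rewrite -subr_eq0 opprK; apply/eqP; move: u; apply: oct_ext => [a x y|i i7].
  by apply/rowP => k; rewrite !(starPl, starPr) !mxE; ring.
move: v; apply: oct_ext => [a x y|j j7].
  by apply/rowP => k; rewrite !(starPl, starPr) !mxE; ring.
have /eqP := forall7P (forall7P oct_skew i7) j7.
by move/(congr1 evo); rewrite sevalD // seval_nil -!star_ev.
Qed.

Lemma gram_assoc u v t : gram (star u v) t = gram u (star v t).
Proof.
apply/eqP; rewrite -subr_eq0; apply/eqP.
move: u; apply: (@oct_ext K^o) => [a x y|i i7].
  by rewrite !(starPl, starPr, gramPl, gramPr) -[_ *: _]/(_ * _); ring.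
move: v; apply: (@oct_ext K^o) => [a x y|j j7].
  by rewrite !(starPl, starPr, gramPl, gramPr) -[_ *: _]/(_ * _); ring.
move: t; apply: (@oct_ext K^o) => [a x y|k k7].
  by rewrite !(starPl, starPr, gramPl, gramPr) -[_ *: _]/(_ * _); ring.
have /eqP := forall7P (forall7P (forall7P oct_assoc i7) j7) k7.
by rewrite !star_ev !gram_ev => ->; rewrite subrr.
Qed.

Lemma gram_nondeg u : (forall v, gram u v = 0) -> u = 0.
Proof.
move=> u0; apply/rowP => i; rewrite mxE.
have lin1 j k (c : Z) : c != Z0 -> (forall l : 'I_7, oct_gram l j = if l == k then c else Z0) ->
    (j < 7)%N -> u 0 k = 0.
  move=> c0 gl j7; have := u0 OB`_j; rewrite {1}(oct_sum u).
  have -> : gram (\sum_(i < 7) u 0 i *: OB`_i) OB`_j = \sum_(i < 7) u 0 i * gram OB`_i OB`_j.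
    rewrite gramC (linear_sum (gram OB`_j : V7 -> K^o)); apply: eq_bigr => l _.
    by rewrite /= gramZr gramC.
  rewrite (bigD1 k) //= gram_oct gl eqxx big1 => [|l /negbTE lk].
    by rewrite addr0 => /eqP; rewrite mulf_eq0 zr_eq0 (negbTE c0) orbF => /eqP.
  by rewrite gram_oct gl lk zr0 mulr0.
(* The index dual to i under the form: c is paired with itself and each w with its partner three
   places on. *)
pose j := if i == 0 :> nat then 0%N else if (i < 4)%N then (i + 3)%N else (i - 3)%N.
apply: (lin1 j i (if i == 0 :> nat then 2%BZ else 1%BZ)); rewrite /j.
- by case: ifP.
- by case: i {j} => [[|[|[|[|[|[|[|]]]]]]] // i7] [[|[|[|[|[|[|[|]]]]]]] // l7].
by case: i {j} => [[|[|[|[|[|[|[|]]]]]]] // i7].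
Qed.

Lemma evo_scoef v (j : 'I_7) : (evo v) 0 j = eval_eis w (scoef j v).
Proof.
elim: v => [|[k c] v IHv]; first by rewrite seval_nil mxE eval_eis0.
rewrite seval_cons !mxE IHv /=; case: eqP => [->|kj].
  by rewrite oct_nth mxE !eqxx mulr1 eval_eisD.
case: (ltnP (N.to_nat k) 7) => k7; last by rewrite nth_default ?size_oct // mxE mulr0 add0r.
rewrite -[N.to_nat k]/(val (Ordinal k7)) oct_nth mxE eqxx /=.
by rewrite -val_eqE /= eq_sym; move/eqP/negbTE: kj => ->; rewrite mulr0 add0r.
Qed.

Definition star_mx (u : V7) : 'M[K]_7 := lin1_mx (star u).

Lemma mul_star_mx u v : v *m star_mx u = star u v.
Proof. exact: mul_rV_lin1. Qed.

Lemma star_mx_trace u : \tr (star_mx u) = 0.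
Proof.
move: u; apply: (@oct_ext K^o) => [a x y|i i7].
  rewrite /mxtrace scaler_sumr -big_split; apply: eq_bigr => j _ /=.
  by rewrite !mxE starPl !mxE.
have := forall7P oct_trace i7 => /(eval_eis0 w).
move=> tr0; rewrite -[RHS]tr0 /mxtrace.
have foldE (s : seq nat) : eval_eis w (foldr (fun j acc =>
    eis_add (scoef j (sstar (oct i) (oct j))) acc) (Z0, Z0) s) =
    \sum_(j <- s) eval_eis w (scoef j (sstar (oct i) (oct j))).
  elim: s => [|j s IHs]; first by rewrite big_nil eval_eis0.
  by rewrite big_cons -IHs -eval_eisD.
rewrite foldE -[iota 0 7]/(index_iota 0 7) big_mkord; apply: eq_bigr => j _.
by rewrite -evo_scoef -star_ev mxE -oct_nth evo_oct evo_oct.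
Qed.

Definition derivation (D : 'M[K]_7) :=
  forall u v, star u v *m D = star (u *m D) v + star u (v *m D).

Definition rho_mx (a : nat) : 'M[K]_7 := \matrix_(i < 7) evo (rho_row a i).

Lemma mul_oct_rho a i : (i < 7)%N -> OB`_i *m rho_mx a = evo (rho_row a i).
Proof.
move=> i7; rewrite -[ i]/(val (Ordinal i7)) oct_nth -rowE; exact: rowK.
Qed.

Lemma derivation_lin a D E : derivation D -> derivation E -> derivation (a *: D + E).
Proof.
move=> dD dE u v; rewrite !mulmxDr -!scalemxAr dD dE.
by rewrite starPl starPr scalerDr addrACA.
Qed.

Lemma rho_der a : (a < 14)%N -> derivation (rho_mx a).
Proof.
move=> a14 u v; apply/eqP; rewrite -subr_eq0; apply/eqP.
move: u; apply: oct_ext => [b x y|i i7].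
  by rewrite !(starPl, starPr, mulmxDl, =^~ scalemxAl); apply/rowP => k; rewrite !mxE; ring.
move: v; apply: oct_ext => [b x y|j j7].
  by rewrite !(starPl, starPr, mulmxDl, =^~ scalemxAl); apply/rowP => k; rewrite !mxE; ring.
have /allP/(_ a) := rho_derivation; rewrite mem_iota => /(_ a14).
move=> /forall7P/(_ i i7)/forall7P/(_ j j7)/eqP/(congr1 evo).
rewrite sevalD // -!star_ev seval_slin // !evo_oct.
have -> : star OB`_i OB`_j *m rho_mx a =
    \sum_(p <- sstar (oct i) (oct j)) eval_eis w p.2 *:
      evo (nth [::] (nth [::] G2_rho a) (N.to_nat p.1)).
  rewrite -!evo_oct star_ev /seval mulmx_suml; apply: eq_bigr => p _.
  rewrite -scalemxAl; congr (_ *: _); case: (ltnP (N.to_nat p.1) 7) => p7.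
    exact: mul_oct_rho.
  rewrite [OB`_(N.to_nat p.1)]nth_default ?size_oct // mul0mx.
  rewrite (@nth_default _ [::] (nth [::] G2_rho a)) ?big_nil //.
  by move: a a14 {i i7 j j7}; do 14!case=> //.
by move=> ->; rewrite !mul_oct_rho // subrr.
Qed.

Lemma rho_gram_skew a u v : (a < 14)%N -> gram (u *m rho_mx a) v + gram u (v *m rho_mx a) = 0.
Proof.
move=> a14; move: u; apply: (@oct_ext K^o) => [b x y|i i7].
  by rewrite !(gramPl, mulmxDl, =^~ scalemxAl) -[_ *: _]/(_ * _); ring.
move: v; apply: (@oct_ext K^o) => [b x y|j j7].
  by rewrite !(gramPr, mulmxDl, =^~ scalemxAl) -[_ *: _]/(_ * _); ring.
have /allP/(_ a) := rho_skew; rewrite mem_iota => /(_ a14).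
move=> /forall7P/(_ i i7)/forall7P/(_ j j7)/(eval_eis0 w).
by rewrite eval_eisD -!gram_ev !evo_oct !mul_oct_rho.
Qed.

End Octonions.

(** * Derivations of the octonion product: a 14-dimensional space *)

Section DerivationData.

(* The (i, j, l) component of the derivation equation
   D(e_i e_j) - D(e_i) e_j - e_i D(e_j) = 0, as a linear form in the entries
   D_kl, indexed by 7 k + l. *)
Definition der_form (i j l : nat) : svec :=
  foldr (fun (t : svec) acc => sadd t acc) [::]
   ([seq [:: (N.of_nat (7 * N.to_nat p.1 + l)%N, p.2)] | p <- oct_mul i j] ++
    [seq sscale eisN1 [seq (N.of_nat (7 * i + k)%N, p.2) | p <- oct_mul k j & N.to_nat p.1 == l]
      | k <- iota 0 7] ++
    [seq sscale eisN1 [seq (N.of_nat (7 * j + k)%N, p.2) | p <- oct_mul i k & N.to_nat p.1 == l]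
      | k <- iota 0 7]).

(* A derivation is determined by these entries. *)
Definition der_pivots : seq (nat * nat) :=
  [:: (3, 2); (2, 3); (2, 1); (3, 1); (1, 2); (1, 3); (0, 5); (0, 6); (0, 1);
      (0, 2); (0, 3); (0, 4); (1, 1); (2, 2)].

(* 4 D_kl as a combination of derivation equations, modulo the pivots. *)
Definition der_certificate : seq (Z * seq (Z * Z * Z * Z)) :=
  [:: (0, [:: (0, 1, 1, -2)]); (7, [:: (0, 1, 0, 2)]);
   (11, [:: (0, 1, 4, 1)]); (12, [:: (0, 1, 5, 1)]);
   (13, [:: (0, 1, 6, 1)]); (14, [:: (0, 2, 0, 2)]);
   (18, [:: (0, 2, 4, 1)]); (19, [:: (0, 2, 5, 1)]);
   (20, [:: (0, 2, 6, 1)]); (21, [:: (0, 3, 0, 2)]);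
   (24, [:: (2, 3, 4, -2); (1, 4, 0, -4); (0, 1, 1, -2)]); (25, [:: (0, 3, 4, 1)]);
   (26, [:: (0, 3, 5, 1)]); (27, [:: (0, 3, 6, 1)]);
   (28, [:: (0, 4, 0, -2)]); (29, [:: (0, 4, 1, -1)]);
   (30, [:: (0, 4, 2, -1)]); (31, [:: (0, 4, 3, -1)]);
   (32, [:: (1, 4, 0, -4); (0, 1, 1, -2)]); (33, [:: (2, 3, 5, 2)]);
   (34, [:: (2, 3, 6, 2)]); (35, [:: (0, 5, 0, -2)]);
   (36, [:: (0, 5, 1, -1)]); (37, [:: (0, 5, 2, -1)]);
   (38, [:: (0, 5, 3, -1)]); (39, [:: (1, 3, 4, -2)]);
   (40, [:: (2, 5, 0, -4); (0, 1, 1, -2)]); (41, [:: (1, 3, 6, -2)]);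
   (42, [:: (0, 6, 0, -2)]); (43, [:: (0, 6, 1, -1)]);
   (44, [:: (0, 6, 2, -1)]); (45, [:: (0, 6, 3, -1)]);
   (46, [:: (1, 2, 4, 2)]); (47, [:: (1, 2, 5, 2)]);
   (48, [:: (1, 2, 6, 2)])]%BZ.

Definition der_combination (s : seq (Z * Z * Z * Z)) : svec :=
  foldr (fun t acc => let: (i, j, l, c) := t in
    sadd (sscale (c, Z0) (der_form (Z.to_nat i) (Z.to_nat j) (Z.to_nat l))) acc)
    [::] s.

Definition der_certified (k : nat) : bool :=
  ((k %/ 7, k %% 7)%N \in der_pivots) ||
  has (fun t => (Z.to_nat t.1 == k) &&
    all (fun p => (((N.to_nat p.1) %/ 7, (N.to_nat p.1) %% 7)%N \in der_pivots))
      (sadd (skey k (-4)%BZ) (der_combination t.2))) der_certificate.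

Lemma der_certificate_ok : all der_certified (iota 0 49).
Proof. by vm_compute. Qed.

(* The coordinates of a derivation in the basis [G2_rho]: p-th coordinate is
   [sum of c D_ij] / d over the listed (i, j, c). *)
Definition der_coords : seq (seq (nat * nat * Z) * Z) :=
  [:: ([:: (2, 2, 1%BZ); (1, 1, 2%BZ)], 1%BZ); ([:: (1, 1, 1%BZ)], 1%BZ);
      ([:: (3, 2, 1%BZ)], 1%BZ); ([:: (0, 5, 1%BZ)], 2%BZ); ([:: (0, 6, 1%BZ)], 2%BZ);
      ([:: (0, 1, 1%BZ)], 4%BZ); ([:: (2, 1, 1%BZ)], 6%BZ); ([:: (3, 1, 1%BZ)], (-6)%BZ);
      ([:: (2, 3, 1%BZ)], 1%BZ); ([:: (0, 2, 1%BZ)], (-2)%BZ); ([:: (0, 3, 1%BZ)], 2%BZ);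
      ([:: (0, 4, 1%BZ)], (-4)%BZ); ([:: (1, 2, 1%BZ)], (-6)%BZ); ([:: (1, 3, 1%BZ)], (-6)%BZ)]%N.

Definition der_coord_form (p : nat) : svec :=
  foldr (fun t acc => sadd [:: (N.of_nat (7 * t.1.1 + t.1.2)%N, (t.2, Z0))] acc) [::]
    (nth ([::], 1%BZ) der_coords p).1.

Definition rho_entries (a : nat) : svec :=
  flatten [seq [seq (N.of_nat (7 * i + N.to_nat p.1)%N, p.2) | p <- rho_row a i] | i <- iota 0 7].

Definition sdot (u v : svec) : eis :=
  foldr (fun p acc => eis_add (eis_mul p.2 (scoef (N.to_nat p.1) v)) acc) (Z0, Z0) u.

Lemma der_coords_rho :
  all (fun p => all (fun a => sdot (der_coord_form p) (rho_entries a) ==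
    (if p == a then (nth ([::], 1%BZ) der_coords p).2 else Z0, Z0)) (iota 0 14) &&
    all (fun q => N.to_nat q.1 < 49)%N (der_coord_form p)) (iota 0 14)
  && all (fun p => ~~ Z.eqb (nth ([::], 1%BZ) der_coords p).2 Z0) (iota 0 14).
Proof. by vm_compute. Qed.

(* Each pivot is a multiple of a coordinate, except (2, 2), the difference of two. *)
Lemma der_pivots_coords :
  all (fun t : nat * nat => has (fun p => (der_coord_form p == [:: (N.of_nat (7 * t.1 + t.2)%N, (1%BZ, Z0))])
    || ((t == (2, 2)%N) && (p == 0%N))) (iota 0 14)) der_pivots.
Proof. by vm_compute. Qed.

Lemma rho_entries_ok :
  all (fun a => all (fun n => scoef n (rho_entries a) ==
    scoef (n %% 7)%N (rho_row a (n %/ 7)%N)) (iota 0 49)) (iota 0 14).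
Proof. by vm_compute. Qed.

End DerivationData.

Section Derivations.
Context {K : numFieldType}.
Variable w : K.
Hypothesis ww : w ^+ 2 + w + 1 = 0.
Local Notation OB := (@oct_basis K).
Local Notation evo := (seval w OB).
Local Notation star := (star w).
Local Notation derivation := (derivation w).
Local Notation rho_mx := (rho_mx w).

Definition mx_entries (D : 'M[K]_7) : seq K^o :=
  mkseq (fun n => D (inord (n %/ 7)) (inord (n %% 7))) 49.

Definition mx_form (D : 'M[K]_7) (v : svec) : K := seval w (mx_entries D) v.

Lemma mx_entriesE D (i j : 'I_7) : (mx_entries D)`_(7 * i + j) = D i j.
Proof.
rewrite nth_mkseq; last by have := ltn_ord i; have := ltn_ord j; lia.
by rewrite mulnC divnMDl // modnMDl divn_small // modn_small // addn0 !inord_val.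
Qed.

Lemma mx_entries_inord D i j : (i < 7)%N -> (j < 7)%N ->
  (mx_entries D)`_(7 * i + j) = D (inord i) (inord j).
Proof. by move=> i7 j7; rewrite -mx_entriesE !inordK. Qed.

Lemma mx_formP a D E v : mx_form (a *: D + E) v = a * mx_form D v + mx_form E v.
Proof.
rewrite /mx_form /seval mulr_sumr -big_split; apply: eq_bigr => p _ /=.
case: (ltnP (N.to_nat p.1) 49) => p49.
  by rewrite !(nth_mkseq 0) // !mxE -![_ *: _]/(_ * _); ring.
by rewrite !nth_default ?size_mkseq // !scaler0 mulr0 addr0.
Qed.

Lemma evo_coef v (l : 'I_7) : evo v 0 l =
  \sum_(p <- v | N.to_nat p.1 == l) eval_eis w p.2.
Proof.
rewrite /seval summxE [RHS]big_mkcond; apply: eq_bigr => p _; rewrite mxE.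
case: (ltnP (N.to_nat p.1) 7) => p7; last first.
  rewrite nth_default ?size_oct // mxE mulr0; case: eqP => // pl.
  by move: p7; rewrite pl leqNgt ltn_ord.
rewrite -[N.to_nat p.1]/(val (Ordinal p7)) oct_nth mxE eqxx /=.
by rewrite -val_eqE /= eq_sym; case: eqP; rewrite ?mulr1 ?mulr0.
Qed.

Lemma oct_mul_lt i j : (i < 7)%N -> (j < 7)%N ->
  {in oct_mul i j, forall p, (N.to_nat p.1 < 7)%N}.
Proof.
have : forall7 (fun i => forall7 (fun j => all (fun p => N.to_nat p.1 < 7)%N (oct_mul i j))).
  by vm_compute.
by move=> /forall7P + i7 => /(_ i i7)/forall7P + j7 => /(_ j j7)/allP.
Qed.

Lemma foldr_sadd (W : vectType K) (B : seq W) (s : seq svec) :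
  seval w B (foldr (fun (t : svec) acc => sadd t acc) [::] s) = \sum_(t <- s) seval w B t.
Proof.
elim: s => [|t s IHs]; first by rewrite big_nil seval_nil.
by rewrite big_cons /= sevalD // IHs.
Qed.

Lemma der_form0 D i j l : derivation D -> (i < 7)%N -> (j < 7)%N -> (l < 7)%N ->
  mx_form D (der_form i j l) = 0.
Proof.
move=> derD i7 j7 l7; have := derD OB`_i OB`_j => /rowP/(_ (inord l)).
have starE m n : (m < 7)%N -> (n < 7)%N ->
    star OB`_m OB`_n 0 (inord l) = \sum_(p <- oct_mul m n | N.to_nat p.1 == l) eval_eis w p.2.
  by move=> m7 n7; rewrite star_oct // evo_coef inordK.
have octD m : (m < 7)%N -> OB`_m *m D = \sum_(k < 7) D (inord m) k *: OB`_k.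
  move=> m7; rewrite -{1}(inordK m7) oct_nth -rowE [LHS]oct_sum.
  by apply: eq_bigr => k _; rewrite mxE.
rewrite !mxE !octD // => E.
rewrite /mx_form /der_form foldr_sadd !big_cat !big_map.
have -> : \sum_(p <- oct_mul i j) seval w (mx_entries D)
      [:: (N.of_nat (7 * N.to_nat p.1 + l), p.2)] =
    \sum_k (star OB`_i OB`_j) 0 k * D k (inord l).
  under [RHS]eq_bigr => k _ do rewrite star_oct // evo_coef mulr_suml.
  rewrite (exchange_big_dep xpredT) //= big_seq [RHS]big_seq; apply: eq_bigr => p pin.
  have p7 := oct_mul_lt i7 j7 pin.
  rewrite (big_pred1 (inord (N.to_nat p.1))) => [|k]; last first.
    by rewrite [RHS]/= -val_eqE /= inordK // eq_sym.
  by rewrite /seval big_seq1 /= Nnat.Nat2N.id mx_entries_inord.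
have half m n (F : nat -> svec) : (m < 7)%N -> (n < 7)%N ->
    (forall k : 'I_7, \sum_(p <- F k | N.to_nat p.1 == l) eval_eis w p.2 =
       star OB`_k OB`_n 0 (inord l)) ->
    \sum_(k <- iota 0 7) seval w (mx_entries D) (sscale eisN1
      [seq (N.of_nat (7 * m + k), p.2) | p <- F k & N.to_nat p.1 == l]) =
    - star (OB`_m *m D) OB`_n 0 (inord l).
  move=> m7 n7 FE; rewrite octD //.
  rewrite -[iota 0 7]/(index_iota 0 7) big_mkord.
  have -> : star (\sum_(k < 7) D (inord m) k *: OB`_k) OB`_n =
      \sum_(k < 7) D (inord m) k *: star OB`_k OB`_n.
    by rewrite star_suml; apply: eq_bigr => k _; rewrite starZl.
  rewrite summxE -sumrN; apply: eq_bigr => k _.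
  rewrite sevalN // mxE -FE /seval big_map big_filter mulr_sumr; congr (- _).
  apply: eq_bigr => p _ /=; rewrite Nnat.Nat2N.id -{1}(inordK m7) mx_entriesE.
  by rewrite -[_ *: _]/(_ * _) mulrC.
rewrite (half i j (fun k => oct_mul k j)) // => [|k]; last by rewrite starE ?ltn_ord.
have -> : \sum_(k <- iota 0 7) seval w (mx_entries D) (sscale eisN1
      [seq (N.of_nat (7 * j + k), p.2) | p <- oct_mul i k & N.to_nat p.1 == l]) =
    - star OB`_i (OB`_j *m D) 0 (inord l).
  rewrite -[iota 0 7]/(index_iota 0 7) big_mkord octD // linear_sum summxE -sumrN.
  apply: eq_bigr => k _; rewrite sevalN // linearZ /= mxE starE ?ltn_ord //.
  rewrite /seval big_map big_filter mulr_sumr; congr (- _).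
  apply: eq_bigr => p _ /=; rewrite Nnat.Nat2N.id -{1}(inordK j7) mx_entriesE.
  by rewrite -[_ *: _]/(_ * _) mulrC.
have addNN (a b : K) : (a + b) + (- a + - b) = 0 by rewrite -opprD subrr.
rewrite E !octD //; exact: addNN.
Qed.

Lemma der_zero D : derivation D ->
  (forall t, t \in der_pivots -> D (inord t.1) (inord t.2) = 0) -> D = 0.
Proof.
move=> derD D0; apply/matrixP => i j; rewrite mxE -mx_entriesE.
have k49 : (7 * i + j < 49)%N by have := ltn_ord i; have := ltn_ord j; lia.
move: (7 * i + j)%N k49 => k k49 {i j}.
have pivot0 n : ((n %/ 7, n %% 7)%N \in der_pivots) -> (mx_entries D)`_n = 0.
  move=> /D0 /= Dn; case: (ltnP n 49) => n49; first by rewrite nth_mkseq.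
  by rewrite nth_default // size_mkseq.
have /allP/(_ k) := der_certificate_ok; rewrite mem_iota => /(_ k49)/orP[/pivot0 //|].
case/hasP=> t tin /andP[_ /allP tz].
have : mx_form D (sadd (skey k (-4)%BZ) (der_combination t.2)) = 0.
  rewrite /mx_form /seval big_seq big1 // => p /tz /pivot0 ->.
  by rewrite scaler0.
rewrite /mx_form sevalD // seval_skey.
have -> : seval w (mx_entries D) (der_combination t.2) = 0.
  have : all (fun t => all (fun u : Z * Z * Z * Z => [&& Z.to_nat u.1.1.1 < 7,
     Z.to_nat u.1.1.2 < 7 & Z.to_nat u.1.2 < 7]%N) t.2) der_certificate by vm_compute.
  move=> /allP/(_ t tin); elim: (t.2) => [_|[[[i j] l] c] s IHs] /=; first exact: seval_nil.
  case/andP=> /and3P[i7 j7 l7] /IHs {}IHs; rewrite sevalD // IHs addr0 sevalZ //.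
  by rewrite -/(mx_form _ _) der_form0 // scaler0.
by rewrite addr0 -[_ *: _]/(_ * _) => /eqP; rewrite mulf_eq0 zr_eq0 => /eqP.
Qed.

Definition der_coord (p : nat) (D : 'M[K]_7) : K :=
  mx_form D (der_coord_form p) / zr (nth ([::], 1%BZ) der_coords p).2.

Lemma der_coordP p a D E : der_coord p (a *: D + E) = a * der_coord p D + der_coord p E.
Proof. by rewrite /der_coord mx_formP mulrDl mulrA. Qed.

Lemma der_coord_rho p a : (p < 14)%N -> (a < 14)%N ->
  der_coord p (rho_mx a) = (p == a)%:R.
Proof.
move=> p14 a14; have /andP[/allP/(_ p) h1 /allP/(_ p) h2] := der_coords_rho.
move: h1 h2; rewrite !mem_iota => /(_ p14)/andP[/allP/(_ a)].
rewrite mem_iota => /(_ a14)/eqP dotE /allP lt49 /(_ p14) dn0.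
have entE (v : svec) : {in v, forall q, (N.to_nat q.1 < 49)%N} ->
    mx_form (rho_mx a) v = eval_eis w (sdot v (rho_entries a)).
  rewrite /mx_form; elim: v => [|[k c] v IHv] lt; first by rewrite seval_nil eval_eis0.
  rewrite seval_cons /= eval_eisD eval_eisM // IHv => [|q qv]; last first.
    by apply: lt; rewrite inE qv orbT.
  congr (_ + _); have k49 : (N.to_nat k < 49)%N by apply: (lt (k, c)); rewrite mem_head.
  rewrite nth_mkseq // mxE evo_scoef !inordK ?ltn_mod //; last by lia.
  have /allP/(_ a) := rho_entries_ok; rewrite mem_iota => /(_ a14)/allP/(_ (N.to_nat k)).
  by rewrite mem_iota => /(_ k49)/eqP ->.
rewrite /der_coord entE // dotE /eval_eis /= mul0r addr0.
case: eqP => [pa|_]; last by rewrite mul0r.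
by rewrite divff // zr_eq0; apply/eqP => z0; rewrite z0 in dn0.
Qed.

Lemma derivation0 : derivation 0.
Proof. by move=> u v; rewrite !mulmx0 star0l star0r addr0. Qed.

Lemma derivation_sum (c : nat -> K) : derivation (\sum_(a < 14) c a *: rho_mx a).
Proof.
elim/big_rec: _ => [|a S _ dS]; first exact: derivation0.
by apply: derivation_lin => //; apply: rho_der.
Qed.

Lemma der_coord_sum p (c : nat -> K) : (p < 14)%N ->
  der_coord p (\sum_(a < 14) c a *: rho_mx a) = c p.
Proof.
move=> p14; have coord0 : der_coord p 0 = 0.
  by have := der_coordP p (-1) 0 0; rewrite scaler0 addr0 mulN1r addNr.
have -> : der_coord p (\sum_(a < 14) c a *: rho_mx a) =
    \sum_(a < 14) c a * der_coord p (rho_mx a).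
  by elim/big_rec2: _ => [//|a x S _ <-]; rewrite der_coordP.
rewrite (bigD1 (Ordinal p14)) //= der_coord_rho // eqxx mulr1 big1 ?addr0 // => a ap.
rewrite der_coord_rho // ?ltn_ord //; case: eqP => [pa|_]; last by rewrite mulr0.
by case/eqP: ap; apply: val_inj.
Qed.

(** Subtracting the combination of the [rho_mx] with the same 14 coordinates leaves a derivation
    whose pivot entries all vanish, hence zero. *)
Lemma derivation_rho D : derivation D -> D = \sum_(a < 14) der_coord a D *: rho_mx a.
Proof.
move=> derD; set S := \sum_(a < 14) _.
apply/eqP; rewrite -subr_eq0 addrC -scaleN1r; apply/eqP.
have derDS : derivation (-1 *: S + D).
  by apply: derivation_lin => //; apply: (derivation_sum (der_coord^~ D)).
have form0 p : (p < 14)%N -> mx_form (-1 *: S + D) (der_coord_form p) = 0.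
  move=> p14; have : der_coord p (-1 *: S + D) = 0.
    by rewrite der_coordP (der_coord_sum (der_coord^~ D)) // mulN1r addNr.
  have /andP[_ /allP/(_ p)] := der_coords_rho; rewrite mem_iota => /(_ p14) dn0.
  move/eqP; rewrite mulf_eq0 invr_eq0 zr_eq0 => /orP[/eqP //|/eqP d0].
  by rewrite d0 in dn0.
have pivot i j : (i < 7)%N -> (j < 7)%N ->
    mx_form (-1 *: S + D) [:: (N.of_nat (7 * i + j), (1%BZ, Z0))] =
    (-1 *: S + D) (inord i) (inord j).
  move=> i7 j7; rewrite /mx_form seval_cons seval_nil addr0 Nnat.Nat2N.id mx_entries_inord //.
  by rewrite eval_eisZ zr1 -[_ *: _]/(_ * _) mul1r.
apply: der_zero => // t tin.
have t7 : (t.1 < 7)%N && (t.2 < 7)%N.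
  by move: t tin; apply/allP; vm_compute.
have {t7} [t7 t7'] := andP t7.
have /allP/(_ t tin)/hasP[p] := der_pivots_coords; rewrite mem_iota => p14.
case/orP=> [/eqP fE|/andP[/eqP -> _]]; first by rewrite -pivot // -fE form0.
(* The pivot (2, 2) remains. Coordinate 0 is 2 D_11 + D_22, and D_11 is coordinate 1. *)
have D11 : (-1 *: S + D) (inord 1) (inord 1) = 0.
  by rewrite -pivot //; apply: (form0 1%N).
have := form0 0%N isT.
have -> : der_coord_form 0 = [:: (N.of_nat (7 * 1 + 1), (2%BZ, Z0)); (N.of_nat (7 * 2 + 2), (1%BZ, Z0))].
  by vm_compute.
rewrite /mx_form seval_cons -/(mx_form _ _) pivot // Nnat.Nat2N.id mx_entries_inord // D11.
by rewrite scaler0 add0r.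
Qed.

End Derivations.

(** * Adapted octonion bases *)

Lemma codiagonalizable_rows (F : fieldType) n (As : seq 'M[F]_n) :
  {in As &, forall A B, A *m B = B *m A} -> {in As, forall A, diagonalizable A} ->
  exists2 P : 'M[F]_n, P \in unitmx & {in As, forall A,
    exists d : 'I_n -> F, forall i, row i P *m A = d i *: row i P}.
Proof.
move=> comA diagA.
have [P Pu /allP PA] : codiagonalizable As.
  by apply/codiagonalizableP; split=> // A B ? ?; apply: comA.
exists P => // A /PA /= /diagonalizable_forPex[d /(simmxP Pu) PAd].
exists (fun i => d 0 i) => i.
by rewrite -row_mul PAd row_mul row_diag_mx -scalemxAl -rowE.
Qed.

Lemma unitmx_rows_ext (F : fieldType) n (P : 'M[F]_n) (W : lmodType F)
    (f : 'rV[F]_n -> W) : linear f -> P \in unitmx ->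
  (forall i, f (row i P) = 0) -> forall u, f u = 0.
Proof.
move=> linf Pu f0 u.
pose g : {linear 'rV[F]_n -> W} := HB.pack f (GRing.isLinear.Build F _ W *:%R f linf).
rewrite -[f u]/(g u) -(mulmxKV Pu u) mulmx_sum_row linear_sum big1 // => i _.
by rewrite linearZ /= f0 scaler0.
Qed.

Lemma row_unitmx_neq0 (F : fieldType) n (P : 'M[F]_n) i : P \in unitmx -> row i P != 0.
Proof.
move=> Pu; apply/eqP => /(congr1 (mulmxr (invmx P))) /=.
rewrite rowE mulmxK // mul0mx => /rowP/(_ i); rewrite !mxE !eqxx => /eqP.
by rewrite oner_eq0.
Qed.

Lemma row_unitmx_indep (F : fieldType) n (P : 'M[F]_n) i j (a : F) :
  P \in unitmx -> i != j -> row i P != a *: row j P.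
Proof.
move=> Pu ij; apply/eqP => /(congr1 (mulmxr (invmx P))) /=.
rewrite -scalemxAl !rowE !mulmxK // => /rowP/(_ i); rewrite !mxE !eqxx /=.
by rewrite (negbTE ij) mulr0 => /eqP; rewrite oner_eq0.
Qed.

Section StandardBasis.
Context {K : numClosedFieldType}.
Variable w : K.
Hypothesis ww : w ^+ 2 + w + 1 = 0.
Local Notation V7 := 'rV[K]_7.
Local Notation OB := (@oct_basis K).
Local Notation star := (star w).
Local Notation gram := (@gram K).
Local Notation derivation := (derivation w).

(** Stands in for linear arithmetic: the proof displays x - y as a multiple of l - r, an identity
    left to [ring]. *)
Lemma lincomb1 (a x y l r : K) : l = r -> x - y = a * (l - r) -> x = y.
Proof. by move=> -> /eqP; rewrite subrr mulr0 subr_eq0 => /eqP. Qed.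

Lemma lincomb2 (a b x y l r l' r' : K) :
  l = r -> l' = r' -> x - y = a * (l - r) + b * (l' - r') -> x = y.
Proof. by move=> -> -> /eqP; rewrite !subrr !mulr0 addr0 subr_eq0 => /eqP. Qed.

Lemma nat_neq0 n : n.+1%:R != 0 :> K. Proof. by rewrite pnatr_eq0. Qed.

Lemma star_self u : star u u = 0.
Proof.
have /eqP := star_skew ww u u; rewrite -addr_eq0 -mulr2n -scaler_nat scaler_eq0.
by rewrite (negbTE (nat_neq0 1)) => /eqP.
Qed.

Lemma derivation_gram D u v : derivation D -> gram (u *m D) v + gram u (v *m D) = 0.
Proof.
move=> derD; rewrite (derivation_rho ww derD).
elim/big_rec: _ => [|a E _ IH]; first by rewrite !mulmx0 gram0l gram0r addr0.
rewrite !mulmxDr -!scalemxAr gramDl gramDr gramZl gramZr addrACA -mulrDr.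
by rewrite rho_gram_skew // mulr0 add0r.
Qed.

Section Split.
(* With this normalization c(c v) = 4 v on the orthogonal of c. *)
Variable c : V7.
Hypothesis cc : gram c c = 2%:R.

Lemma star_cc v : star c (star c v) = 4%:R *: v - (2%:R * gram c v) *: c.
Proof.
apply/rowP => k; have := congr1 (fun x : V7 => x 0 k) (star_alternative ww c c v).
rewrite /= !mxE cc => E; apply: (mulfI (nat_neq0 1)).
by apply: (lincomb1 (a := 1) E); ring.
Qed.

Definition plus (x : V7) := star c x = 2%:R *: x.
Definition minus (x : V7) := star c x = - 2%:R *: x.

Lemma gram_c_star x : gram c (star c x) = 0.
Proof. by rewrite -(gram_assoc ww) star_self gram0l. Qed.

Lemma plus_c x : plus x -> gram c x = 0.
Proof.
move=> px; have := gram_c_star x; rewrite px gramZr => /eqP.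
by rewrite mulf_eq0 (negbTE (nat_neq0 1)) => /eqP.
Qed.

Lemma minus_c x : minus x -> gram c x = 0.
Proof.
move=> px; have := gram_c_star x; rewrite px gramZr => /eqP.
by rewrite mulf_eq0 oppr_eq0 (negbTE (nat_neq0 1)) => /eqP.
Qed.

Lemma gram_star_c x y : gram (star c x) y = - gram x (star c y).
Proof. by rewrite (star_skew ww c x) gramNl (gram_assoc ww). Qed.

Lemma plus_plus x y : plus x -> plus y -> gram x y = 0.
Proof.
move=> px py; have := gram_star_c x y; rewrite px py gramZl gramZr => E.
by apply: (mulfI (nat_neq0 3)); apply: (lincomb1 (a := 1) E); ring.
Qed.

Lemma minus_minus x y : minus x -> minus y -> gram x y = 0.
Proof.
move=> px py; have := gram_star_c x y; rewrite px py gramZl gramZr => E.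
by apply: (mulfI (nat_neq0 3)); apply: (lincomb1 (a := -1) E); ring.
Qed.

(** With all the relevant form values zero, the alternative identity for c, x, y reads c(xy) =
    -x(cy) = -2xy. *)
Lemma plus_star x y : plus x -> plus y -> minus (star x y).
Proof.
move=> px py; have := star_alternative ww c x y.
rewrite py (plus_plus px py) (plus_c px) (plus_c py) !mulr0 !scale0r !subr0 starZr => /eqP.
by rewrite addr_eq0 /minus scaleNr => /eqP.
Qed.

(** The alternative identity for c, x, y and for c, y, x gives two equations from which c(xy) is
    eliminated. *)
Lemma plus_minus_star x y : plus x -> minus y -> star x y = gram y x *: c.
Proof.
move=> px my; have := star_alternative ww c y x; have := star_alternative ww c x y.
rewrite px my (plus_c px) (minus_c my) !mulr0 !scale0r !subr0 !sub0r.
rewrite !starZr (star_skew ww y x) starNr (gramC x y) => E1 E2.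
apply/rowP => k; move: (congr1 (fun v : V7 => v 0 k) E1) (congr1 (fun v : V7 => v 0 k) E2).
rewrite /= !mxE => {}E1 {}E2; apply: (mulfI (nat_neq0 3)).
by apply: (lincomb2 (a := -1) (b := -1) E1 E2); ring.
Qed.

(* If w1, w2, w3 span the plus eigenspace, the trilinear form (w1, w2 w3) is
   nonzero on them; the hypothesis [span] says that c, w1, w2, w3 and the minus
   eigenspace span the whole space. *)
Lemma plus_triple_neq0 w1 w2 w3 : plus w1 -> plus w2 -> plus w3 ->
  (forall a, w2 != a *: w3) -> w2 != 0 -> w3 != 0 ->
  (forall u, gram c u = 0 -> gram w1 u = 0 -> gram w2 u = 0 -> gram w3 u = 0 ->
     (forall v, minus v -> gram v u = 0) -> u = 0) ->
  gram w1 (star w2 w3) != 0.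
Proof.
move=> p1 p2 p3 indep w2n0 w3n0 span; apply/eqP => g0.
have m23 := plus_star p2 p3.
have star0 : star w2 w3 = 0.
  apply: span => // [| | |v mv].
  - exact: minus_c.
  - by rewrite -(gram_assoc ww) star_self gram0l.
  - by rewrite gramC (gram_assoc ww) star_self gram0r.
  - exact: minus_minus.
have gw2 v : minus v -> gram v w2 = 0.
  move=> mv; have := star_alternative ww w2 v w3.
  rewrite star0 star0r addr0 (plus_plus p2 p3) mulr0 scale0r subr0.
  rewrite (star_skew ww v w3) (plus_minus_star p3 mv) starNr starZr.
  rewrite (star_skew ww w2 c) p2 => E.
  have {}E : (4%:R * gram v w3) *: w2 = (4%:R * gram v w2) *: w3.
    apply/rowP => k; move: (congr1 (fun v : V7 => v 0 k) E).
    rewrite /= !mxE (gramC w2 v) => {}E.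
    by apply: (lincomb1 (a := 1) E); ring.
  have [g30|g3n0] := eqVneq (gram v w3) 0.
    move: E; rewrite g30 mulr0 scale0r => /esym/eqP.
    rewrite scaler_eq0 (negbTE w3n0) orbF mulf_eq0 (negbTE (nat_neq0 3)).
    by move/eqP.
  have n0 : 4%:R * gram v w3 != 0 by rewrite mulf_neq0 ?nat_neq0.
  have := indep ((4%:R * gram v w3)^-1 * (4%:R * gram v w2)).
  by rewrite -scalerA -E scalerK ?eqxx.
move/eqP: w2n0; apply; apply: span => //.
- exact: plus_c.
- exact: plus_plus.
- exact: plus_plus.
- exact: plus_plus.
Qed.

Section Triple.
Variables w1 w2 w3 : V7.
Hypotheses (p1 : plus w1) (p2 : plus w2) (p3 : plus w3).
Hypothesis vol : gram w1 (star w2 w3) = 2%:R.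
Let v1 := 2%:R^-1 *: star w2 w3.
Let v2 := 2%:R^-1 *: star w3 w1.
Let v3 := 2%:R^-1 *: star w1 w2.

Lemma minus_scale a v : minus v -> minus (a *: v).
Proof. by move=> mv; rewrite /minus starZr mv !scalerA mulrC. Qed.

Lemma half2 : 2%:R^-1 * 2%:R = 1 :> K.
Proof. by rewrite mulVf ?nat_neq0. Qed.

Lemma gram_dual11 : gram w1 v1 = 1.
Proof. by rewrite gramZr vol half2. Qed.

Lemma gram_dual21 : gram w2 v1 = 0.
Proof. by rewrite gramZr -(gram_assoc ww) star_self gram0l mulr0. Qed.

Lemma gram_dual31 : gram w3 v1 = 0.
Proof. by rewrite gramZr gramC (gram_assoc ww) star_self gram0r mulr0. Qed.

Lemma vol_cycle : gram w2 (star w3 w1) = 2%:R.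
Proof. by rewrite -(gram_assoc ww) gramC. Qed.

Lemma star_w1w2 : star w1 w2 = 2%:R *: v3.
Proof. by rewrite scalerA mulfV ?nat_neq0 // scale1r. Qed.

Lemma star_v1v2 : star v1 v2 = - 2%:R *: w3.
Proof.
have m1 : minus v1 by apply: minus_scale; apply: plus_star.
have := star_alternative ww v1 w3 w1.
rewrite (plus_plus p3 p1) mulr0 scale0r subr0.
rewrite (star_skew ww v1 w1) (plus_minus_star p1 m1) starNr starZr (star_skew ww w3 c) p3.
rewrite (gramC v1 w3) gram_dual31 mulr0 scale0r sub0r (gramC v1 w1) gram_dual11 => E.
rewrite /v2 starZr; apply/rowP => k; move: (congr1 (fun v : V7 => v 0 k) E).
rewrite /= !mxE => {}E; apply: (mulfI (nat_neq0 1)); rewrite mulrA mulfV ?nat_neq0 // mul1r.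
by apply: (lincomb1 (a := 1) E); ring.
Qed.

End Triple.

Definition adapted_row (w1 w2 w3 : V7) : seq V7 :=
  [:: c; w1; w2; w3; 2%:R^-1 *: star w2 w3; 2%:R^-1 *: star w3 w1; 2%:R^-1 *: star w1 w2].

(** The value 2 makes the halved products dual to the w's. Every relation needed comes from one
    instance by cyclic permutation, since the trilinear form (w1, w2 w3) is cyclic. *)
Lemma adapted_star w1 w2 w3 : plus w1 -> plus w2 -> plus w3 ->
  gram w1 (star w2 w3) = 2%:R ->
  let r := adapted_row w1 w2 w3 in
  forall i j, (i < 7)%N -> (j < 7)%N ->
    star r`_i r`_j = seval w r (oct_mul i j) /\ gram r`_i r`_j = zr (oct_gram i j).
Proof.
move=> p1 p2 p3 vol r.
have vol2 := vol_cycle vol; have vol3 := vol_cycle vol2.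
have m1 : minus r`_4 by apply: minus_scale; apply: plus_star.
have m2 : minus r`_5 by apply: minus_scale; apply: plus_star.
have m3 : minus r`_6 by apply: minus_scale; apply: plus_star.
have d11 := gram_dual11 vol; have d22 := gram_dual11 vol2; have d33 := gram_dual11 vol3.
have d21 := gram_dual21 w2 w3; have d32 := gram_dual21 w3 w1; have d13 := gram_dual21 w1 w2.
have d31 := gram_dual31 w2 w3; have d12 := gram_dual31 w3 w1; have d23 := gram_dual31 w1 w2.
have s12 := star_w1w2 w1 w2; have s23 := star_w1w2 w2 w3; have s31 := star_w1w2 w3 w1.
have t12 := star_v1v2 p1 p2 p3 vol; have t23 := star_v1v2 p2 p3 p1 vol2.
have t31 := star_v1v2 p3 p1 p2 vol3.
have evr i j : seval w r (oct_mul i j) =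
    let: (k, z) := nth (Z0, Z0) (nth [::] oct_table i) j in zr z *: r`_(Z.to_nat k).
  rewrite /oct_mul; case: (nth _ _ _) => k z; case: ifP => [/Z.eqb_eq ->|_].
    by rewrite seval_nil zr0 scale0r.
  rewrite seval_cons seval_nil addr0 eval_eisZ; congr (_ *: r`_ _).
  by case: k.
have z2 : zr 2%BZ = 2%:R :> K by []. have zN2 : zr (-2)%BZ = - 2%:R :> K by [].
have pm := plus_minus_star.
rewrite /r /= in m1 m2 m3.
have e1 := pm _ _ p1 m1; have e2 := pm _ _ p2 m2; have e3 := pm _ _ p3 m3.
have e12 := pm _ _ p1 m2; have e13 := pm _ _ p1 m3; have e21 := pm _ _ p2 m1.
have e23 := pm _ _ p2 m3; have e31 := pm _ _ p3 m1; have e32 := pm _ _ p3 m2.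
have g1 := plus_c p1; have g2 := plus_c p2; have g3 := plus_c p3.
have h1 := minus_c m1; have h2 := minus_c m2; have h3 := minus_c m3.
have pp := plus_plus. have mm := minus_minus.
move=> i j i7 j7; rewrite evr.
move: m1 m2 m3 d11 d22 d33 d21 d32 d13 d31 d12 d23 s12 s23 s31 t12 t23 t31 e1 e2 e3
  e12 e13 e21 e23 e31 e32 g1 g2 g3 h1 h2 h3; rewrite /r /adapted_row.
set v1 := _ *: star w2 w3; set v2 := _ *: star w3 w1; set v3 := _ *: star w1 w2.
move=> m1 m2 m3 d11 d22 d33 d21 d32 d13 d31 d12 d23 s12 s23 s31 t12 t23 t31 e1 e2 e3
  e12 e13 e21 e23 e31 e32 g1 g2 g3 h1 h2 h3.
(* [G] and [S] collect all form values and all products as rewriting rules that settle the 49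
   entries of both tables. *)
have G := (cc, g1, g2, g3, h1, h2, h3, (gramC w1 c, gramC w2 c, gramC w3 c,
  gramC v1 c, gramC v2 c, gramC v3 c), (pp _ _ p1 p1, pp _ _ p1 p2, pp _ _ p1 p3,
  pp _ _ p2 p1, pp _ _ p2 p2, pp _ _ p2 p3, pp _ _ p3 p1, pp _ _ p3 p2, pp _ _ p3 p3),
  (mm _ _ m1 m1, mm _ _ m1 m2, mm _ _ m1 m3, mm _ _ m2 m1, mm _ _ m2 m2, mm _ _ m2 m3,
   mm _ _ m3 m1, mm _ _ m3 m2, mm _ _ m3 m3), (d11, d22, d33, d21, d32, d13, d31, d12, d23),
  (gramC v1 w1, gramC v1 w2, gramC v1 w3, gramC v2 w1, gramC v2 w2, gramC v2 w3,
   gramC v3 w1, gramC v3 w2, gramC v3 w3)).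
have sk := star_skew ww.
rewrite /minus in m1 m2 m3; rewrite /plus in p1 p2 p3.
have S := (star_self, p1, p2, p3, m1, m2, m3, (s12, s23, s31, t12, t23, t31),
  (e1, e2, e3, e12, e13, e21, e23, e31, e32),
  (sk w1 c, sk w2 c, sk w3 c, sk v1 c, sk v2 c, sk v3 c),
  (sk w2 w1, sk w3 w2, sk w1 w3, sk v2 v1, sk v3 v2, sk v1 v3),
  (sk v1 w1, sk v1 w2, sk v1 w3, sk v2 w1, sk v2 w2, sk v2 w3, sk v3 w1, sk v3 w2, sk v3 w3)).
case: i i7 => [|[|[|[|[|[|[|]]]]]]] // _; case: j j7 => [|[|[|[|[|[|[|]]]]]]] // _;
  rewrite /=; split; rewrite ?(S, G) ?z2 ?zN2 ?zr0 ?zr1 ?zrN1 ?scale0r ?scale1r ?scaleN1r ?scaleNr ?opprK ?oppr0 //.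
Qed.

Lemma size_adapted w1 w2 w3 : size (adapted_row w1 w2 w3) = 7%N.
Proof. by []. Qed.

Definition adapted_mx (w1 w2 w3 : V7) : 'M[K]_7 :=
  \matrix_(i < 7) (adapted_row w1 w2 w3)`_i.

Lemma mul_oct_adapted w1 w2 w3 i : (i < 7)%N ->
  OB`_i *m adapted_mx w1 w2 w3 = (adapted_row w1 w2 w3)`_i.
Proof.
by move=> i7; rewrite -[ i]/(val (Ordinal i7)) oct_nth -rowE; exact: rowK.
Qed.

Lemma seval_mulmx (g : 'M[K]_7) (r : seq V7) v : size r = 7%N ->
  (forall i, (i < 7)%N -> OB`_i *m g = r`_i) -> seval w OB v *m g = seval w r v.
Proof.
move=> sr gr; rewrite /seval mulmx_suml; apply: eq_bigr => p _.
rewrite -scalemxAl; congr (_ *: _); case: (ltnP (N.to_nat p.1) 7) => p7; first exact: gr.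
by rewrite !nth_default ?sr ?size_oct // mul0mx.
Qed.

(** A matrix sending the standard basis to one with the same multiplication table is multiplicative;
    it also preserves the nondegenerate form, so its kernel is zero. *)
Lemma adapted_auto w1 w2 w3 : plus w1 -> plus w2 -> plus w3 ->
  gram w1 (star w2 w3) = 2%:R ->
  let g := adapted_mx w1 w2 w3 in
  (forall u v, star (u *m g) (v *m g) = star u v *m g) /\ g \in unitmx.
Proof.
move=> p1 p2 p3 vol g; have adst := adapted_star p1 p2 p3 vol.
have og i : (i < 7)%N -> OB`_i *m g = (adapted_row w1 w2 w3)`_i by apply: mul_oct_adapted.
split=> [u v|].
  apply/eqP; rewrite -subr_eq0; apply/eqP; move: u; apply: (oct_ext (w := w)) => [a x y|i i7].
    by rewrite !(starPl, mulmxDl, =^~ scalemxAl); apply/rowP => k; rewrite !mxE; ring.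
  move: v; apply: (oct_ext (w := w)) => [a x y|j j7].
    by rewrite !(starPr, mulmxDl, =^~ scalemxAl); apply/rowP => k; rewrite !mxE; ring.
  rewrite !evo_oct !og // (adst i j i7 j7).1 star_oct //.
  by rewrite (seval_mulmx _ (size_adapted w1 w2 w3)) // subrr.
have gramg u v : gram (u *m g) (v *m g) = gram u v.
  apply/eqP; rewrite -subr_eq0; apply/eqP.
  move: u; apply: (@oct_ext _ w K^o) => [a x y|i i7].
    by rewrite !(gramPl, mulmxDl, =^~ scalemxAl) -[_ *: _]/(_ * _); ring.
  move: v; apply: (@oct_ext _ w K^o) => [a x y|j j7].
    by rewrite !(gramPr, mulmxDl, =^~ scalemxAl) -[_ *: _]/(_ * _); ring.
  by rewrite !evo_oct !og // (adst i j i7 j7).2 gram_oct // subrr.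
rewrite -row_free_unit -kermx_eq0; apply/eqP/row_matrixP => i; rewrite row0.
apply: gram_nondeg => v; rewrite -gramg -row_mul mulmx_ker row0.
exact: gram0l.
Qed.

End Split.

Definition torus_weight (m1 m2 m3 : K) (i : nat) : K :=
  [:: 0; m1; m2; m3; - m1; - m2; - m3]`_i.

(** The point is to find a vector c killed by all of [As] with (c, c) = 2. Multiplication by c then
    commutes with [As], and a common eigenbasis contains three vectors of eigenvalue 2, which
    generate the rest of an adapted basis. *)
Lemma adapted_basis (As : seq 'M[K]_7) :
  {in As, forall A, derivation A} ->
  {in As &, forall A B, A *m B = B *m A} ->
  {in As, forall A, diagonalizable A} ->
  (exists2 A, A \in As & A != 0) ->
  exists g : 'M[K]_7, [/\ g \in unitmx,
    forall u v, star (u *m g) (v *m g) = star u v *m g &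
    {in As, forall A, exists m1 m2 m3, m1 + m2 + m3 = 0 /\
      forall i, (i < 7)%N ->
        OB`_i *m g *m A = torus_weight m1 m2 m3 i *: (OB`_i *m g)}].
Proof.
move=> derA comA diagA [A0 A0in A0n0].
have [P Pu PA] := codiagonalizable_rows comA diagA.
have [d0 d0P] := PA _ A0in.
have [i di] : exists i, d0 i != 0.
  apply/existsP; apply: contraT; rewrite negb_exists => /forallP d00.
  case/eqP: A0n0; apply/row_matrixP => i; rewrite row0 rowE.
  apply: (unitmx_rows_ext (f := fun u => u *m A0) _ Pu) => [a x y|j].
    by rewrite mulmxDl scalemxAl.
  by have := d00 j; rewrite negbK d0P => /eqP ->; rewrite scale0r.
pose u := row i P.
(* Derivations are skew, so a vector of nonzero weight is isotropic. *)
have uu : gram u u = 0.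
  have := derivation_gram u u (derA _ A0in); rewrite d0P gramZl gramZr => E.
  apply: (mulfI di); apply: (mulfI (nat_neq0 1)).
  by apply: (lincomb1 (a := 1) E); ring.
have [j guj] : exists j, gram u (row j P) != 0.
  apply/existsP; apply: contraT; rewrite negb_exists => /forallP g0.
  case/eqP: (row_unitmx_neq0 i Pu); apply: gram_nondeg.
  apply: (unitmx_rows_ext (f := gram u : V7 -> K^o) (gram_linear_r u) Pu) => j.
  by have := g0 j; rewrite negbK => /eqP.
pose u' := row j P; pose c0 := star u u'.
(* As u and u' are not orthogonal, skewness gives them opposite weights under every A; their product
   has weight 0. *)
have c0A A : A \in As -> c0 *m A = 0.
  move=> AAs; have [d dP] := PA _ AAs.
  have := derivation_gram u u' (derA _ AAs); rewrite !dP gramZl gramZr -mulrDl.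
  move/eqP; rewrite mulf_eq0 (negbTE guj) orbF => /eqP dd.
  by rewrite (derA _ AAs) !dP starZl starZr -scalerDl dd scale0r.
have c0c0 : gram c0 c0 = 2%:R * gram u u' ^+ 2.
  rewrite /c0 (gram_assoc ww).
  have := star_alternative ww u' u u'; rewrite star_self star0r addr0 => ->.
  rewrite !gramDr !gramNr !gramZr uu (gramC u' u); ring.
have c0n0 : gram c0 c0 != 0 by rewrite c0c0 mulf_neq0 ?expf_neq0 ?nat_neq0.
pose s := sqrtC (2%:R / gram c0 c0); pose c := s *: c0.
have cc : gram c c = 2%:R.
  by rewrite /c gramZl gramZr mulrA -expr2 sqrtCK divfK.
have cA A : A \in As -> c *m A = 0 by move=> AAs; rewrite /c -scalemxAl c0A // scaler0.
pose C := star_mx w c.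
have mulC x : x *m C = star c x by apply: mul_star_mx.
have comCA A : A \in As -> C *m A = A *m C.
  move=> AAs; apply/row_matrixP => k; rewrite !rowE !mulmxA !mulC.
  by rewrite (derA _ AAs) cA // star0l add0r.
(* By [star_cc], C is annihilated by X(X-2)(X+2), which has distinct roots. *)
have diagC : diagonalizable C.
  apply/diagonalizableP; exists [:: 0; 2%:R; - 2%:R].
    rewrite /= !inE eq_sym (negbTE (nat_neq0 1)) eq_sym oppr_eq0 (negbTE (nat_neq0 1)).
    by rewrite andbT /= -addr_eq0 -natrD nat_neq0.
  apply: mxminpoly_min; rewrite !big_cons big_nil mulr1 !rmorphM !rmorphB /=.
  rewrite horner_mx_X !horner_mx_C; apply/row_matrixP => k; rewrite row0 rowE.
  set x := delta_mx 0 k; rewrite -!mulmxE !mulmxA !mulmxBr mul_mx_scalar scale0r subr0.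
  rewrite !mulmxBl !mul_mx_scalar -!scalemxAl !mulC !star_cc //.
  rewrite gram_c_star mulr0 scale0r subr0.
  by apply/rowP => l; rewrite !mxE; ring.
have [Q Qu QA] : exists2 Q : 'M[K]_7, Q \in unitmx & {in C :: As, forall A,
    exists d : 'I_7 -> K, forall i, row i Q *m A = d i *: row i Q}.
  apply: codiagonalizable_rows => [A B|A].
    rewrite !inE => /orP[/eqP ->|AAs] /orP[/eqP ->|BAs] //; first exact: comCA.
      by rewrite comCA.
    exact: comA.
  by rewrite inE => /orP[/eqP -> //|/diagA].
have [d dP] := QA C (mem_head _ _).
have d3 k : (d k == 2%:R) || (d k == - 2%:R) || (d k == 0).
  have rk0 := row_unitmx_neq0 k Qu.
  have := star_cc cc (star c (row k Q)); rewrite gram_c_star mulr0 scale0r subr0.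
  rewrite -!mulC !dP -!scalemxAl !dP -!scalemxAl dP !scalerA => /eqP.
  rewrite -subr_eq0 -scalerBl scaler_eq0 (negbTE rk0) orbF => /eqP E.
  have : d k * ((d k - 2%:R) * (d k + 2%:R)) == 0 by apply/eqP; rewrite -E; ring.
  by rewrite !mulf_eq0 subr_eq0 addr_eq0 orbC.
have d0c k : d k = 0 -> exists a, row k Q = a *: c.
  move=> dk; have := star_cc cc (row k Q); rewrite -[X in star c X]mulC dP dk scale0r star0r.
  move=> /esym/eqP; rewrite subr_eq0 => /eqP E.
  exists (4%:R^-1 * (2%:R * gram c (row k Q))).
  by rewrite -scalerA -E scalerA mulVf ?nat_neq0 // scale1r.
have [i1 [i2 [i3 [i12 i13 i23 di1 [di2 di3 dplus]]]]] : exists i1 i2 i3,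
    [/\ i1 != i2, i1 != i3, i2 != i3, d i1 = 2%:R & [/\ d i2 = 2%:R, d i3 = 2%:R &
      forall k, d k = 2%:R -> k \in [:: i1; i2; i3]]].
  have n2 : (2%:R == - 2%:R :> K) = false.
    by rewrite -addr_eq0 -natrD (negbTE (nat_neq0 3)).
  pose Pp := [set k | d k == 2%:R]; pose Pm := [set k | d k == - 2%:R].
  pose P0 := [set k | d k == 0].
  have trd : \sum_k d k = 0.
    rewrite -[RHS](star_mx_trace ww c) -/C.
    have -> : C = invmx Q *m (Q *m C) by rewrite mulKmx.
    have -> : Q *m C = diag_mx (\row_k d k) *m Q.
      by apply/row_matrixP => k; rewrite row_mul dP row_mul row_diag_mx -scalemxAl -rowE mxE.
    rewrite mxtrace_mulC -mulmxA mulmxV // mulmx1 mxtrace_diag.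
    by apply: eq_bigr => k _; rewrite mxE.
  have card_sum (A : {set 'I_7}) : #|A| = (\sum_k (k \in A))%N.
    by rewrite -sum1_card big_mkcond; apply: eq_bigr => k _; case: (k \in A).
  have PpPm : #|Pp| = #|Pm|.
    apply/eqP; rewrite -(eqr_nat K) !card_sum !natr_sum.
    apply/eqP/(mulfI (nat_neq0 1)); apply/eqP; rewrite -subr_eq0 !mulr_sumr -sumrB.
    apply/eqP; rewrite -[RHS]trd; apply: eq_bigr => k _; rewrite !inE.
    case/orP: (d3 k) => [/orP[]/eqP ->|/eqP ->].
    - by rewrite eqxx n2 mulr0 subr0 mulr1.
    - by rewrite eqxx eq_sym n2 mulr0 sub0r mulr1.
    by rewrite eq_sym (negbTE (nat_neq0 1)) eq_sym oppr_eq0 (negbTE (nat_neq0 1)) subrr.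
  (* The kernel of C is contained in the line of c. *)
  have P01 : (#|P0| <= 1)%N.
    apply/card_le1_eqP => k l; rewrite !inE => /eqP/d0c[a ka] /eqP/d0c[b lb].
    apply/eqP; apply/negPn/negP; rewrite eq_sym => kl.
    have b0 : b != 0.
      by apply: contraNneq (row_unitmx_neq0 l Qu) => b0; rewrite lb b0 scale0r.
    case/eqP: (row_unitmx_indep (a / b) Qu kl).
    by rewrite ka lb [RHS]scalerA divfK.
  have tot : (#|Pp| + #|Pm| + #|P0| = 7)%N.
    rewrite !card_sum -!big_split /= -[RHS](card_ord 7) -sum1_card.
    apply: eq_bigr => k _; rewrite !inE.
    case/orP: (d3 k) => [/orP[]/eqP ->|/eqP ->].
    - by rewrite eqxx n2 (negbTE (nat_neq0 1)).
    - by rewrite eqxx eq_sym n2 oppr_eq0 (negbTE (nat_neq0 1)).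
    by rewrite eq_sym (negbTE (nat_neq0 1)) eq_sym oppr_eq0 (negbTE (nat_neq0 1)) eqxx.
  (* Trace 0 gives equal multiplicities p for 2 and -2; with z at most 1 for the kernel, 2p + z = 7
     leaves p = 3. *)
  have : size (enum Pp) = 3%N by rewrite -cardE; clear -PpPm P01 tot; lia.
  have := enum_uniq (mem Pp); have := mem_enum Pp.
  case: (enum Pp) => [|i1 [|i2 [|i3 [|]]]] //= memP + _.
  rewrite !inE negb_or andbT => /andP[/andP[i12 i13] i23].
  have dm k : k \in [:: i1; i2; i3] -> d k = 2%:R by rewrite memP inE => /eqP.
  exists i1, i2, i3; split=> //; first by apply: dm; rewrite mem_head.
  split; first by apply: dm; rewrite !inE eqxx orbT.
    by apply: dm; rewrite !inE eqxx !orbT.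
  by move=> k dk; rewrite memP inE dk.
have plusd k : d k = 2%:R -> plus c (row k Q) by move=> dk; rewrite /plus -mulC dP dk.
have p1 := plusd _ di1; have p2 := plusd _ di2; have p3 := plusd _ di3.
have vol0 : gram (row i1 Q) (star (row i2 Q) (row i3 Q)) != 0.
  apply: (plus_triple_neq0 p1 p2 p3) => [a||| x cx g1 g2 g3 gm].
  - exact: row_unitmx_indep.
  - exact: row_unitmx_neq0.
  - exact: row_unitmx_neq0.
  apply: gram_nondeg => v; rewrite gramC; move: v.
  pose f v := gram v x : K^o.
  apply: (unitmx_rows_ext (f := f) _ Qu) => [a y z|k]; first exact: gramPl.
  rewrite /f; case/orP: (d3 k) => [/orP[]/eqP dk|/eqP/d0c[a ->]].
  - by have := dplus k dk; rewrite !inE => /orP[/eqP -> //|/orP[]/eqP -> //].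
  - by apply: gm; rewrite /minus -mulC dP dk.
  by rewrite gramZl cx mulr0.
set w2 := row i2 Q in p2 vol0 *; set w3 := row i3 Q in p3 vol0 *.
pose w1 := (2%:R / gram (row i1 Q) (star w2 w3)) *: row i1 Q.
have p1' : plus c w1 by rewrite /plus /w1 starZr p1 !scalerA mulrC.
have vol : gram w1 (star w2 w3) = 2%:R by rewrite gramZl divfK.
have [gauto gu] := adapted_auto cc p1' p2 p3 vol.
exists (adapted_mx c w1 w2 w3); split=> // A AAs.
have [dA dAP] : exists dA : 'I_7 -> K, forall i, row i Q *m A = dA i *: row i Q.
  by apply: QA; rewrite inE AAs orbT.
pose m1 := dA i1; pose m2 := dA i2; pose m3 := dA i3.
have e1 : w1 *m A = m1 *: w1 by rewrite -scalemxAl dAP !scalerA mulrC.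
have e2 : w2 *m A = m2 *: w2 by rewrite dAP.
have e3 : w3 *m A = m3 *: w3 by rewrite dAP.
have star_eigen x y a b : x *m A = a *: x -> y *m A = b *: y ->
    2%:R^-1 *: star x y *m A = (a + b) *: (2%:R^-1 *: star x y).
  move=> xa yb; rewrite -scalemxAl (derA _ AAs) xa yb starZl starZr -scalerDl.
  by rewrite !scalerA mulrC.
(* Skewness applied to the nonzero pairing of w1 with w2 w3. *)
have sum0 : m1 + m2 + m3 = 0.
  have := derivation_gram w1 (2%:R^-1 *: star w2 w3) (derA _ AAs).
  rewrite (star_eigen _ _ _ _ e2 e3) e1 gramZl [gram _ ((_ + _) *: _)]gramZr.
  by rewrite -mulrDl gramZr vol mulVf ?nat_neq0 // mulr1 addrA.
exists m1, m2, m3; split=> // k k7; rewrite mul_oct_adapted //.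
case: k k7 => [|[|[|[|[|[|[|]]]]]]] // _; rewrite /torus_weight /adapted_row /=.
- by rewrite cA // scale0r.
- by rewrite (star_eigen _ _ _ _ e2 e3); congr (_ *: _); apply: (lincomb1 (a := 1) sum0); ring.
- by rewrite (star_eigen _ _ _ _ e3 e1); congr (_ *: _); apply: (lincomb1 (a := 1) sum0); ring.
by rewrite (star_eigen _ _ _ _ e1 e2); congr (_ *: _); apply: (lincomb1 (a := 1) sum0); ring.
Qed.

End StandardBasis.

(** * The bigrading of E6 and the subalgebra G2 *)

Definition G2_weights : seq (Z * Z) :=
  [:: (0, 0); (0, 0); (2, -3); (-1, 2); (1, -1); (0, 1); (-1, 3); (1, 0);
      (-2, 3); (1, -2); (-1, 1); (0, -1); (1, -3); (-1, 0)]%BZ.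

Definition oct_weights : seq (Z * Z) :=
  [:: (0, 0); (0, 1); (1, -2); (-1, 1); (0, -1); (-1, 2); (1, -1); (0, 0)]%BZ.

(* The pair of eigenvalues of the simple coroots (long, short) on the k-th vector. *)
Definition graded_weight (k : nat) : Z * Z :=
  if (k < 14)%N then nth (Z0, Z0) G2_weights k
  else nth (Z0, Z0) oct_weights ((k - 14) %% 8).

(* A regular element of the torus: the non-zero weights take the distinct values
   +-1, +-3, +-4 (short) and +-2, +-5, +-7 (long) on it. *)
Definition reg_weight (a : Z * Z) : Z := Z.add (Z.mul 7%BZ a.1) (Z.mul 4%BZ a.2).

Lemma graded_weight_ok :
  all (fun k => let v := nth [::] graded_vectors k in
    (sbr (nth [::] graded_vectors 0) v == sscale ((graded_weight k).1, Z0) v) &&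
    (sbr (nth [::] graded_vectors 1) v == sscale ((graded_weight k).2, Z0) v)) (iota 0 78).
Proof. by vm_compute. Qed.

Lemma graded_weight_block b k : (k < 8)%N ->
  graded_weight (14 + 8 * b + k) = nth (Z0, Z0) oct_weights k.
Proof.
move=> k8; have b14 : (14 + 8 * b + k < 14)%N = false by lia.
rewrite /graded_weight b14; by have -> : ((14 + 8 * b + k - 14) %% 8 = k)%N by lia.
Qed.

Lemma zr_nat (K : numFieldType) n : zr (Z.of_nat n) = n%:R :> K.
Proof.
elim: n => [|n IHn]; first exact: zr0.
by rewrite -[Z.of_nat _]/(Z.of_nat (1 + n)) -natr1 -IHn -zr1 -zrD; congr zr; lia.
Qed.

Section Graded.
Local Opaque sbr graded_weight graded_degree.
Context {K : numFieldType} {L : finLieType K}.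
Variable w : K.
Hypothesis ww : w ^+ 2 + w + 1 = 0.
Variables e f : 'I_6 -> L.
Hypothesis simpleL : simple_lie {:L}.
Hypothesis chevL : chevalley_generators cartan_E6 {:L} e f.
Local Notation B := (B6 e f).
Local Notation OB := (@oct_basis K).
Local Notation ev := (seval w B).
Local Notation Gv := (Gv w e f).
Local Notation sigma0 := (sigma0 w e f).
Local Notation sigma1 := (sigma1 w e f).

Definition gcoord (k : nat) (x : L) : K := coord (G_tuple w e f) (inord k : 'I_78) x.

Lemma gcoordP k a x y : gcoord k (a *: x + y) = a * gcoord k x + gcoord k y.
Proof. exact: linearP. Qed.

Lemma gcoordZ k a x : gcoord k (a *: x) = a * gcoord k x.
Proof. exact: linearZ. Qed.

Lemma gcoordD k x y : gcoord k (x + y) = gcoord k x + gcoord k y.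
Proof. exact: linearD. Qed.

Lemma gcoord0 k : gcoord k 0 = 0.
Proof. exact: linear0. Qed.

Lemma gcoord_sum k I (s : seq I) P F :
  gcoord k (\sum_(i <- s | P i) F i) = \sum_(i <- s | P i) gcoord k (F i).
Proof. exact: linear_sum. Qed.

Lemma gcoord_G k l : (k < 78)%N -> (l < 78)%N -> gcoord k (Gv l) = (k == l)%:R.
Proof.
move=> k78 l78; have fG : free (G_tuple w e f) := basis_free (basis_G ww simpleL chevL).
rewrite /gcoord -(nth_G w e f l78).
by rewrite (coord_free (Ordinal l78) (inord k) fG) -val_eqE /= inordK // eq_sym.
Qed.

Lemma gcoord_expand x : x = \sum_(k < 78) gcoord k x *: Gv k.
Proof.
rewrite [LHS](coord_basis (basis_G ww simpleL chevL) (memvf x)).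
by apply: eq_bigr => k _; rewrite nth_G // /gcoord inord_val.
Qed.

Lemma gcoord_ext x y : (forall k, (k < 78)%N -> gcoord k x = gcoord k y) -> x = y.
Proof.
move=> xy; rewrite (gcoord_expand x) (gcoord_expand y).
by apply: eq_bigr => k _; rewrite xy.
Qed.

Lemma Gv_neq0 k : (k < 78)%N -> Gv k != 0.
Proof.
move=> k78; apply/eqP => G0; have := gcoord_G k78 k78.
by rewrite G0 gcoord0 eqxx => /eqP; rewrite eq_sym oner_eq0.
Qed.

Lemma gcoord_linfun (D : 'End(L)) (l : nat -> K) :
  (forall k, (k < 78)%N -> D (Gv k) = l k *: Gv k) ->
  forall k x, (k < 78)%N -> gcoord k (D x) = l k * gcoord k x.
Proof.
move=> DG k x k78; rewrite {1}(gcoord_expand x) linear_sum gcoord_sum.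
rewrite (bigD1 (Ordinal k78)) //= big1 ?addr0 => [|i ik].
  by rewrite linearZ /= DG // !gcoordZ gcoord_G // eqxx mulr1 mulrC.
rewrite linearZ /= DG // !gcoordZ gcoord_G // [k == i]eq_sym.
by have /negPf -> : val i != k by []; rewrite !mulr0.
Qed.

Lemma eigen_gcoord (D : 'End(L)) (l : nat -> K) (m : K) x :
  (forall k, (k < 78)%N -> D (Gv k) = l k *: Gv k) ->
  D x = m *: x <-> forall k, (k < 78)%N -> l k != m -> gcoord k x = 0.
Proof.
move=> DG; split=> [Dx k k78 lm|x0].
  have := gcoord_linfun DG x k78; rewrite Dx gcoordZ => /eqP.
  by rewrite -subr_eq0 -mulrBl mulf_eq0 subr_eq0 [m == _]eq_sym (negPf lm) => /eqP.
apply: gcoord_ext => k k78; rewrite (gcoord_linfun DG) // gcoordZ.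
by have [->//|lm] := eqVneq (l k) m; rewrite x0 ?mulr0.
Qed.

Lemma sigma_G k : (k < 78)%N ->
  sigma0 (Gv k) = w ^+ (graded_degree k %/ 3) *: Gv k /\
  sigma1 (Gv k) = w ^+ (graded_degree k %% 3) *: Gv k.
Proof.
move=> k78; have /allP/(_ k) := graded_degree_ok; rewrite mem_iota => /(_ k78).
move=> /andP[/eqP/(congr1 ev) E0 /eqP/(congr1 ev) E1].
have deg9 : (graded_degree k %/ 3 < 3)%N.
  Local Transparent graded_degree.
  by rewrite /graded_degree; case: ifP => k14 //; lia.
  Local Opaque graded_degree.
have deg3 : (graded_degree k %% 3 < 3)%N by rewrite ltn_mod.
rewrite /Gv /sigma0 /sigma1 !lmap_ev // E0 E1 !sevalZ //.
by rewrite !eval_omega.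
Qed.

Lemma ww_omega_neq : w ^+ 2 != 1 /\ w ^+ 2 != w.
Proof.
have w1 := w_neq1 ww; have w3 := w_order3 ww; split; apply: contra_neq w1 => E.
  by rewrite -w3 exprS E mulr1.
by rewrite -[RHS]w3 exprSr E -expr2 E.
Qed.

Lemma omega_inj m n : (m < 3)%N -> (n < 3)%N -> w ^+ m = w ^+ n -> m = n.
Proof.
have [w21 w2w] := ww_omega_neq; have w1 := w_neq1 ww.
case: m n => [|[|[|//]]] [|[|[|//]]] // _ _; rewrite ?expr0 ?expr1.
- by move/eqP; rewrite eq_sym (negPf w1).
- by move/eqP; rewrite eq_sym (negPf w21).
- by move/eqP; rewrite (negPf w1).
- by move/eqP; rewrite eq_sym (negPf w2w).
- by move/eqP; rewrite (negPf w21).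
- by move/eqP; rewrite (negPf w2w).
Qed.

Lemma graded_gcoord p q x : (p < 3)%N -> (q < 3)%N ->
  (sigma0 x = w ^+ p *: x /\ sigma1 x = w ^+ q *: x) <->
  (forall k, (k < 78)%N -> graded_degree k != (3 * p + q)%N -> gcoord k x = 0).
Proof.
move=> p3 q3.
have deg9 k : (k < 78)%N -> (graded_degree k %/ 3 < 3)%N.
  Local Transparent graded_degree.
  by rewrite /graded_degree; case: ifP => k14 //; lia.
  Local Opaque graded_degree.
have e0 := eigen_gcoord (w ^+ p) x (fun k k78 => proj1 (sigma_G k78)).
have e1 := eigen_gcoord (w ^+ q) x (fun k k78 => proj2 (sigma_G k78)).
split=> [[/e0 x0 /e1 x1] k k78 dk|x0].
  have [Ep|np] := eqVneq (graded_degree k %/ 3)%N p.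
    have [Eq|nq] := eqVneq (graded_degree k %% 3)%N q.
      by case/eqP: dk; rewrite -Ep -Eq mulnC -divn_eq.
    by apply: x1 => //; apply: contra_neq nq; apply: omega_inj; rewrite ?ltn_mod.
  by apply: x0 => //; apply: contra_neq np; apply: omega_inj; rewrite ?deg9.
split; [apply/e0|apply/e1] => k k78 dk; apply: x0 => //.
  by apply: contra_neq dk => ->; rewrite mulnC divnMDl // divn_small // addn0.
by apply: contra_neq dk => ->; rewrite mulnC modnMDl modn_small.
Qed.

Lemma lie_weight0 k : (k < 78)%N ->
  [lie Gv 0, Gv k] = zr (graded_weight k).1 *: Gv k /\
  [lie Gv 1, Gv k] = zr (graded_weight k).2 *: Gv k.
Proof.
move=> k78; have /allP/(_ k) := graded_weight_ok; rewrite mem_iota => /(_ k78).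
move=> /andP[/eqP/(congr1 ev) E0 /eqP/(congr1 ev) E1].
by rewrite /Gv -!(ev_br ww chevL) E0 E1 !sevalZ // /eval_eis /= zr0 !mul0r !addr0.
Qed.

(** Sees only the degree (0, 0) component of x, which makes it a linear map on the whole of [L]. *)
Definition rho (x : L) : 'M[K]_7 := \sum_(a < 14) gcoord a x *: rho_mx w a.

Definition block (b : nat) (v : 'rV[K]_7) : L := \sum_(k < 7) v 0 k *: Gv (14 + 8 * b + k).

(* The degree (0, 0) part, which is the subalgebra of type G2. *)
Definition in_G2 (x : L) : Prop := forall k, (14 <= k < 78)%N -> gcoord k x = 0.

Lemma rhoP a x y : rho (a *: x + y) = a *: rho x + rho y.
Proof.
rewrite /rho scaler_sumr -big_split; apply: eq_bigr => k _.
by rewrite gcoordP scalerDl scalerA.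
Qed.

Lemma blockP b a u v : block b (a *: u + v) = a *: block b u + block b v.
Proof.
rewrite /block scaler_sumr -big_split; apply: eq_bigr => k _.
by rewrite !mxE scalerDl scalerA.
Qed.

Lemma block0 b : block b 0 = 0.
Proof. by have := blockP b (-1) 0 0; rewrite scaler0 addr0 scaleN1r addNr. Qed.

Lemma blockZ b a u : block b (a *: u) = a *: block b u.
Proof. by have := blockP b a u 0; rewrite block0 !addr0. Qed.

Lemma block_sum b I (s : seq I) P F :
  block b (\sum_(i <- s | P i) F i) = \sum_(i <- s | P i) block b (F i).
Proof.
elim/big_rec2: _ => [|i y1 y2 _ <-]; first exact: block0.
by rewrite -[F i]scale1r blockP !scale1r.
Qed.

Lemma block_basis b k : (k < 7)%N -> block b OB`_k = Gv (14 + 8 * b + k).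
Proof.
move=> k7; rewrite -[ k]/(val (Ordinal k7)) oct_nth /block (bigD1 (Ordinal k7)) //=.
rewrite mxE !eqxx scale1r big1 ?addr0 // => i ik.
by rewrite mxE (negPf ik) andbF scale0r.
Qed.

Lemma rho0 : rho 0 = 0.
Proof. by have := rhoP (-1) 0 0; rewrite scaler0 addr0 scaleN1r addNr. Qed.

Lemma rhoZ a x : rho (a *: x) = a *: rho x.
Proof. by have := rhoP a x 0; rewrite rho0 !addr0. Qed.

Lemma rho_is_derivation x : derivation w (rho x).
Proof. exact: (derivation_sum ww (fun a => gcoord a x)). Qed.

Lemma in_G2P x : in_G2 x -> x = \sum_(a < 14) gcoord a x *: Gv a.
Proof.
move=> x0; rewrite [LHS]gcoord_expand [RHS](big_ord_widen 78 (fun k => gcoord k x *: Gv k)) //.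
rewrite [RHS]big_mkcond; apply: eq_bigr => k _; case: (ltnP k 14) => k14 //.
by rewrite x0 ?scale0r // k14 ltn_ord.
Qed.

Lemma gcoord_G2_sum (c : nat -> K) k : (k < 78)%N ->
  gcoord k (\sum_(a < 14) c a *: Gv a) = if (k < 14)%N then c k else 0.
Proof.
move=> k78; rewrite gcoord_sum; case: ifP => k14.
  rewrite (bigD1 (Ordinal k14)) //= big1 ?addr0 => [|i ik].
    by rewrite gcoordZ gcoord_G // eqxx mulr1.
  rewrite gcoordZ gcoord_G //; last by have := ltn_ord i; lia.
  by rewrite [k == _]eq_sym; have /negPf -> : val i != k by []; rewrite mulr0.
rewrite big1 // => i _; rewrite gcoordZ gcoord_G //; last by have := ltn_ord i; lia.
have /negPf -> : k != i by apply: contraFneq k14 => ->.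
by rewrite mulr0.
Qed.

(** Defined linearly for all matrices; it inverts [rho] on derivations, identifying G2 with the
    derivations of the octonions. *)
Definition rho_inv (D : 'M[K]_7) : L := \sum_(a < 14) der_coord w a D *: Gv a.

Lemma in_G2_inv D : in_G2 (rho_inv D).
Proof.
move=> k /andP[k14 k78]; rewrite (gcoord_G2_sum (fun a => der_coord w a D)) //.
by rewrite ltnNge k14.
Qed.

Lemma rho_invK D : derivation w D -> rho (rho_inv D) = D.
Proof.
move=> dD; rewrite {2}(derivation_rho ww dD); apply: eq_bigr => a _.
rewrite (gcoord_G2_sum (fun a => der_coord w a D)) ?ltn_ord //.
by have := ltn_ord a; lia.
Qed.

Lemma rhoK x : in_G2 x -> rho_inv (rho x) = x.
Proof.
move=> x0; rewrite {2}(in_G2P x0); apply: eq_bigr => a _.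
by rewrite (der_coord_sum ww (fun a => gcoord a x)).
Qed.

Lemma rho_inj x y : in_G2 x -> in_G2 y -> rho x = rho y -> x = y.
Proof. by move=> x0 y0 E; rewrite -(rhoK x0) E rhoK. Qed.

Lemma lie_block_basis a b k : (a < 14)%N -> (b < 8)%N -> (k < 8)%N ->
  [lie Gv a, Gv (14 + 8 * b + k)] =
  if (k < 7)%N then block b (seval w (@oct_basis K) (oct k) *m rho_mx w a) else 0.
Proof.
move=> a14 b8 k8; have /allP/(_ a) := rho_blocks; rewrite mem_iota => /(_ a14).
move=> /allP/(_ b); rewrite mem_iota => /(_ b8) /allP/(_ k); rewrite mem_iota => /(_ k8).
move/eqP/(congr1 ev); rewrite (ev_br ww chevL) -!/(Gv _) => ->.
case: ifP => k7; last by rewrite seval_nil.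
rewrite evo_oct (mul_oct_rho w _ k7) seval_slin // /seval.
elim: (rho_row a k) => [|p v IHv].
  by rewrite !big_nil block0.
rewrite !big_cons blockP -IHv; congr (_ *: _ + _).
case: (ltnP (N.to_nat p.1) 7) => p7; last first.
  rewrite [OB`_(N.to_nat p.1)]nth_default ?size_oct // block0.
  rewrite nth_default; first exact: (seval_nil w B).
  by rewrite size_take; case: ifP => // s7; apply: leq_trans p7; rewrite leqNgt s7.
by rewrite nth_take // nth_drop block_basis.
Qed.

Lemma lie_block x b v : in_G2 x -> (b < 8)%N -> [lie x, block b v] = block b (v *m rho x).
Proof.
move=> /in_G2P {1}-> b8; rewrite lie_suml /rho mulmx_sumr.
rewrite block_sum; apply: eq_bigr => a _; rewrite lieZl -scalemxAr blockZ.
congr (_ *: _); rewrite /block lie_sumr -/(block b _) [in RHS](oct_sum v) mulmx_suml block_sum.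
apply: eq_bigr => k _; rewrite lieZr lie_block_basis ?ltn_ord //; last by have := ltn_ord k; lia.
by rewrite evo_oct -scalemxAl blockZ.
Qed.

Lemma lie_triv x b : in_G2 x -> (b < 8)%N -> [lie x, Gv (14 + 8 * b + 7)] = 0.
Proof.
move=> /in_G2P {1}-> b8; rewrite lie_suml big1 // => a _.
by rewrite lieZl lie_block_basis // scaler0.
Qed.

Lemma gcoord_block b v k : (b < 8)%N -> (k < 78)%N ->
  gcoord k (block b v) =
  if (14 + 8 * b <= k < 14 + 8 * b + 7)%N then v 0 (inord (k - (14 + 8 * b))) else 0.
Proof.
move=> b8 k78; rewrite /block gcoord_sum.
have i78 (i : 'I_7) : (14 + 8 * b + i < 78)%N by have := ltn_ord i; lia.
case: ifP => [/andP[bk kb]|kb]; last first.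
  rewrite big1 // => i _; rewrite gcoordZ gcoord_G //.
  case: eqP => [ki|_]; last by rewrite mulr0.
  by move: kb (ltn_ord i); rewrite ki; lia.
have k7 : (k - (14 + 8 * b) < 7)%N by lia.
rewrite (bigD1 (inord (k - (14 + 8 * b)))) //= big1 ?addr0 => [|i ik].
  by rewrite gcoordZ gcoord_G ?inordK // ?subnKC // eqxx mulr1.
rewrite gcoordZ gcoord_G //; case: eqP => [ki|_]; last by rewrite mulr0.
by case/eqP: ik; apply: val_inj; rewrite /= inordK // ki addKn.
Qed.

Lemma block_inj b u v : (b < 8)%N -> block b u = block b v -> u = v.
Proof.
move=> b8 E; apply/rowP => k; have k7 := ltn_ord k.
have := congr1 (gcoord (14 + 8 * b + k)) E; rewrite !gcoord_block //; try lia.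
have -> : (14 + 8 * b <= 14 + 8 * b + k < 14 + 8 * b + 7)%N by lia.
by rewrite addKn inord_val.
Qed.

Lemma in_G2_sigma x : in_G2 x <-> sigma0 x = x /\ sigma1 x = x.
Proof.
have := @graded_gcoord 0 0 x isT isT; rewrite expr0 !scale1r => ->.
Local Transparent graded_degree.
split=> x0 k; last by move=> /andP[k14 k78]; apply: x0 => //; rewrite /graded_degree ltnNge k14.
move=> k78; rewrite /graded_degree; case: (ltnP k 14) => // k14 _.
by apply: x0; rewrite k14.
Local Opaque graded_degree.
Qed.

Lemma in_G2_lie x y : in_G2 x -> in_G2 y -> in_G2 [lie x, y].
Proof.
move=> /in_G2_sigma[x0 x1] /in_G2_sigma[y0 y1]; apply/in_G2_sigma.
by rewrite (sigma0_lie ww simpleL chevL) (sigma1_lie ww simpleL chevL) x0 x1 y0 y1.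
Qed.

Lemma in_G2_lin a x y : in_G2 x -> in_G2 y -> in_G2 (a *: x + y).
Proof. by move=> x0 y0 k kk; rewrite gcoordP x0 // y0 // mulr0 addr0. Qed.

Lemma in_G2_0 : in_G2 0.
Proof. by move=> k _; rewrite gcoord0. Qed.

Lemma in_G2_G a : (a < 14)%N -> in_G2 (Gv a).
Proof.
move=> a14 k /andP[k14 k78]; rewrite gcoord_G //; last by lia.
by case: eqP => // E; move: k14; rewrite E leqNgt a14.
Qed.

(** Matrices act on row vectors from the right, whence the reversed commutator. The identity is read
    off from the action on a block, where row vectors embed injectively. *)
Lemma rho_lie x y : in_G2 x -> in_G2 y ->
  rho [lie x, y] = rho y *m rho x - rho x *m rho y.
Proof.
move=> x0 y0; apply/row_matrixP => i; rewrite !rowE.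
apply: (@block_inj 0) => //; rewrite -lie_block //; last exact: in_G2_lie.
rewrite lieAl !lie_block // mulmxBr !mulmxA -scaleN1r addrC -blockP.
by rewrite scaleN1r addrC.
Qed.

Lemma rho_G a : (a < 14)%N -> rho (Gv a) = rho_mx w a.
Proof.
move=> a14; rewrite /rho (bigD1 (Ordinal a14)) //= big1 ?addr0 => [|i ia].
  by rewrite gcoord_G ?eqxx ?scale1r //; lia.
rewrite gcoord_G; [|have := ltn_ord i; lia|lia].
by have /negPf -> : val i != a by []; rewrite scale0r.
Qed.

Lemma graded_blockP b x : (b < 8)%N ->
  (forall k, (k < 78)%N -> graded_degree k != b.+1 -> gcoord k x = 0) ->
  x = block b (\row_(k < 7) gcoord (14 + 8 * b + k) x)
      + gcoord (14 + 8 * b + 7) x *: Gv (14 + 8 * b + 7).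
Proof.
move=> b8 x0; apply: gcoord_ext => k k78; rewrite gcoordD gcoordZ gcoord_block //.
rewrite gcoord_G; [|lia|lia]; case: ifP => kb.
  rewrite mxE inordK; last by lia.
  rewrite subnKC; last by lia.
  by case: eqP => [ke|_]; [lia|rewrite mulr0 addr0].
case: eqP => [<-|ke]; first by rewrite mulr1 add0r.
rewrite mulr0 addr0; apply: x0 => //.
Local Transparent graded_degree.
by rewrite /graded_degree; case: ifP => k14 //; lia.
Local Opaque graded_degree.
Qed.

Lemma graded_triv b k : (b < 8)%N -> (k < 78)%N -> graded_degree k != b.+1 ->
  gcoord k (Gv (14 + 8 * b + 7)) = 0 /\ forall v, gcoord k (block b v) = 0.
Proof.
Local Transparent graded_degree.
move=> b8 k78; rewrite /graded_degree => kb; split=> [|v].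
  rewrite gcoord_G //; last by lia.
  by case: eqP => // ke; case/eqP: kb; rewrite ifF; lia.
rewrite gcoord_block //; case: ifP => // kk; case/eqP: kb.
by rewrite ifF; lia.
Local Opaque graded_degree.
Qed.

End Graded.

(** * Irreducibility of the 7-dimensional modules and simplicity of G2 *)

Definition reach (adj : nat -> seq nat) (n k : nat) : seq nat :=
  iter n (fun s => undup (s ++ flatten (map adj s))) [:: k].

Lemma reach_ind (adj : nat -> seq nat) (P : nat -> Prop) n k :
  (forall i j, P i -> j \in adj i -> P j) -> P k -> {in reach adj n k, forall i, P i}.
Proof.
move=> Padj Pk; elim: n => [|n IHn] i /=; first by rewrite inE => /eqP->.
rewrite mem_undup mem_cat => /orP[/IHn//|/flattenP[s /mapP[j /IHn Pj ->]]].
exact: Padj.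
Qed.

Definition adj_coefs : seq Z :=
  let s := [:: 1; 2; 3; 4; 6; 12; 36]%BZ in s ++ map Z.opp s.

(** An edge means that some basis vector of G2 sends the k-th vector to a nonzero multiple of the
    m-th. If every vertex can be reached, an invariant subspace containing one weight vector
    contains all of them. *)
Definition G2_adj : seq (seq nat) := Eval vm_compute in
  mkseq (fun k => [seq m <- iota 0 14 | has (fun a =>
    let u := sbr (nth [::] graded_vectors a) (nth [::] graded_vectors k) in
    has (fun c => u == sscale (c, Z0) (nth [::] graded_vectors m))
      adj_coefs) (iota 0 14)]) 14.

Definition oct_adj : seq (seq nat) := Eval vm_compute in
  mkseq (fun k => [seq m <- iota 0 7 | has (fun a =>
    has (fun c => rho_row a k == skey m c) adj_coefs) (iota 0 14)]) 7.

Lemma G2_adj_ok :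
  all (fun k => all (fun m => has (fun a =>
    let u := sbr (nth [::] graded_vectors a) (nth [::] graded_vectors k) in
    has (fun c => u == sscale (c, Z0) (nth [::] graded_vectors m))
      adj_coefs) (iota 0 14)) (nth [::] G2_adj k)) (iota 0 14).
Proof. by vm_compute. Qed.

Lemma oct_adj_ok :
  all (fun k => all (fun m => has (fun a =>
    has (fun c => rho_row a k == skey m c) adj_coefs) (iota 0 14))
    (nth [::] oct_adj k)) (iota 0 7).
Proof. by vm_compute. Qed.

Lemma G2_reach :
  all (fun k => all [in reach (nth [::] G2_adj) 12 k] (iota 0 14)) (iota 2 12).
Proof. by vm_compute. Qed.

Lemma oct_reach :
  all (fun k => all [in reach (nth [::] oct_adj) 6 k] (iota 0 7)) (iota 0 7).
Proof. by vm_compute. Qed.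

Lemma mem_G2_reach k i : (2 <= k < 14)%N -> (i < 14)%N -> i \in reach (nth [::] G2_adj) 12 k.
Proof. by move=> k2 i14; apply: (allP (allP G2_reach k _) i _); rewrite mem_iota. Qed.

Lemma mem_oct_reach k i : (k < 7)%N -> (i < 7)%N -> i \in reach (nth [::] oct_adj) 6 k.
Proof. by move=> k7 i7; apply: (allP (allP oct_reach k _) i _); rewrite mem_iota. Qed.

Lemma G2_relations :
  let g := nth [::] graded_vectors in
  all (fun t => sbr (g t.1.1) (g t.1.2) == g t.2)
    [:: (2, 8, 0); (3, 9, 1); (3, 2, 4); (3, 4, 5); (3, 5, 6); (2, 6, 7);
        (9, 8, 10); (9, 10, 11); (9, 11, 12); (8, 12, 13)]%N &&
  all (fun t => sbr (g t.1) (g t.2) == [::])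
    [:: (0, 1); (1, 0); (0, 0); (1, 1); (2, 9); (3, 8); (2, 4); (3, 6); (8, 10); (9, 12)]%N.
Proof. by vm_compute. Qed.

Lemma reg_weight_uniq :
  uniq (map (fun k => reg_weight (graded_weight k)) (iota 1 13)) &&
  uniq (map (fun k => reg_weight (nth (Z0, Z0) oct_weights k)) (iota 0 7)) &&
  all (fun k => reg_weight (graded_weight k) != Z0) (iota 2 12).
Proof. by vm_compute. Qed.

Lemma uniq_map_inj (S T : eqType) (F : S -> T) (s : seq S) :
  uniq (map F s) -> {in s &, injective F}.
Proof.
elim: s => [|a s IHs] //= /andP[Fa /IHs inj] x y; rewrite !inE.
move=> /orP[/eqP->|xs] /orP[/eqP->|ys] // E; last exact: inj.
  by rewrite E map_f in Fa.
by rewrite -E map_f in Fa.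
Qed.

Section Components.
Context {K : fieldType} {V : vectType K}.

(** As for the independence of eigenvectors: [D - l a] removes one component and rescales the
    others, and it preserves [W]. *)
Lemma eigen_components (T : eqType) (s : seq T) (D : 'End(V)) (W : {vspace V})
    (v : T -> V) (l : T -> K) :
  uniq s -> {in s &, injective l} -> {in s, forall t, D (v t) = l t *: v t} ->
  (forall x, x \in W -> D x \in W) -> \sum_(t <- s) v t \in W -> {in s, forall t, v t \in W}.
Proof.
move=> + + + WD; elim: s v => [|a s IHs] v //= /andP[as' us] linj Dv sumW.
have vs : {in s, forall t, v t \in W}.
  move=> t ts; have lta : l t - l a != 0.
    rewrite subr_eq0; apply: contraNneq as' => E.
    by rewrite -(linj t a) ?mem_head ?inE ?ts ?orbT.
  rewrite -[v t](scalerK lta); apply: rpredZ.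
  apply: (IHs (fun t => (l t - l a) *: v t)) => //.
  - by move=> x y xs ys; apply: linj; rewrite inE ?xs ?ys orbT.
  - by move=> x xs; rewrite linearZ /= Dv ?inE ?xs ?orbT // !scalerA mulrC.
  have -> : \sum_(x <- s) (l x - l a) *: v x =
     D (\sum_(x <- a :: s) v x) - l a *: (\sum_(x <- a :: s) v x).
    rewrite !big_cons linearD linear_sum /= Dv ?mem_head // scalerDr opprD addrACA subrr add0r.
    rewrite scaler_sumr -sumrN -big_split /=; apply: eq_big_seq => x xs.
    by rewrite Dv ?inE ?xs ?orbT // scalerBl.
  by rewrite rpredB ?rpredZ ?WD.
move=> t; rewrite inE => /orP[/eqP->|/vs//]; move: sumW; rewrite big_cons rpredDr //.
by rewrite big_seq; apply: rpred_sum => x /vs.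
Qed.

End Components.

Section GradedPieces.
Local Opaque sbr graded_weight graded_degree rho_row.
Context {K : numFieldType} {L : finLieType K}.
Variable w : K.
Hypothesis ww : w ^+ 2 + w + 1 = 0.
Variables e f : 'I_6 -> L.
Hypothesis simpleL : simple_lie {:L}.
Hypothesis chevL : chevalley_generators cartan_E6 {:L} e f.
Local Notation B := (B6 e f).
Local Notation ev := (seval w B).
Local Notation Gv := (Gv w e f).
Local Notation in_G2 := (in_G2 w e f).
Local Notation block := (block w e f).
Local Notation gcoord := (gcoord w e f).
Local Notation rho := (rho w e f).
Variable U : {vspace L}.
Hypothesis UP : forall x, x \in U <-> in_G2 x.

Definition regular_elt : L := zr 7%BZ *: Gv 0 + zr 4%BZ *: Gv 1.

Lemma G2_mem a : (a < 14)%N -> Gv a \in U.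
Proof. by move=> a14; apply/UP; exact: in_G2_G. Qed.

Lemma regular_mem : regular_elt \in U.
Proof. by apply: rpredD; apply: rpredZ; apply: G2_mem. Qed.

Lemma regular_G k : (k < 78)%N -> [lie regular_elt, Gv k] = zr (reg_weight (graded_weight k)) *: Gv k.
Proof.
move=> k78; have [E0 E1] := lie_weight0 ww chevL k78.
by rewrite /regular_elt lieDl !lieZl E0 E1 !scalerA -scalerDl /reg_weight zrD !zrM.
Qed.

Lemma adj_coefs_neq0 c : c \in adj_coefs -> zr c != 0 :> K.
Proof. by move=> cc; rewrite zr_eq0; move: c cc; apply/allP; vm_compute. Qed.

HB.instance Definition _ b :=
  GRing.isLinear.Build K 'rV[K]_7 L *:%R (block b) (blockP w e f b).

Definition V7 (b : nat) : {vspace L} := limg (linfun (block b)).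

Lemma mem_V7 b x : reflect (exists v, x = block b v) (x \in V7 b).
Proof.
apply: (iffP memv_imgP) => [[v _ ->]|[v ->]]; exists v; rewrite ?memvf ?lfunE //.
Qed.

Lemma dim_V7 b : (b < 8)%N -> \dim (V7 b) = 7%N.
Proof.
move=> b8; rewrite /V7 limg_dim_eq.
  by rewrite dimvf.
apply/eqP; rewrite -subv0; apply/subvP => v.
rewrite memv_cap memvf memv_ker lfunE /= memv0 -(block0 w e f b) => /eqP E.
by apply/eqP; apply: (block_inj ww simpleL chevL b8).
Qed.

Lemma oct_edge b k m (W : {vspace L}) : (b < 8)%N -> (k < 7)%N -> (m < 7)%N ->
  submodule U W -> m \in nth [::] oct_adj k ->
  Gv (14 + 8 * b + k) \in W -> Gv (14 + 8 * b + m) \in W.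
Proof.
move=> b8 k7 m7 subW km Gk; have /allP/(_ k) := oct_adj_ok; rewrite mem_iota => /(_ k7).
move/allP/(_ m km)/hasP => [a]; rewrite mem_iota => a14 /hasP[c cc /eqP rowE].
have := subW _ _ (G2_mem a14) Gk; rewrite (lie_block_basis ww chevL) //; last by rewrite ltnW.
rewrite k7 evo_oct mul_oct_rho // rowE seval_skey blockZ block_basis //.
by rewrite rpredZeq (negPf (adj_coefs_neq0 cc)).
Qed.

Lemma oct_adj_lt k m : m \in nth [::] oct_adj k -> (m < 7)%N.
Proof.
case: (ltnP k 7) => k7; last by rewrite nth_default.
by move: m; apply/allP; move: k k7; apply/(@forall7P (fun k => all (fun m => m < 7)%N (nth [::] oct_adj k))).
Qed.

(** The regular element has seven distinct eigenvalues, so a nonzero submodule contains a weight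
    vector, and from it all others are reached. *)
Lemma V7_irreducible b : (b < 8)%N -> irreducible_module U (V7 b).
Proof.
move=> b8; split.
- by rewrite -dimv_eq0 dim_V7.
- move=> x v /UP x0 /mem_V7[u ->]; apply/mem_V7; exists (u *m rho x).
  exact: lie_block.
move=> W WV subW; have [->|Wn0] := eqVneq W 0%VS; [by left|right].
apply/eqP; rewrite eqEsubv WV /=.
have /mem_V7[u Eu] : vpick W \in V7 b by apply: (subvP WV); exact: memv_pick.
have D (k : 'I_7) : linfun (lie regular_elt) (u 0 k *: Gv (14 + 8 * b + k)) =
     zr (reg_weight (nth (Z0, Z0) oct_weights k)) *: (u 0 k *: Gv (14 + 8 * b + k)).
  have k7 := ltn_ord k; rewrite linearZ /= linfun_lieE regular_G; last by lia.
  by rewrite !scalerA mulrC graded_weight_block // ltnW.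
have inj : {in index_enum 'I_7 &, injective (fun k : 'I_7 => zr (reg_weight (nth (Z0, Z0) oct_weights k)) : K)}.
  move=> i j _ _ /zr_inj E; apply/val_inj; have /andP[/andP[_ un] _] := reg_weight_uniq.
  by apply: (uniq_map_inj un) E; rewrite mem_iota ltn_ord.
have WD x : x \in W -> linfun (lie regular_elt) x \in W.
  by rewrite linfun_lieE; apply: subW; exact: regular_mem.
have sumW : \sum_(k <- index_enum 'I_7) u 0 k *: Gv (14 + 8 * b + k) \in W.
  by rewrite -/(block b u) -Eu memv_pick.
have comps := eigen_components (index_enum_uniq _) inj (fun k _ => D k) WD sumW.
have [k uk] : exists k, u 0 k != 0.
  apply/existsP; apply: contraNT Wn0 => /existsPn u0; rewrite -vpick0 Eu.
  by apply/eqP; rewrite /block big1 // => i _; have /negPn/eqP -> := u0 i; rewrite scale0r.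
have Gk : Gv (14 + 8 * b + k) \in W.
  by have := comps k (mem_index_enum _); rewrite rpredZeq (negPf uk).
have GW := @reach_ind (nth [::] oct_adj) (fun i => (i < 7)%N /\ Gv (14 + 8 * b + i) \in W) 6 k.
apply/subvP => _ /mem_V7[v ->]; apply: rpred_sum => i _; apply: rpredZ.
apply: (proj2 (GW _ _ i _)) => [||].
- move=> i1 j1 [i7 Gi] ij; have j7 := oct_adj_lt ij; split => //.
  exact: oct_edge Gi.
- by split.
exact: mem_oct_reach.
Qed.

Lemma graded_irr7_plus_trivial b (M : {vspace L}) : (b < 8)%N ->
  (forall x, x \in M <->
    (forall k, (k < 78)%N -> graded_degree k != b.+1 -> gcoord k x = 0)) ->
  irr7_plus_trivial U M.
Proof.
move=> b8 MP; have gt := graded_triv ww simpleL chevL b8.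
exists (V7 b), <[Gv (14 + 8 * b + 7)]>%VS.
have b78 : (14 + 8 * b + 7 < 78)%N by lia.
have Gn0 := Gv_neq0 ww simpleL chevL b78.
split.
- apply/vspaceP => x; apply/idP/idP.
    move/memv_addP => [_ /mem_V7[v ->]] [_ /vlineP[c ->]] ->; apply/MP => k k78 kb.
    by have [g1 g2] := gt k k78 kb; rewrite gcoordD gcoordZ g1 g2 mulr0 addr0.
  move/MP => x0; rewrite (graded_blockP ww simpleL chevL b8 x0); apply: memv_add.
    by apply/mem_V7; eexists.
  by apply: rpredZ; exact: memv_line.
- apply/eqP; rewrite -subv0; apply/subvP => x; rewrite memv_cap memv0.
  case/andP=> /mem_V7[v ->] /vlineP[c E].
  have := congr1 (gcoord (14 + 8 * b + 7)) E; rewrite gcoordZ gcoord_G // eqxx mulr1.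
  rewrite gcoord_block // ltnn andbF => c0.
  by rewrite E -c0 scale0r.
- by split; [exact: dim_V7|exact: V7_irreducible].
- by rewrite dim_vline Gn0.
by move=> x v /UP x0 /vlineP[c ->]; rewrite lieZr (lie_triv ww simpleL chevL) // scaler0.
Qed.

Lemma G2_edge k m (W : {vspace L}) : (k < 14)%N -> lie_ideal U W -> m \in nth [::] G2_adj k ->
  Gv k \in W -> Gv m \in W.
Proof.
move=> k14 [_ idW] km Gk; have /allP/(_ k) := G2_adj_ok; rewrite mem_iota => /(_ k14).
move/allP/(_ m km)/hasP => [a]; rewrite mem_iota => a14 /hasP[c cc /eqP/(congr1 ev)].
rewrite (ev_br ww chevL) sevalZ // -!/(Gv _) => E.
have := idW _ _ (G2_mem a14) Gk; rewrite E rpredZeq /eval_eis /= zr0 mul0r addr0.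
by rewrite (negPf (adj_coefs_neq0 cc)).
Qed.

Lemma G2_adj_lt k m : m \in nth [::] G2_adj k -> (m < 14)%N.
Proof.
case: (ltnP k 14) => k14; last by rewrite nth_default.
have /allP/(_ k) : all (fun k => all (fun m => m < 14)%N (nth [::] G2_adj k)) (iota 0 14) by vm_compute.
by rewrite mem_iota => /(_ k14)/allP; apply.
Qed.

Lemma U_subalgebra : subalgebra U.
Proof. by move=> x y /UP x0 /UP y0; apply/UP; exact: in_G2_lie. Qed.

Lemma U_simple : simple_lie U.
Proof.
split; first exact: U_subalgebra.
  exists (Gv 0), (Gv 2); split; try exact: G2_mem.
  have [-> _] := lie_weight0 ww chevL (isT : (2 < 78)%N).
  have G2n0 := Gv_neq0 ww simpleL chevL (isT : (2 < 78)%N).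
  by rewrite scaler_eq0 (negPf G2n0) orbF zr_eq0; vm_compute.
move=> I idI; have [IU idW] := idI.
have [->|In0] := eqVneq I 0%VS; [by left|right].
apply/eqP; rewrite eqEsubv IU /=.
have x0 : in_G2 (vpick I) by apply/UP; apply: (subvP IU); exact: memv_pick.
(* The two torus vectors share the eigenvalue 0 and are merged into one component, stored at index
   1. *)
pose t := gcoord 0 (vpick I) *: Gv 0 + gcoord 1 (vpick I) *: Gv 1.
pose c k := if k == 1%N then t else gcoord k (vpick I) *: Gv k.
have sumI : \sum_(k <- iota 1 13) c k = vpick I.
  rewrite [RHS](in_G2P ww simpleL chevL x0) -(big_mkord xpredT (fun k => gcoord k (vpick I) *: Gv k)).
  rewrite /index_iota subn0 /= !big_cons /c /= /t !big_nil; rewrite !addrA.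
  by [].
have D k : k \in iota 1 13 -> linfun (lie regular_elt) (c k) = zr (reg_weight (graded_weight k)) *: c k.
  rewrite mem_iota => /andP[k1 k14]; rewrite linfun_lieE /c; case: eqP => [->|_].
    rewrite /t lieDr !lieZr !regular_G // scalerDr !scalerA.
    by congr (_ *: _ + _ *: _); rewrite mulrC.
  by rewrite lieZr regular_G ?scalerA 1?mulrC //; lia.
have inj : {in iota 1 13 &, injective (fun k => zr (reg_weight (graded_weight k)) : K)}.
  move=> i j si sj /zr_inj E; have /andP[/andP[un _] _] := reg_weight_uniq.
  exact: (uniq_map_inj un) E.
have WD x : x \in I -> linfun (lie regular_elt) x \in I.
  by rewrite linfun_lieE; apply: idW; exact: regular_mem.
have comps := eigen_components (iota_uniq 1 13) inj D WD.
rewrite sumI memv_pick in comps; have {}comps := comps isT.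
have [k /andP[k2 k14] Gk] : exists2 k, (2 <= k < 14)%N & Gv k \in I.
  have [/hasP[k]|/hasPn none] := boolP (has (fun k => gcoord k (vpick I) != 0) (iota 2 12)).
    rewrite mem_iota => kk ck; exists k => //.
    have := comps k; rewrite mem_iota /c ifF; last by lia.
    by rewrite rpredZeq (negPf ck) /=; apply; lia.
  (* Without a root component the chosen vector is the torus element t. Its brackets with vectors 5
     and 7, of weights (0, 1) and (1, 0), detect both coordinates of t and put a root vector into
     [I]. *)
  have tI : t \in I by have := comps 1%N; rewrite /c eqxx; apply.
  have tn0 : t != 0.
    apply: contraNneq In0 => t0; rewrite -vpick0 -sumI; apply/eqP; rewrite big_seq big1 // => k.
    rewrite mem_iota /c => k14; case: eqP => [//|k1].
    by have := none k; rewrite mem_iota negbK => /(_ ltac:(lia))/eqP ->; rewrite scale0r.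
  have lt k : (k < 78)%N -> [lie t, Gv k] = (gcoord 0 (vpick I) * zr (graded_weight k).1
      + gcoord 1 (vpick I) * zr (graded_weight k).2) *: Gv k.
    move=> k78; have [E0 E1] := lie_weight0 ww chevL k78.
    by rewrite /t lieDl !lieZl E0 E1 !scalerA -scalerDl.
  have ltI k : (k < 14)%N -> [lie t, Gv k] \in I.
    by move=> k14; rewrite lieC rpredN; apply: idW => //; exact: G2_mem.
  have := ltI 5%N isT; have := ltI 7%N isT; rewrite !lt // !rpredZeq.
  have -> : graded_weight 7 = (1, 0)%BZ by [].
  have -> : graded_weight 5 = (0, 1)%BZ by [].
  rewrite zr0 zr1 !mulr0 !mulr1 addr0 add0r.
  case: eqP => [c0 _|_ /= G7]; last by exists 7%N.
  case: eqP => [c1 _|_ /= G5]; last by exists 5%N.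
  by case/eqP: tn0; rewrite /t c0 c1 !scale0r addr0.
have GW := @reach_ind (nth [::] G2_adj) (fun i => (i < 14)%N /\ Gv i \in I) 12 k.
apply/subvP => x /UP/(in_G2P ww simpleL chevL) ->; apply: rpred_sum => i _; apply: rpredZ.
apply: (proj2 (GW _ _ i _)) => [||].
- by move=> i1 j1 [i14 Gi] ij; split; [exact: G2_adj_lt ij|exact: G2_edge ij Gi].
- by split.
by apply: mem_G2_reach; rewrite ?k2 ?k14.
Qed.

Lemma G2_bracket (a b c : nat) :
  (a, b, c) \in [:: (2, 8, 0); (3, 9, 1); (3, 2, 4); (3, 4, 5); (3, 5, 6); (2, 6, 7);
        (9, 8, 10); (9, 10, 11); (9, 11, 12); (8, 12, 13)]%N -> [lie Gv a, Gv b] = Gv c.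
Proof.
move=> abc; have /andP[/allP/(_ _ abc)/eqP/(congr1 ev) E _] := G2_relations.
by rewrite (ev_br ww chevL) in E.
Qed.

Lemma G2_bracket0 (a b : nat) :
  (a, b) \in [:: (0, 1); (1, 0); (0, 0); (1, 1); (2, 9); (3, 8); (2, 4); (3, 6); (8, 10); (9, 12)]%N ->
  [lie Gv a, Gv b] = 0.
Proof.
move=> ab; have /andP[_ /allP/(_ _ ab)/eqP/(congr1 ev) E] := G2_relations.
by rewrite (ev_br ww chevL) seval_nil in E.
Qed.

Lemma ord2 (P : 'I_2 -> Prop) : P 0 -> P 1 -> forall i, P i.
Proof.
move=> P0 P1 [[|[|//]] i2].
  by rewrite (_ : Ordinal i2 = 0) //; apply: val_inj.
by rewrite (_ : Ordinal i2 = 1) //; apply: val_inj.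
Qed.

Lemma cartan_G2E i j : (cartan_G2 i j)%:~R =
  nth 0 (nth [::] [:: [:: 2; -1]; [:: - 3; 2]] i) j :> K.
Proof. by rewrite mxE; move: i j; apply: ord2; apply: ord2; rewrite /= ?rmorphN. Qed.

(** Index 0 is the long simple root, so the entry -3 of [cartan_G2] is the action of the short
    coroot on the long root vector. *)
Lemma U_chevalley : chevalley_generators cartan_G2 U
  (fun i : 'I_2 => Gv (2 + i)) (fun i : 'I_2 => Gv (8 + i)).
Proof.
have h (i : 'I_2) : [lie Gv (2 + i), Gv (8 + i)] = Gv i.
  by move: i; apply: ord2; apply: G2_bracket.
have zrs : [/\ zr 2%BZ = 2 :> K, zr 3%BZ = 3 :> K, zr (-2)%BZ = -2 :> K, zr (-3)%BZ = -3 :> K & zr (-1)%BZ = -1 :> K].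
  have z2 : zr 2%BZ = 2 :> K by exact: zr2.
  have z3 : zr 3%BZ = 3 :> K by rewrite -[3%BZ]/(Z.add 2%BZ 1%BZ) zrD zr2 zr1; ring.
  by split=> //; rewrite -[(-_)%BZ]/(Z.opp _) zrN ?z2 ?z3 ?zr1.
have [z2 z3 zN2 zN3 zN1] := zrs.
have c01 : cartan_G2 0 1 = -1 by rewrite mxE.
have c10 : cartan_G2 1 0 = -3 by rewrite mxE.
have wt2 : graded_weight 2 = (2, -3)%BZ by [].
have wt3 : graded_weight 3 = (-1, 2)%BZ by [].
have wt8 : graded_weight 8 = (-2, 3)%BZ by [].
have wt9 : graded_weight 9 = (1, -2)%BZ by [].
have /= [h02 h12] := lie_weight0 ww chevL (isT : (2 < 78)%N).
have /= [h03 h13] := lie_weight0 ww chevL (isT : (3 < 78)%N).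
have /= [h08 h18] := lie_weight0 ww chevL (isT : (8 < 78)%N).
have /= [h09 h19] := lie_weight0 ww chevL (isT : (9 < 78)%N).
rewrite wt2 /= z2 zN3 in h02 h12; rewrite wt3 /= z2 zN1 in h03 h13.
rewrite wt8 /= zN2 z3 in h08 h18; rewrite wt9 /= zr1 zN2 in h09 h19.
split.
- by move=> i; have i2 := ltn_ord i; split; apply: G2_mem; lia.
- move=> i j; rewrite !h; move: i j; apply: ord2; apply: ord2; rewrite ?G2_bracket0 //.
- by apply: ord2; apply: ord2 => //= _; apply: G2_bracket0.
- by move=> i j; rewrite h cartan_G2E; move: i j; apply: ord2; apply: ord2.
- move=> i j; rewrite h cartan_G2E; move: i j; apply: ord2; apply: ord2 => //=;
    rewrite opprK; by [exact: h18|exact: h09].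
- apply: ord2; apply: ord2 => // _.
    rewrite c01 /= [ [lie Gv 2, Gv 3]]lieC lieNr (@G2_bracket 3 2 4 isT).
    by rewrite G2_bracket0 // oppr0.
  by rewrite c10 /= (@G2_bracket 3 2 4 isT) (@G2_bracket 3 4 5 isT)
             (@G2_bracket 3 5 6 isT) G2_bracket0.
- apply: ord2; apply: ord2 => // _.
    rewrite c01 /= [ [lie Gv 8, Gv 9]]lieC lieNr (@G2_bracket 9 8 10 isT).
    by rewrite G2_bracket0 // oppr0.
  by rewrite c10 /= (@G2_bracket 9 8 10 isT) (@G2_bracket 9 10 11 isT)
             (@G2_bracket 9 11 12 isT) G2_bracket0.
move=> W subW gW; have [W2 W8] := gW 0; have [W3 W9] := gW 1.
have br a b c : (a, b, c) \in [:: (2, 8, 0); (3, 9, 1); (3, 2, 4); (3, 4, 5); (3, 5, 6); (2, 6, 7);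
        (9, 8, 10); (9, 10, 11); (9, 11, 12); (8, 12, 13)]%N ->
    Gv a \in W -> Gv b \in W -> Gv c \in W.
  by move=> abc aW bW; rewrite -(G2_bracket abc); apply: subW.
have W0 := br 2 8 0 isT W2 W8.
have W1 := br 3 9 1 isT W3 W9.
have W4 := br 3 2 4 isT W3 W2.
have W5 := br 3 4 5 isT W3 W4.
have W6 := br 3 5 6 isT W3 W5.
have W7 := br 2 6 7 isT W2 W6.
have W10 := br 9 8 10 isT W9 W8.
have W11 := br 9 10 11 isT W9 W10.
have W12 := br 9 11 12 isT W9 W11.
have W13 := br 8 12 13 isT W8 W12.
apply/subvP => x /UP/(in_G2P ww simpleL chevL) ->; apply: rpred_sum => a _; apply: rpredZ.
case: a => a a14 /=; move: a a14.
by do 14 (case=> [_ //|]).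
Qed.

End GradedPieces.

(** * Cartan subalgebras of G2 *)

Section JordanDecomposition.
Context {K : numClosedFieldType}.

Lemma poly_crt (rs : seq K) (c : K -> K) m : uniq rs ->
  exists p : {poly K}, {in rs, forall a, ('X - a%:P) ^+ m %| p - (c a)%:P}.
Proof.
elim: rs => [|b rs IHrs] /=; first by exists 0.
move=> /andP[brs /IHrs[p pP]]; set Q := \prod_(a <- rs) ('X - a%:P) ^+ m.
have coQ : coprimep Q (('X - b%:P) ^+ m).
  rewrite coprimep_expr // coprimep_sym /Q big_seq.
  elim/big_ind: _ => [|x y xc yc|a ars]; rewrite ?coprimep1 ?coprimepMr ?xc //.
  rewrite coprimep_expr // coprimep_XsubC root_XsubC.
  by apply: contraNneq brs => <-.
have [[u v] /= uv] := Bezout_eq1_coprimepP _ _ coQ.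
exists (p + ((c b)%:P - p) * (u * Q)) => a; rewrite inE.
have [->_|ab /= ars] := eqVneq a b.
  have -> : p + ((c b)%:P - p) * (u * Q) - (c b)%:P =
     (p - (c b)%:P) * (1 - u * Q) by ring.
  by rewrite -uv addrAC subrr add0r mulrA dvdp_mull.
rewrite addrAC dvdp_add ?pP // mulrA dvdp_mull // /Q (big_rem a) //=.
exact: dvdp_mulr.
Qed.

(** The generalized eigenspaces span, being kernels of coprime polynomials whose product is a
    multiple of the characteristic polynomial. *)
Lemma geigenspace_ext n (D : 'M[K]_n.+1) (W : lmodType K) (f : 'rV[K]_n.+1 -> W) :
  linear f -> (forall a v, v *m (D - a%:M) ^+ n.+1 = 0 -> f v = 0) -> forall u, f u = 0.
Proof.
move=> linf f0 u.
pose g : {linear 'rV[K]_n.+1 -> W} := HB.pack f (GRing.isLinear.Build K _ W *:%R f linf).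
rewrite -[f u]/(g u).
have [rs rsP] := closed_field_poly_normal (char_poly D).
rewrite (monicP (char_poly_monic D)) scale1r in rsP.
pose rs' := undup rs; pose p i := ('X - (rs'`_i)%:P) ^+ n.+1.
have co : {in xpredT &, forall i j : 'I_(size rs'), j != i -> coprimep (p i) (p j)}.
  move=> i j _ _ ij; rewrite coprimep_expl // coprimep_expr // coprimep_XsubC root_XsubC.
  by rewrite nth_uniq // ?undup_uniq.
(* The exponent n+1 is the dimension and so bounds every multiplicity. *)
have dvd : char_poly D %| \prod_(i < size rs') p i.
  have -> : \prod_(i < size rs') p i = (\prod_(a <- rs') ('X - a%:P)) ^+ n.+1.
    by rewrite (big_nth 0) big_mkord prodrXl.
  rewrite rsP; have -> : n.+1 = size rs by have := size_char_poly D; rewrite rsP size_prod_XsubC => - [].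
  have : {subset rs <= rs'} by move=> a; rewrite mem_undup.
  elim: (rs) => [|a s IHs] sub; first by rewrite big_nil dvd1p.
  rewrite big_cons exprS dvdp_mul //; last by apply: IHs => x xs; apply: sub; rewrite inE xs orbT.
  by rewrite dvdp_XsubCl root_prod_XsubC sub ?mem_head.
have top : (1%:M <= \sum_(i < size rs') kermxpoly D (p i))%MS.
  rewrite -(kermxpoly_prod D co) kermxpoly_min //.
  by apply: dvdp_trans dvd; exact: mxminpoly_dvd_char.
have /sub_sumsmxP[c cE] := submx_trans (submx1 u) top.
rewrite cE linear_sum big1 // => i _; apply: (f0 rs'`_i).
have := mulmx_ker (horner_mx D (p i)); rewrite /kermxpoly => ker0.
have -> : (D - (rs'`_i)%:M) ^+ n.+1 = horner_mx D (p i).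
  by rewrite /p rmorphXn rmorphB /= horner_mx_X horner_mx_C.
by rewrite -mulmxA mulmx_ker mulmx0.
Qed.

(** S is a polynomial in D congruent to a modulo (X-a)^m for every eigenvalue a. The exponent m is
    left free, because products and images of generalized eigenvectors are naturally killed by
    higher powers. *)
Lemma jordan_semisimple n (D : 'M[K]_n.+1) m : (n < m)%N -> exists S : 'M[K]_n.+1,
  diagonalizable S /\
  forall a (v : 'rV_n.+1), v *m (D - a%:M) ^+ m = 0 -> v *m S = a *: v.
Proof.
move=> nm; have [rs rsP] := closed_field_poly_normal (char_poly D).
rewrite (monicP (char_poly_monic D)) scale1r in rsP.
have [p pP] := @poly_crt (undup rs) id m (undup_uniq rs).
pose S := horner_mx D p.
have eig a (v : 'rV_n.+1) : v *m (D - a%:M) ^+ m = 0 -> v != 0 -> a \in undup rs.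
  move=> Dv v0; rewrite mem_undup -root_prod_XsubC -rsP -eigenvalue_root_char.
  apply: contraNT v0; rewrite /eigenvalue negbK => /eqP ker0.
  have : D - a%:M \in unitmx by rewrite -row_free_unit -kermx_eq0; apply/eqP.
  by move/(unitrX m) => Du; rewrite -[v](mulmxK Du) Dv mul0mx.
have SE a (v : 'rV_n.+1) : v *m (D - a%:M) ^+ m = 0 -> v *m S = a *: v.
  move=> Dv; have [->|v0] := eqVneq v 0; first by rewrite mul0mx scaler0.
  have /dvdpP[q Eq] := pP a (eig a v Dv v0); rewrite /= in Eq.
  have pE : p = ('X - a%:P) ^+ m * q + a%:P by rewrite mulrC -Eq subrK.
  rewrite /S pE rmorphD rmorphM rmorphXn rmorphB /= horner_mx_X horner_mx_C.
  by rewrite mulmxDr mulmxA Dv mul0mx add0r mul_mx_scalar.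
exists S; split => //; apply/diagonalizableP; exists (undup rs); first exact: undup_uniq.
apply: mxminpoly_min; apply/row_matrixP => i; rewrite row0 rowE; move: (delta_mx 0 i).
apply: (@geigenspace_ext n D _ (fun v => v *m _)) => [a x y|a v Dv].
  by rewrite mulmxDl scalemxAl.
have {}Dv : v *m (D - a%:M) ^+ m = 0.
  by rewrite -(subnKC nm) exprD mulmxA Dv mul0mx.
have [->|v0] := eqVneq v 0; first by rewrite mul0mx.
rewrite (big_rem a) /= ?(eig a v) // rmorphM /= mulmxA rmorphB /= horner_mx_X horner_mx_C.
by rewrite mulmxBr (SE a v Dv) mul_mx_scalar subrr mul0mx.
Qed.

(** Moving D - a past E costs one commutator, so each step lowers either the order i of the vector
    or the order k of the iterated commutator. *)
Lemma geigen_comm n (D E : 'M[K]_n.+1) a i k (v : 'rV_n.+1) :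
  v *m (D - a%:M) ^+ i = 0 -> iter k (fun X => X *m D - D *m X) E = 0 ->
  v *m E *m (D - a%:M) ^+ (i + k) = 0.
Proof.
move ik: (i + k)%N => m; elim: m i k ik E v => [|m IHm] i k ik E v.
  by case: i ik => // _; rewrite expr0 mulmx1 => -> _; rewrite !mul0mx.
case: i ik => [|i] ik Dv; first by rewrite expr0 mulmx1 in Dv; rewrite Dv !mul0mx.
case: k ik => [|k] ik Ek; first by rewrite /= in Ek; rewrite Ek mulmx0 !mul0mx.
have -> : v *m E *m (D - a%:M) ^+ m.+1 =
    (v *m (D - a%:M)) *m E *m (D - a%:M) ^+ m + v *m (E *m D - D *m E) *m (D - a%:M) ^+ m.
  rewrite exprS mulmxA -mulmxDl; congr (_ *m _).
  rewrite !mulmxBr !mulmxBl !mulmxA !mul_mx_scalar -!scalemxAl.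
  by rewrite [in RHS]addrC addrA subrK.
rewrite (IHm i k.+1) //; first last.
- by rewrite exprS mulmxA in Dv.
- by move: ik; rewrite addSn => - [].
rewrite (IHm i.+1 k) ?addr0 //; last by rewrite -iterSr.
by move: ik; rewrite addnS => - [].
Qed.

Lemma geigen_jordan n (D S : 'M[K]_n.+1) m :
  (forall a (v : 'rV_n.+1), v *m (D - a%:M) ^+ m = 0 -> v *m S = a *: v) ->
  forall a (v : 'rV_n.+1) k, (k <= m)%N -> v *m (D - a%:M) ^+ k = 0 -> v *m (D - S) ^+ k = 0.
Proof.
move=> SE a v k km; elim: k km v => [|k IHk] km v Dv; first by rewrite expr0 in Dv *.
rewrite exprS mulmxA; apply: IHk; first exact: ltnW.
rewrite mulmxBr (SE a); last by rewrite -(subnKC km) exprD mulmxA Dv mul0mx.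
by rewrite exprS mulmxA mulmxBr mul_mx_scalar in Dv.
Qed.

End JordanDecomposition.

(** * Lower central series and an Engel argument *)

Section EngelLemma.
Context {K : fieldType} {L : finLieType K}.
Implicit Types (U W V H C : {vspace L}) (x y h : L).

Lemma lie_prodP U W x y : x \in U -> y \in W -> [lie x, y] \in lie_prod U W.
Proof.
move=> xU yW; rewrite (coord_vbasis xU) (coord_vbasis yW) lie_suml.
apply: rpred_sum => i _; rewrite lie_sumr; apply: rpred_sum => j _.
rewrite lieZl lieZr; do 2 apply: rpredZ; apply: memv_span.
by apply: allpairs_f; apply: mem_nth; rewrite size_tuple.
Qed.

Lemma lie_prod_sub U W V : (forall x y, x \in U -> y \in W -> [lie x, y] \in V) ->
  (lie_prod U W <= V)%VS.
Proof.
move=> UWV; apply/span_subvP => _ /allpairsP[[x y] /= [xU yW ->]].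
by apply: UWV; [apply: (vbasis_mem xU)|apply: (vbasis_mem yW)].
Qed.

Lemma lower_central_sub H k : subalgebra H ->
  (iter k.+1 (lie_prod H) H <= iter k (lie_prod H) H)%VS /\ (iter k (lie_prod H) H <= H)%VS.
Proof.
move=> subH; elim: k => [|k [IH1 IH2]] /=.
  by split => //; apply: lie_prod_sub.
split; last exact: subv_trans IH1 IH2.
by apply: lie_prod_sub => x y xH /(subvP IH1); apply: lie_prodP.
Qed.

(* The lower central series of H replaces the usual induction on dimension in
   Engel's theorem: each term acts on the normalizer, modulo H, of the next one by
   commuting operators. *)
Lemma engel_normalizer H C : subalgebra H -> nilpotent_lie H -> (H <= C)%VS ->
  (forall h y, h \in H -> y \in C -> [lie h, y] \in C) ->
  (forall h y, h \in H -> y \in C -> exists m, iter m (lie h) y = 0) ->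
  C != H -> exists y, [/\ y \in C, y \notin H & forall h, h \in H -> [lie h, y] \in H].
Proof.
move=> subH [n nilH] HC stabC nilC CH; pose H_ k := iter k (lie_prod H) H.
suff : forall j k, (j + k)%N = n ->
    exists y, [/\ y \in C, y \notin H & forall h, h \in H_ k -> [lie h, y] \in H].
  by move/(_ n 0%N (addn0 n)).
elim=> [|j IHj] k jk.
  have /subvPn[y yC yH] : ~~ (C <= H)%VS by apply: contra CH => CH; rewrite eqEsubv CH.
  exists y; split=> // h; rewrite /H_ -[k]/(0 + k)%N jk nilH memv0 => /eqP ->.
  by rewrite lie0x mem0v.
have {IHj} [|y0 [y0C y0H y0k]] := IHj k.+1; first by rewrite addnS -addSn.
have [Hk1 HkH] := lower_central_sub k subH; rewrite -/(H_ k) in HkH.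
have [Hk2 _] := lower_central_sub k.+1 subH.
(* A spanning list of [H_ k] is treated one element x at a time, replacing y by its last iterate
   under ad x that lies outside H. *)
have subHk (s : seq L) : {subset s <= H_ k} -> exists y, [/\ y \in C, y \notin H,
    forall h, h \in H_ k.+1 -> [lie h, y] \in H & forall h, h \in s -> [lie h, y] \in H].
  elim: s => [|x s IHs] sub; first by exists y0.
  have xk : x \in H_ k by apply: sub; rewrite mem_head.
  have {IHs} [|y [yC yH y1 ys]] := IHs; first by move=> z zs; apply: sub; rewrite inE zs orbT.
  have xH := subvP HkH _ xk.
  (* Iterating ad x keeps what was achieved for the earlier h, since [h, x] lies in the next term of
     the series. *)
  have inv m : let z := iter m (lie x) y in [/\ z \in C,
      forall h, h \in H_ k.+1 -> [lie h, z] \in H & forall h, h \in s -> [lie h, z] \in H].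
    elim: m => [|m [zC z1 zs]] //=; set z := iter m _ _ in zC z1 zs *; split.
    - exact: stabC.
    - move=> h h1; rewrite lieA; apply: rpredD; last by apply: subH => //; exact: z1.
      apply: z1; rewrite lieC rpredN; apply: (subvP Hk2); exact: lie_prodP.
    move=> h hs; rewrite lieA; apply: rpredD; last by apply: subH => //; exact: zs.
    apply: z1; apply: lie_prodP => //; apply: (subvP HkH); apply: sub.
    by rewrite inE hs orbT.
  have [m0 m0y] := nilC x y xH yC.
  have ex : exists m, iter m (lie x) y \in H by exists m0; rewrite m0y mem0v.
  case: (ex_minnP ex) => [[|m]] mH min; first by rewrite /= (negPf yH) in mH.
  have [zC z1 zs] := inv m; exists (iter m (lie x) y); split=> //.
    by apply/negP => /min; rewrite ltnn.
  by move=> h; rewrite inE => /orP[/eqP->|/zs//].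
have [y [yC yH _ yk]] := subHk (vbasis (H_ k)) (fun z => @vbasis_mem _ _ z (H_ k)).
exists y; split=> // h hk; rewrite (coord_vbasis hk) lie_suml.
apply: rpred_sum => i _; rewrite lieZl; apply: rpredZ; apply: yk.
by apply: mem_nth; rewrite size_tuple.
Qed.

Lemma nilpotent_iter H n x y k : iter n (lie_prod H) H = 0%VS -> x \in H -> y \in H ->
  (n <= k)%N -> iter k (lie x) y = 0.
Proof.
move=> nilH xH yH nk.
have inH m : iter m (lie x) y \in iter m (lie_prod H) H.
  by elim: m => [|m IHm] //=; apply: lie_prodP.
rewrite -(subnK nk) iterD; have := inH n; rewrite nilH memv0 => /eqP ->.
by elim: (k - n)%N => [|m IHm] //=; rewrite IHm liex0.
Qed.

End EngelLemma.

(** * A Cartan subalgebra as the centralizer of its semisimple elements *)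

Section CartanG2.
Context {K : numClosedFieldType} {L : finLieType K}.
Variable w : K.
Hypothesis ww : w ^+ 2 + w + 1 = 0.
Variables e f : 'I_6 -> L.
Hypothesis simpleL : simple_lie {:L}.
Hypothesis chevL : chevalley_generators cartan_E6 {:L} e f.
Local Notation star := (star w).
Local Notation derivation := (derivation w).
Local Notation in_G2 := (in_G2 w e f).
Local Notation rho := (rho w e f).
Local Notation rho_inv := (rho_inv w e f).

(** Leibniz rule: D - a - b acts on uv as D - a on u plus D - b on v. *)
Lemma geigen_star (D : 'M[K]_7) a b i j u v : derivation D ->
  u *m (D - a%:M) ^+ i = 0 -> v *m (D - b%:M) ^+ j = 0 ->
  star u v *m (D - (a + b)%:M) ^+ (i + j) = 0.
Proof.
move=> derD; move ij: (i + j)%N => m; elim: m i j ij u v => [|m IHm] i j ij u v.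
  by case: i ij => // _; rewrite expr0 mulmx1 => -> _; rewrite star0l mul0mx.
case: i ij => [|i] ij Du; first by rewrite expr0 mulmx1 in Du; rewrite Du star0l mul0mx.
case: j ij => [|j] ij Dv; first by rewrite expr0 mulmx1 in Dv; rewrite Dv star0r mul0mx.
have -> : star u v *m (D - (a + b)%:M) ^+ m.+1 =
    star (u *m (D - a%:M)) v *m (D - (a + b)%:M) ^+ m
    + star u (v *m (D - b%:M)) *m (D - (a + b)%:M) ^+ m.
  rewrite exprS mulmxA -mulmxDl; congr (_ *m _).
  rewrite !mulmxBr derD !mul_mx_scalar starDl starNl starDr starNr starZl starZr scalerDl.
  by rewrite opprD addrACA.
rewrite (IHm i j.+1) //; first last.
- by rewrite exprS mulmxA in Du.
- by move: ij; rewrite addSn => - [].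
rewrite (IHm i.+1 j) ?addr0 //; last by rewrite exprS mulmxA in Dv.
by move: ij; rewrite addnS => - [].
Qed.

(* The product of the generalized eigenspaces of D for a and b lies in the one for
   a + b, so the semisimple part of a derivation is a derivation. *)
Lemma derivation_jordan (D : 'M[K]_7) n : derivation D -> exists S, [/\ derivation S,
  diagonalizable S, (D - S) ^+ 7 = 0 &
  forall E : 'M[K]_7, iter n (fun X => X *m D - D *m X) E = 0 -> E *m S = S *m E].
Proof.
(* The exponent n + 14 covers 7 + 7, for products of two generalized eigenvectors, and 7 + n, for
   images under E. *)
move=> derD; have [|S [diagS SE]] := @jordan_semisimple K 6 D (n + 14); first by lia.
have ge7 i a (v : 'rV[K]_7) : (i <= n + 14)%N -> v *m (D - a%:M) ^+ i = 0 -> v *m S = a *: v.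
  by move=> im Dv; apply: SE; rewrite -(subnKC im) exprD mulmxA Dv mul0mx.
exists S; split => //.
- move=> u v; apply/eqP; rewrite -subr_eq0; apply/eqP; move: u.
  apply: (@geigenspace_ext K 6 D _ (fun u => _ - _)) => [c x y|a u Du].
    by rewrite !(starPl, mulmxDl, =^~ scalemxAl); apply/rowP => k; rewrite !mxE; ring.
  move: v; apply: (@geigenspace_ext K 6 D _ (fun v => _ - _)) => [c x y|b v Dv].
    by rewrite !(starPr, mulmxDl, =^~ scalemxAl); apply/rowP => k; rewrite !mxE; ring.
  have [m7 m14] : (7 <= n + 14)%N /\ (14 <= n + 14)%N by split; lia.
  rewrite (ge7 14%N (a + b) (star u v) m14 (geigen_star derD Du Dv)).
  by rewrite (ge7 7%N a u m7 Du) (ge7 7%N b v m7 Dv) starZl starZr scalerDl subrr.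
- apply/row_matrixP => i; rewrite row0 rowE; move: (delta_mx 0 i).
  apply: (@geigenspace_ext K 6 D _ (fun u => _ *m _)) => [c x y|a u Du].
    by rewrite mulmxDl scalemxAl.
  by apply: (geigen_jordan SE _ Du); lia.
move=> E Ek; apply/row_matrixP => i; rewrite !rowE; apply/eqP; rewrite -subr_eq0; apply/eqP.
move: (delta_mx 0 i); apply: (@geigenspace_ext K 6 D _ (fun u => _ - _)) => [c x y|a u Du].
  by rewrite !(mulmxDl, =^~ scalemxAl); apply/rowP => k; rewrite !mxE; ring.
have Dv := geigen_comm Du Ek.
have [m7 mn] : (7 <= n + 14)%N /\ (7 + n <= n + 14)%N by split; lia.
by rewrite !mulmxA (ge7 7%N a u m7 Du) (ge7 (7 + n)%N a (u *m E) mn Dv) scalemxAl subrr.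
Qed.

Lemma iter_rho x y n : in_G2 x -> in_G2 y ->
  in_G2 (iter n (lie x) y) /\
  rho (iter n (lie x) y) = iter n (fun X => X *m rho x - rho x *m X) (rho y).
Proof.
move=> x0 y0; elim: n => [|n [IH1 IH2]] //=; split; first exact: in_G2_lie.
by rewrite (rho_lie ww simpleL chevL) // IH2.
Qed.

(** The iterated commutator is a combination of terms N^i E N^j with i + j = 14, so i or j is at
    least 7. *)
Lemma comm_nilpotent (N E : 'M[K]_7) : N ^+ 7 = 0 ->
  iter 14 (fun X => X *m N - N *m X) E = 0.
Proof.
move=> N7.
have nil i : (7 <= i)%N -> N ^+ i = 0.
  by move=> i7; rewrite -(subnKC i7) exprD N7 mul0r.
have H m : forall i j, (14 <= i + j + m)%N ->
    N ^+ i *m iter m (fun X => X *m N - N *m X) E *m N ^+ j = 0.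
  elim: m => [|m IHm] i j ijm /=.
    have [i7|i7] := leqP 7 i; first by rewrite nil // !mul0mx.
    by rewrite (nil j) ?mulmx0 //; lia.
  rewrite mulmxBr mulmxBl !mulmxA -[X in X - _]mulmxA.
  rewrite -[N *m N ^+ j]/(N * N ^+ j) -[N ^+ i *m N]/(N ^+ i * N) -exprS -exprSr.
  by rewrite !IHm ?subr0 //; lia.
by have := H 14%N 0%N 0%N isT; rewrite !expr0 mul1mx mulmx1.
Qed.

(** Centrality in H makes these elements commute, and commuting diagonalizable matrices are
    simultaneously diagonal; hence a subspace. *)
Lemma semisimple_span (H : {vspace L}) : (forall x, x \in H -> in_G2 x) ->
  exists W : {vspace L}, forall x, x \in W <->
    [/\ x \in H, forall h, h \in H -> [lie x, h] = 0 & diagonalizable (rho x)].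
Proof.
move=> HG; apply: prop_vspace.
  split=> [|h _|]; [exact: mem0v|exact: lie0x|].
  by rewrite rho0; exact: diagonalizable0.
move=> a x y [xH xc xd] [yH yc yd]; split=> [|h hH|].
- by apply: rpredD => //; apply: rpredZ.
- by rewrite lieDl lieZl xc // yc // scaler0 addr0.
have comm : rho x *m rho y = rho y *m rho x.
  apply/eqP; rewrite eq_sym -subr_eq0 -(rho_lie ww simpleL chevL) ?xc ?rho0 //; exact: HG.
have [P Pu PA] : exists2 P : 'M[K]_7, P \in unitmx & {in [:: rho x; rho y], forall A,
    exists d : 'I_7 -> K, forall i, row i P *m A = d i *: row i P}.
  apply: codiagonalizable_rows => [A B|A].
    by rewrite !inE => /orP[]/eqP-> /orP[]/eqP->.
  by rewrite !inE => /orP[]/eqP->.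
have [d dP] := PA _ (mem_head _ _).
have [d' d'P] : exists d : 'I_7 -> K, forall i, row i P *m rho y = d i *: row i P.
  by apply: PA; rewrite !inE eqxx orbT.
exists P => //; apply/diagonalizable_forPex; exists (\row_i (a * d i + d' i)).
apply/(simmxP Pu); apply/row_matrixP => i.
rewrite !row_mul row_diag_mx mxE -scalemxAl -rowE rhoP mulmxDr -scalemxAr dP d'P.
by rewrite scalerA -scalerDl.
Qed.

(** Let C be the centralizer of [W] in [U]. The semisimple part of any h in H lies in [W], so on C
    the action of h is that of its nilpotent part. If C were larger than H, Engel's argument would
    give an element outside H normalizing it. *)
Lemma cartan_semisimple (U H : {vspace L}) : (forall x, x \in U <-> in_G2 x) ->
  cartan_subalgebra U H -> exists W : {vspace L}, [/\
    forall x, x \in W <->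
      [/\ x \in H, forall h, h \in H -> [lie x, h] = 0 & diagonalizable (rho x)] &
    forall x, x \in U -> (forall s, s \in W -> [lie s, x] = 0) -> x \in H].
Proof.
move=> UP [HU subH nilH norm]; have HG x (xH : x \in H) := proj1 (UP x) (subvP HU x xH).
have [W WP] := semisimple_span HG; exists W; split => // x xU xW.
pose P y := y \in U /\ forall s, s \in W -> [lie s, y] = 0.
have [C CP] : exists C : {vspace L}, forall y, y \in C <-> P y.
  apply: prop_vspace => [|a y z [yU yW] [zU zW]].
    by split=> [|s _]; rewrite ?mem0v ?liex0.
  split=> [|s sW]; first by apply: rpredD => //; apply: rpredZ.
  by rewrite lieDr lieZr (yW s sW) (zW s sW) scaler0 addr0.
have HC : (H <= C)%VS.
  apply/subvP => h hH; apply/CP; split; first exact: (subvP HU).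
  by move=> s /WP[_ sc _]; apply: sc.
have [CH|CH] := eqVneq C H; first by rewrite -CH; apply/CP.
have stab h y : h \in H -> y \in C -> [lie h, y] \in C.
  move=> hH /CP[yU yW]; apply/CP; split.
    by apply/UP; apply: in_G2_lie => //; apply/UP => //; apply: (subvP HU).
  move=> s sW; rewrite lieA (yW s sW) liex0 addr0; have /WP[_ sc _] := sW.
  by rewrite sc // lie0x.
have nilC h y : h \in H -> y \in C -> exists m, iter m (lie h) y = 0.
  move=> hH /CP[yU yW]; exists 14%N; have hG := HG h hH; have yG := proj1 (UP y) yU.
  have [n nil] := nilH.
  have [S [derS diagS S7 Scomm]] := derivation_jordan n (rho_is_derivation ww e f h).
  pose s := rho_inv S; have sG : in_G2 s := in_G2_inv ww simpleL chevL S.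
  have rhos : rho s = S := rho_invK ww simpleL chevL derS.
  (* Since ad h is nilpotent on H, s commutes with H; self-normalization then puts s into H. *)
  have sW : s \in W.
    have sc x' : x' \in H -> [lie s, x'] = 0.
      move=> x'H; apply: (rho_inj ww simpleL chevL); [exact: in_G2_lie (HG _ x'H)|exact: in_G2_0|].
      rewrite (rho_lie ww simpleL chevL) ?rhos ?rho0; [|exact: sG|exact: HG].
      rewrite Scomm ?subrr // -(proj2 (iter_rho n hG (HG _ x'H))).
      by rewrite (nilpotent_iter nil) ?rho0.
    apply/WP; split => //; last by rewrite rhos.
    by apply: norm => [|x' x'H]; [apply/UP|rewrite sc // mem0v].
  have [n0 nrho] := iter_rho 14 hG yG.
  apply: (rho_inj ww simpleL chevL n0); first exact: in_G2_0.
  rewrite nrho rho0.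
  have ysS : rho y *m S = S *m rho y.
    have := rho_lie ww simpleL chevL sG yG; rewrite yW // rho0 rhos => /esym/eqP.
    by rewrite subr_eq0 => /eqP.
  have Sh : S *m rho h = rho h *m S.
    have /WP[_ /(_ h hH) sh _] := sW.
    have := rho_lie ww simpleL chevL sG hG; rewrite sh rho0 rhos => /esym/eqP.
    by rewrite subr_eq0 => /eqP.
  (* Every iterate commutes with S, so commutators with rho h and with its nilpotent part agree. *)
  have eqn m : let Y := iter m (fun X => X *m rho h - rho h *m X) (rho y) in
      Y = iter m (fun X => X *m (rho h - S) - (rho h - S) *m X) (rho y) /\ Y *m S = S *m Y.
    elim: m => [|m [IH1 IH2]] //=; rewrite -IH1; set Y := iter m _ _ in IH1 IH2 *.
    split; first by rewrite mulmxBr mulmxBl IH2 opprB addrA subrK.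
    rewrite mulmxBl mulmxBr -[Y *m rho h *m S]mulmxA -Sh [Y *m (S *m _)]mulmxA IH2.
    by rewrite -[rho h *m Y *m S]mulmxA IH2 [rho h *m (S *m Y)]mulmxA -Sh !mulmxA.
  by rewrite (proj1 (eqn 14%N)) comm_nilpotent.
have [y [yC yH yn]] := engel_normalizer subH nilH HC stab nilC CH.
case/negP: yH; apply: norm; first by have /CP[] := yC.
by move=> h hH; rewrite lieC rpredN; apply: yn.
Qed.

End CartanG2.

(** * Conjugacy of Cartan subalgebras by octonion automorphisms *)

Section CartanConjugacy.
Context {K : numClosedFieldType} {L : finLieType K}.
Variable w : K.
Hypothesis ww : w ^+ 2 + w + 1 = 0.
Variables e f : 'I_6 -> L.
Hypothesis simpleL : simple_lie {:L}.
Hypothesis chevL : chevalley_generators cartan_E6 {:L} e f.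
Local Notation OB := (@oct_basis K).
Local Notation star := (star w).
Local Notation derivation := (derivation w).
Local Notation Gv := (Gv w e f).
Local Notation in_G2 := (in_G2 w e f).
Local Notation gcoord := (gcoord w e f).
Local Notation rho := (rho w e f).
Local Notation rho_inv := (rho_inv w e f).
Local Notation block := (block w e f).
Local Notation reg := (regular_elt w e f).

Definition torus_mx (c0 c1 : K) : 'M[K]_7 := c0 *: rho_mx w 0 + c1 *: rho_mx w 1.

Definition oct_eigen (c0 c1 : K) (i : nat) : K :=
  c0 * zr (nth (Z0, Z0) oct_weights i).1 + c1 * zr (nth (Z0, Z0) oct_weights i).2.

Lemma mul_oct_torus c0 c1 i : (i < 7)%N -> OB`_i *m torus_mx c0 c1 = oct_eigen c0 c1 i *: OB`_i.
Proof.
move=> i7; have i78 : (14 + 8 * 0 + i < 78)%N by lia.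
have [E0 E1] := lie_weight0 ww chevL i78.
have ob a : (a < 14)%N -> [lie Gv a, Gv (14 + 8 * 0 + i)] = block 0 (OB`_i *m rho_mx w a).
  by move=> a14; rewrite -(block_basis w e f 0 i7) (lie_block ww simpleL chevL) ?rho_G //; exact: in_G2_G.
rewrite !ob // -(block_basis w e f 0 i7) -!blockZ graded_weight_block in E0 E1; last by lia.
rewrite /torus_mx mulmxDr -!scalemxAr (block_inj ww simpleL chevL _ E0) //.
by rewrite (block_inj ww simpleL chevL _ E1) // !scalerA -scalerDl.
Qed.

Definition star_auto (g : 'M[K]_7) :=
  g \in unitmx /\ forall u v, star (u *m g) (v *m g) = star u v *m g.

Lemma star_auto_inv g : star_auto g -> star_auto (invmx g).
Proof.
move=> [gu gstar]; split; first by rewrite unitmx_inv.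
move=> u v; rewrite -{2}(mulmxKV gu u) -{2}(mulmxKV gu v) gstar.
by rewrite mulmxK.
Qed.

Lemma derivation_conj (g D : 'M[K]_7) : star_auto g -> derivation D ->
  derivation (invmx g *m D *m g).
Proof.
move=> ga derD u v; have [gu gstar] := ga; have [_ gistar] := star_auto_inv ga.
have conjE (x : 'rV[K]_7) : x *m (invmx g *m D *m g) = x *m invmx g *m D *m g.
  by rewrite !mulmxA.
rewrite !conjE -gistar derD mulmxDl -!gstar.
by rewrite !(mulmxKV gu).
Qed.

Lemma in_G2_torus x : in_G2 x -> (forall k, (2 <= k < 14)%N -> gcoord k x = 0) ->
  rho x = torus_mx (gcoord 0 x) (gcoord 1 x).
Proof.
move=> xG x0; rewrite /rho -(big_mkord xpredT (fun a => gcoord a x *: rho_mx w a)).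
rewrite big_ltn // big_ltn // big_nat_cond big1 ?addr0 // => k /andP[k2 _].
by rewrite x0 ?scale0r.
Qed.

Lemma reg_torus : rho reg = torus_mx (zr 7%BZ) (zr 4%BZ).
Proof. by rewrite /reg rhoP rhoZ !rho_G. Qed.

Lemma iter_reg n y k : in_G2 y -> (k < 78)%N ->
  gcoord k (iter n (lie reg) y) = zr (reg_weight (graded_weight k)) ^+ n * gcoord k y.
Proof.
move=> yG k78; elim: n => [|n IHn]; first by rewrite expr0 mul1r.
rewrite iterS -linfun_lieE.
rewrite (gcoord_linfun ww simpleL chevL (l := fun k => zr (reg_weight (graded_weight k)))) //.
  by rewrite IHn exprS mulrA.
by move=> l l78; rewrite linfun_lieE regular_G.
Qed.

Theorem cartan_conjugate (U H : {vspace L}) : (forall x, x \in U <-> in_G2 x) ->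
  cartan_subalgebra U H -> exists2 g, star_auto g & forall x, x \in H <->
    in_G2 x /\ exists c0 c1, rho x = invmx g *m torus_mx c0 c1 *m g.
Proof.
move=> UP cH; have [W [WP WH]] := cartan_semisimple ww simpleL chevL UP cH.
have [HU subH [n nil] norm] := cH; have HG x (xH : x \in H) := proj1 (UP x) (subvP HU x xH).
(* If [W] were zero its centralizer would be all of [U], so H = [U] would be nilpotent; but the
   regular element scales a root vector by a nonzero number. *)
have Wn0 : W != 0%VS.
  apply/eqP => W0.
  have UH x : x \in U -> x \in H.
    by move=> xU; apply: WH => // s; rewrite W0 memv0 => /eqP ->; exact: lie0x.
  have := nilpotent_iter nil (UH _ (regular_mem ww simpleL chevL UP)) (UH _ (G2_mem ww simpleL chevL UP (isT : (2 < 14)%N))) (leqnn n).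
  move/(congr1 (gcoord 2)); rewrite iter_reg //; last exact: in_G2_G.
  rewrite gcoord_G // gcoord0 mulr1 => /eqP; rewrite expf_eq0 => /andP[_].
  by rewrite zr_eq0; vm_compute.
have WG x : x \in W -> in_G2 x by case/WP => /HG.
pose Bs := vpick W :: vbasis W.
have BsW : {subset Bs <= W}.
  by move=> x; rewrite inE => /orP[/eqP ->|/vbasis_mem//]; exact: memv_pick.
have [|A B|A||g [gu gstar gA]] := adapted_basis ww (As := map rho Bs).
- by move=> A /mapP[x _ ->]; exact: rho_is_derivation.
- move=> /mapP[x /BsW xW ->] /mapP[y /BsW yW ->]; apply/eqP; rewrite eq_sym -subr_eq0.
  rewrite -(rho_lie ww simpleL chevL); try exact: WG.
  have /WP[_ xc _] := xW; have /WP[yH _ _] := yW.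
  by rewrite xc // rho0.
- by move=> /mapP[x /BsW /WP[_ _ dx] ->].
- exists (rho (vpick W)); first by rewrite mem_head.
  apply: contraNneq Wn0 => r0; rewrite -vpick0; apply/eqP.
  apply: (rho_inj ww simpleL chevL); rewrite ?rho0 //; last exact: in_G2_0.
  by apply: WG; exact: memv_pick.
exists g => // x.
have ga : star_auto g by split.
(* The conjugated torus and [W] are diagonal in the same basis, hence commute, so the torus lies in
   H. *)
have TH y : in_G2 y -> (exists c0 c1, rho y = invmx g *m torus_mx c0 c1 *m g) -> y \in H.
  move=> yG [c0 [c1 ry]]; apply: WH => [|s sW]; first exact/UP.
  rewrite (coord_vbasis sW) lie_suml big1 // => i _; rewrite lieZl.
  set b := (vbasis W)`_i; have bB : b \in Bs.
    by rewrite inE; apply/orP; right; apply: mem_nth; rewrite size_tuple.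
  have bG := WG _ (BsW _ bB); have [|m1 [m2 [m3 [m0 bE]]]] := gA (rho b); first exact: map_f.
  suff -> : [lie b, y] = 0 by rewrite scaler0.
  apply: (rho_inj ww simpleL chevL); [exact: in_G2_lie|exact: in_G2_0|].
  rewrite (rho_lie ww simpleL chevL) // rho0; apply/row_matrixP => j; rewrite row0 rowE.
  have oy l : (l < 7)%N -> OB`_l *m g *m rho y = oct_eigen c0 c1 l *: (OB`_l *m g).
    by move=> l7; rewrite ry !mulmxA mulmxK // mul_oct_torus // scalemxAl.
  apply: (unitmx_rows_ext (P := g) (f := fun u => u *m _)) => // [a u v|l].
    by rewrite mulmxDl scalemxAl.
  rewrite rowE -oct_nth mulmxBr !mulmxA oy // bE // -!scalemxAl bE // oy //.
  by rewrite !scalerA mulrC subrr.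
split=> [xH|[xG xT]]; last exact: TH.
have xG := HG x xH; split => //.
(* Conversely, H contains the conjugate t of the regular element, and ad t is nilpotent on x.
   Conjugating back, ad of the regular element is nilpotent on y; as it has nonzero eigenvalues on
   root vectors, y is in the torus. *)
pose y := rho_inv (g *m rho x *m invmx g); pose t := rho_inv (invmx g *m rho reg *m g).
have derx : derivation (g *m rho x *m invmx g).
  by rewrite -{1}[g]invmxK; apply: derivation_conj; [exact: star_auto_inv|exact: rho_is_derivation].
have dert : derivation (invmx g *m rho reg *m g) by apply: derivation_conj => //; exact: rho_is_derivation.
have yG : in_G2 y := in_G2_inv ww simpleL chevL _; have tG : in_G2 t := in_G2_inv ww simpleL chevL _.
have tH : t \in H.
  apply: TH => //; exists (zr 7%BZ), (zr 4%BZ); rewrite (rho_invK ww simpleL chevL) //.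
  by rewrite reg_torus.
have ry : rho y = g *m rho x *m invmx g by rewrite (rho_invK ww simpleL chevL).
have iter0 : iter n (lie reg) y = 0.
  have regG : in_G2 reg by apply/UP; exact: (regular_mem ww simpleL chevL UP).
  have [zG zE] := iter_rho ww simpleL chevL n regG yG.
  apply: (rho_inj ww simpleL chevL) => //; [exact: in_G2_0|].
  have := nilpotent_iter nil tH xH (leqnn n) => /(congr1 rho); rewrite rho0.
  rewrite (proj2 (iter_rho ww simpleL chevL n tG xG)) (rho_invK ww simpleL chevL) // zE ry.
  have -> : iter n (fun X => X *m rho reg - rho reg *m X) (g *m rho x *m invmx g) =
    g *m iter n (fun X => X *m (invmx g *m rho reg *m g) - invmx g *m rho reg *m g *m X) (rho x) *m invmx g.
    elim: (n) => [|m IHm] //=; rewrite IHm; set X := iter m _ _.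
    by rewrite mulmxBr mulmxBl !mulmxA mulmxV // mul1mx mulmxK.
  by move=> ->; rewrite mulmx0 mul0mx.
exists (gcoord 0 y), (gcoord 1 y); rewrite -in_G2_torus //.
  by rewrite ry !mulmxA mulVmx // mul1mx mulmxKV.
move=> k /andP[k2 k14]; have k78 : (k < 78)%N by lia.
have := iter_reg n yG k78; rewrite iter0 gcoord0 => /esym/eqP.
rewrite mulf_eq0 expf_eq0 => /orP[/andP[_]|/eqP//].
rewrite zr_eq0 => /eqP r0; have /andP[_ /allP/(_ k)] := reg_weight_uniq.
have kin : k \in iota 2 12 by rewrite mem_iota k2.
by move/(_ kin); rewrite r0.
Qed.

End CartanConjugacy.

(** * Weights of a Cartan subalgebra of G2 on E6 *)

Definition short_indices : seq nat := [:: 3; 4; 5; 9; 10; 11]%N.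
Definition long_indices : seq nat := [:: 2; 6; 7; 8; 12; 13]%N.

(* 72 times the square length of the functional with values a, b on the coroots. *)
Definition weight_norm (p : Z * Z) : Z :=
  let: (a, b) := p in
  Z.add (Z.mul 6%BZ (Z.mul a a)) (Z.add (Z.mul 6%BZ (Z.mul a b)) (Z.mul 2%BZ (Z.mul b b))).

Lemma weight_norm_ok :
  all (fun k => weight_norm (graded_weight k) == 2%BZ) short_indices &&
  all (fun k => weight_norm (graded_weight k) == 6%BZ) long_indices.
Proof. by vm_compute. Qed.

Lemma weight_classes :
  all (fun k => (graded_weight k == (Z0, Z0)) ||
    has (fun l => graded_weight k == graded_weight l) short_indices ||
    (k \in long_indices)) (iota 0 78).
Proof. by vm_compute. Qed.

Lemma short_oct_weight :
  all (fun k => has (fun i => nth (Z0, Z0) oct_weights i == graded_weight k) (iota 0 7))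
    short_indices.
Proof. by vm_compute. Qed.

(** The Killing form of E6 on the long and short coroots of G2, as sums over all 78 weights. *)
Lemma trace_forms :
  let s F := Zsum [seq F (graded_weight k) | k <- iota 0 78] in
  [/\ s (fun p => Z.mul p.1 p.1) = 48%BZ, s (fun p => Z.mul p.1 p.2) = (-72)%BZ &
      s (fun p => Z.mul p.2 p.2) = 144%BZ].
Proof. by vm_compute. Qed.

(** [killing] takes the trace in the fixed basis [vbasis]; this computes it from any expansion that
    diagonalizes D. *)
Lemma trace_eigen (K : fieldType) (V : vectType K) n (X : 'I_n -> V)
    (xi : 'I_n -> {linear V -> K^o}) (l : 'I_n -> K) (D : 'End(V)) :
  (forall x, x = \sum_k xi k x *: X k) -> (forall k, xi k (X k) = 1) ->
  (forall k x, xi k (D x) = l k * xi k x) ->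
  \tr (passmx.mxof (vbasis {:V}) (vbasis {:V}) D) = \sum_k l k.
Proof.
move=> expand dual eig; set b := vbasis _; have bb : basis_of {:V} b := vbasisP _.
transitivity (\sum_i coord b i (D b`_i)).
  by apply: eq_bigr => i _; rewrite !mxE /= passmx.vecof_delta.
transitivity (\sum_(i < \dim {:V}) \sum_(k < n) l k * (xi k b`_i * coord b i (X k))).
  apply: eq_bigr => i _; rewrite {1}(expand (D b`_i)) linear_sum; apply: eq_bigr => k _.
  by rewrite linearZ /= eig -mulrA.
rewrite exchange_big; apply: eq_bigr => k _; rewrite -mulr_sumr -[RHS]mulr1; congr (_ * _).
rewrite -(dual k) [in RHS](coord_basis bb (memvf (X k))) linear_sum.
by apply: eq_bigr => i _; rewrite linearZ /= mulrC.
Qed.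

(** * Transport of the standard torus to H, and the induced forms and roots *)

Section Gamma.
Local Opaque graded_weight graded_degree.
Context {K : numClosedFieldType} {L : finLieType K}.
Variable w : K.
Hypothesis ww : w ^+ 2 + w + 1 = 0.
Variables e f : 'I_6 -> L.
Hypothesis simpleL : simple_lie {:L}.
Hypothesis chevL : chevalley_generators cartan_E6 {:L} e f.
Local Notation Gv := (Gv w e f).
Local Notation in_G2 := (in_G2 w e f).
Local Notation gcoord := (gcoord w e f).
Local Notation rho := (rho w e f).
Local Notation rho_inv := (rho_inv w e f).
Local Notation block := (block w e f).
Local Notation sigma0 := (sigma0 w e f).
Local Notation sigma1 := (sigma1 w e f).
Local Notation star_auto := (star_auto w).

(* Conjugation by g on G2, and v |-> v g on each 7-dimensional summand: this map
   is equivariant for G2, up to conjugation by g, and preserves the degrees. *)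
Definition gamma_fun (g : 'M[K]_7) (x : L) : L :=
  rho_inv (invmx g *m rho x *m g) +
  \sum_(b < 8) (block b ((\row_(k < 7) gcoord (14 + 8 * b + k) x) *m g)
    + gcoord (14 + 8 * b + 7) x *: Gv (14 + 8 * b + 7)).

Lemma rho_invP a D E : rho_inv (a *: D + E) = a *: rho_inv D + rho_inv E.
Proof.
rewrite /rho_inv scaler_sumr -big_split; apply: eq_bigr => k _.
by rewrite der_coordP scalerDl scalerA.
Qed.

Lemma gamma_linear g : linear (gamma_fun g).
Proof.
move=> a x y; rewrite /gamma_fun rhoP mulmxDr mulmxDl -scalemxAr -scalemxAl rho_invP.
rewrite scalerDr addrACA; congr (_ + _); rewrite scaler_sumr -big_split; apply: eq_bigr => b _.
rewrite /= gcoordP scalerDl -scalerA.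
have -> : \row_(k < 7) gcoord (14 + 8 * b + k) (a *: x + y) =
    a *: (\row_k gcoord (14 + 8 * b + k) x) + \row_k gcoord (14 + 8 * b + k) y.
  by apply/rowP => k; rewrite !mxE gcoordP.
by rewrite mulmxDl -scalemxAl blockP scalerDr addrACA.
Qed.

HB.instance Definition _ g := GRing.isLinear.Build K L L *:%R (gamma_fun g) (gamma_linear g).

Definition gamma g : 'End(L) := linfun (gamma_fun g).

Lemma gammaP g a x y : gamma g (a *: x + y) = a *: gamma g x + gamma g y.
Proof. exact: linearP. Qed.

Lemma graded_ind (P : L -> Prop) :
  P 0 -> (forall a x y, P x -> P y -> P (a *: x + y)) ->
  (forall x, in_G2 x -> P x) -> (forall b v, (b < 8)%N -> P (block b v)) ->
  (forall b, (b < 8)%N -> P (Gv (14 + 8 * b + 7))) -> forall x, P x.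
Proof.
move=> P0 PD PG Pb Pt x; rewrite (gcoord_expand ww simpleL chevL x).
elim/big_rec: _ => [|k y _ Py] //; apply: PD => //.
have [k14|k14] := ltnP k 14; first by apply: PG; exact: in_G2_G.
have k78 := ltn_ord k; have b8 : ((k - 14) %/ 8 < 8)%N by lia.
have kE : val k = (14 + 8 * ((k - 14) %/ 8) + (k - 14) %% 8)%N.
  by rewrite -addnA [(8 * _)%N]mulnC -divn_eq subnKC.
have := ltn_pmod (k - 14) (isT : (0 < 8)%N); rewrite ltnS leq_eqVlt => /orP[/eqP k7|k7].
  by rewrite kE k7; exact: Pt.
by rewrite kE -block_basis //; exact: Pb.
Qed.

Lemma gamma_G2 g x : in_G2 x -> gamma g x = rho_inv (invmx g *m rho x *m g).
Proof.
move=> x0; rewrite lfunE /= /gamma_fun big1 ?addr0 // => b _; have b8 := ltn_ord b.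
rewrite x0 ?scale0r ?addr0; last by lia.
rewrite (_ : \row_k _ = 0) ?mul0mx ?block0 //; apply/rowP => k; rewrite !mxE x0 //.
by have := ltn_ord k; lia.
Qed.

Lemma gamma_block g b v : (b < 8)%N -> gamma g (block b v) = block b (v *m g).
Proof.
move=> b8; rewrite lfunE /= /gamma_fun.
have -> : rho (block b v) = 0.
  rewrite /rho big1 // => a _; have a14 := ltn_ord a; rewrite (gcoord_block ww simpleL chevL) //; last by lia.
  have -> : (14 + 8 * b <= a < 14 + 8 * b + 7)%N = false by lia.
  by rewrite scale0r.
have -> : rho_inv (invmx g *m 0 *m g) = 0.
  by rewrite mulmx0 mul0mx -(rho0 w e f) (rhoK ww simpleL chevL) //; exact: in_G2_0.
rewrite add0r (bigD1 (Ordinal b8)) //= big1 ?addr0 => [|c cb].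
  rewrite (gcoord_block ww simpleL chevL) //; last by lia.
  rewrite ltnn andbF scale0r addr0; congr (block b (_ *m _)); apply/rowP => k.
  rewrite mxE (gcoord_block ww simpleL chevL) //; last by have := ltn_ord k; lia.
  have -> : (14 + 8 * b <= 14 + 8 * b + k < 14 + 8 * b + 7)%N by have := ltn_ord k; lia.
  by rewrite addKn inord_val.
have {}cb : (c : nat) != b by [].
 have c8 := ltn_ord c.
rewrite (gcoord_block ww simpleL chevL) //; last by lia.
have -> : (14 + 8 * b <= 14 + 8 * c + 7 < 14 + 8 * b + 7)%N = false by lia.
rewrite scale0r addr0 (_ : \row_k _ = 0) ?mul0mx ?block0 //; apply/rowP => k; have k7 := ltn_ord k.
rewrite !mxE (gcoord_block ww simpleL chevL) //; last by lia.
by have -> : (14 + 8 * b <= 14 + 8 * c + k < 14 + 8 * b + 7)%N = false by lia.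
Qed.

Lemma gamma_triv g b : (b < 8)%N -> gamma g (Gv (14 + 8 * b + 7)) = Gv (14 + 8 * b + 7).
Proof.
move=> b8; rewrite lfunE /= /gamma_fun; set x := Gv _.
have xE k : (k < 78)%N -> gcoord k x = (k == 14 + 8 * b + 7)%N%:R.
  by move=> k78; rewrite (gcoord_G ww simpleL chevL) //; lia.
have -> : rho x = 0.
  rewrite /rho big1 // => a _; have a14 := ltn_ord a; rewrite xE; last by lia.
  have -> : ((a : nat) == 14 + 8 * b + 7)%N = false by lia.
  by rewrite scale0r.
have -> : rho_inv (invmx g *m 0 *m g) = 0.
  by rewrite mulmx0 mul0mx -(rho0 w e f) (rhoK ww simpleL chevL) //; exact: in_G2_0.
rewrite add0r (bigD1 (Ordinal b8)) //= big1 ?addr0 => [|c cb].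
  rewrite xE ?eqxx ?scale1r; last by lia.
  rewrite (_ : \row_k _ = 0) ?mul0mx ?block0 ?add0r //; apply/rowP => k; have k7 := ltn_ord k.
  rewrite !mxE xE; last by lia.
  by have -> : (14 + 8 * b + k == 14 + 8 * b + 7)%N = false by lia.
have {}cb : (c : nat) != b by [].
 have c8 := ltn_ord c.
rewrite xE; last by lia.
have -> : (14 + 8 * c + 7 == 14 + 8 * b + 7)%N = false by lia.
rewrite scale0r addr0 (_ : \row_k _ = 0) ?mul0mx ?block0 //; apply/rowP => k; have k7 := ltn_ord k.
rewrite !mxE xE; last by lia.
by have -> : (14 + 8 * c + k == 14 + 8 * b + 7)%N = false by lia.
Qed.

Lemma in_G2_gamma g x : in_G2 x -> in_G2 (gamma g x).
Proof. by move=> xG; rewrite gamma_G2 //; exact: in_G2_inv. Qed.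

Lemma rho_gamma g x : star_auto g -> in_G2 x -> rho (gamma g x) = invmx g *m rho x *m g.
Proof.
move=> ga xG; rewrite gamma_G2 // (rho_invK ww simpleL chevL) //.
by apply: derivation_conj => //; exact: rho_is_derivation.
Qed.

Lemma gammaK g : star_auto g -> cancel (gamma g) (gamma (invmx g)).
Proof.
move=> ga; have [gu _] := ga; apply: graded_ind => [|a x y IHx IHy|x xG|b v b8|b b8].
- by rewrite !linear0.
- by rewrite !gammaP IHx IHy.
- have gi := star_auto_inv ga.
  apply: (rho_inj ww simpleL chevL) => //; first by do 2 apply: in_G2_gamma.
  rewrite rho_gamma //; last exact: in_G2_gamma.
  by rewrite rho_gamma // invmxK !mulmxA mulmxV // mul1mx mulmxK.
- by rewrite !gamma_block // mulmxK.
by rewrite !gamma_triv.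
Qed.

(** Checked separately on G2, where [rho] is faithful, on the blocks and on the trivial summands. *)
Lemma gamma_lie g u x : star_auto g -> in_G2 u -> gamma g [lie u, x] = [lie gamma g u, gamma g x].
Proof.
move=> ga uG; have [gu _] := ga; move: x; apply: graded_ind => [|a x y IHx IHy|x xG|b v b8|b b8].
- by rewrite liex0 !linear0.
- by rewrite lieDr lieZr !gammaP IHx IHy lieDr lieZr.
- have uxG := in_G2_lie ww simpleL chevL uG xG.
  apply: (rho_inj ww simpleL chevL); rewrite ?(rho_lie ww simpleL chevL) ?rho_gamma //;
    try by [exact: in_G2_gamma|apply: in_G2_lie => //; exact: in_G2_gamma].
  by rewrite (rho_lie ww simpleL chevL) // mulmxBr mulmxBl !mulmxA !(mulmxK gu).
- rewrite (lie_block ww simpleL chevL) // !gamma_block // (lie_block ww simpleL chevL) //; last exact: in_G2_gamma.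
  by rewrite rho_gamma // !mulmxA mulmxK.
by rewrite (lie_triv ww simpleL chevL) // linear0 gamma_triv // (lie_triv ww simpleL chevL) //; exact: in_G2_gamma.
Qed.

Lemma graded_sigma b x : (b < 8)%N ->
  (forall k, (k < 78)%N -> graded_degree k != b.+1 -> gcoord k x = 0) ->
  sigma0 x = w ^+ (b.+1 %/ 3) *: x /\ sigma1 x = w ^+ (b.+1 %% 3) *: x.
Proof.
move=> b8 x0; apply/(graded_gcoord ww simpleL chevL); rewrite ?ltn_mod //; first by lia.
by move=> k k78; rewrite mulnC -divn_eq; exact: x0.
Qed.

Lemma gamma_sigma g x : sigma0 (gamma g x) = gamma g (sigma0 x) /\
  sigma1 (gamma g x) = gamma g (sigma1 x).
Proof.
move: x; apply: graded_ind => [|a x y [x0 x1] [y0 y1]|x xG|b v b8|b b8].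
- by rewrite !linear0.
- have lP (h : 'End(L)) u v : h (a *: u + v) = a *: h u + h v by exact: linearP.
  by rewrite !lP x0 x1 y0 y1.
- have [x0 x1] := (in_G2_sigma ww simpleL chevL x).1 xG.
  have [g0 g1] := (in_G2_sigma ww simpleL chevL _).1 (in_G2_gamma g xG).
  by rewrite g0 g1 x0 x1.
- have gt u k (k78 : (k < 78)%N) kb := proj2 (graded_triv ww simpleL chevL b8 k78 kb) u.
  rewrite gamma_block //; have [-> ->] := graded_sigma b8 (gt (v *m g)).
  by have [-> ->] := graded_sigma b8 (gt v); rewrite !linearZ /= gamma_block.
have gt k (k78 : (k < 78)%N) kb := proj1 (graded_triv ww simpleL chevL b8 k78 kb).
by rewrite gamma_triv //; have [-> ->] := graded_sigma b8 gt; rewrite !linearZ /= gamma_triv.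
Qed.

Section Torus.
Variables (g : 'M[K]_7) (U H : {vspace L}).
Hypothesis ga : star_auto g.
Hypothesis UP : forall x, x \in U <-> in_G2 x.
Hypothesis HP : forall x, x \in H <->
  in_G2 x /\ exists c0 c1, rho x = invmx g *m torus_mx w c0 c1 *m g.
Local Notation tau := (gamma (invmx g)).

Lemma gammaVK x : gamma g (tau x) = x.
Proof. by have := gammaK (star_auto_inv ga) x; rewrite invmxK. Qed.

Definition torus_elt (c0 c1 : K) : L := gamma g (c0 *: Gv 0 + c1 *: Gv 1).

Lemma in_G2_torus_elt c0 c1 : in_G2 (c0 *: Gv 0 + c1 *: Gv 1).
Proof.
apply: in_G2_lin => //; first exact: in_G2_G.
by rewrite -[_ *: _]addr0; apply: in_G2_lin; [exact: in_G2_G|exact: in_G2_0].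
Qed.

Lemma mem_H x : x \in H <-> exists c0 c1, x = torus_elt c0 c1.
Proof.
have rt c0 c1 : rho (torus_elt c0 c1) = invmx g *m torus_mx w c0 c1 *m g.
  rewrite rho_gamma //; last exact: in_G2_torus_elt.
  by rewrite rhoP rhoZ !rho_G.
have tG c0 c1 : in_G2 (torus_elt c0 c1) by apply: in_G2_gamma; exact: in_G2_torus_elt.
split=> [/HP[xG [c0 [c1 E]]]|[c0 [c1 ->]]].
  by exists c0, c1; apply: (rho_inj ww simpleL chevL); rewrite ?E ?rt.
by apply/HP; split => //; exists c0, c1.
Qed.

(** Coordinates in the transported basis [gamma g (Gv k)], in which H is diagonal. *)
Definition tcoord (j : nat) (x : L) : K := gcoord j (tau x).

Lemma tcoord_elt c0 c1 : tcoord 0 (torus_elt c0 c1) = c0 /\ tcoord 1 (torus_elt c0 c1) = c1.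
Proof.
rewrite /tcoord /torus_elt gammaK // !gcoordD !gcoordZ !(gcoord_G ww simpleL chevL) //.
by rewrite !mulr1 !mulr0 addr0 add0r.
Qed.

Definition weight_val (k : nat) (A B : K) : K :=
  A * zr (graded_weight k).1 + B * zr (graded_weight k).2.

Definition eigen (h : L) (k : nat) : K := weight_val k (tcoord 0 h) (tcoord 1 h).

Lemma H_eigen h x k : h \in H -> (k < 78)%N ->
  tcoord k [lie h, x] = eigen h k * tcoord k x.
Proof.
move=> /mem_H[c0 [c1 ->]] k78; have [t0 t1] := tcoord_elt c0 c1.
rewrite /eigen t0 t1 /tcoord gamma_lie; [|exact: star_auto_inv|]; last first.
  by apply: in_G2_gamma; exact: in_G2_torus_elt.
rewrite gammaK // -linfun_lieE.
rewrite (gcoord_linfun ww simpleL chevL (l := fun k => weight_val k c0 c1)) // => l l78.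
have [E0 E1] := lie_weight0 ww chevL l78.
by rewrite linfun_lieE lieDl !lieZl E0 E1 !scalerA -scalerDl.
Qed.

Lemma tcoord_ext x y : (forall k, (k < 78)%N -> tcoord k x = tcoord k y) -> x = y.
Proof.
move=> xy; rewrite -(gammaVK x) -(gammaVK y); congr (gamma g _).
exact: (gcoord_ext ww simpleL chevL).
Qed.

Lemma killing_H h h' : h \in H -> h' \in H ->
  killing h h' = \sum_(k < 78) eigen h k * eigen h' k.
Proof.
move=> hH h'H; pose xi (k : 'I_78) : {linear L -> K^o} := coord (G_tuple w e f) k \o tau.
have xiE k x : xi k x = tcoord k x by rewrite /xi /tcoord /gcoord inord_val.
apply: (@trace_eigen K L 78 (fun k => gamma g (Gv k)) xi).
- move=> x; rewrite -[LHS]gammaVK {1}(gcoord_expand ww simpleL chevL (tau x)) linear_sum.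
  by apply: eq_bigr => k _; rewrite xiE linearZ.
- by move=> k; rewrite xiE /tcoord gammaK // (gcoord_G ww simpleL chevL) ?eqxx.
by move=> k x; rewrite !xiE comp_lfunE /ad !linfun_lieE !H_eigen // mulrA.
Qed.

Lemma killing_form h h' : h \in H -> h' \in H -> killing h h' =
  24%:R * (2%:R * tcoord 0 h * tcoord 0 h'
    - 3%:R * (tcoord 0 h * tcoord 1 h' + tcoord 1 h * tcoord 0 h')
    + 6%:R * tcoord 1 h * tcoord 1 h').
Proof.
move=> hH h'H; rewrite killing_H //.
have zsum (F : Z * Z -> Z) : \sum_(k < 78) zr (F (graded_weight k)) =
    zr (Zsum [seq F (graded_weight k) | k <- iota 0 78]) :> K.
  rewrite -(big_mkord xpredT (fun k => zr (F (graded_weight k)) : K)) /index_iota subn0.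
  elim: (iota 0 78) => [|k s IHs]; first by rewrite big_nil zr0.
  by rewrite big_cons IHs -zrD.
have [t00 t01 t11] := trace_forms.
transitivity (tcoord 0 h * tcoord 0 h' * \sum_(k < 78) zr (Z.mul (graded_weight k).1 (graded_weight k).1)
  + (tcoord 0 h * tcoord 1 h' + tcoord 1 h * tcoord 0 h') * \sum_(k < 78) zr (Z.mul (graded_weight k).1 (graded_weight k).2)
  + tcoord 1 h * tcoord 1 h' * \sum_(k < 78) zr (Z.mul (graded_weight k).2 (graded_weight k).2)).
  rewrite !mulr_sumr -!big_split; apply: eq_bigr => k _ /=.
  by rewrite /eigen /weight_val !zrM; ring.
rewrite (zsum (fun p => Z.mul p.1 p.1)) (zsum (fun p => Z.mul p.1 p.2)) (zsum (fun p => Z.mul p.2 p.2)).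
rewrite t00 t01 t11 -[48%BZ]/(Z.of_nat 48) -[144%BZ]/(Z.of_nat 144) -[(-72)%BZ]/(Z.opp (Z.of_nat 72)) zrN !zr_nat.
ring.
Qed.

Lemma torus_elt_mem c0 c1 : torus_elt c0 c1 \in H.
Proof. by apply/mem_H; exists c0, c1. Qed.

Lemma torus_eltE h : h \in H -> h = torus_elt (tcoord 0 h) (tcoord 1 h).
Proof. by move=> /mem_H[c0 [c1 ->]]; have [-> ->] := tcoord_elt c0 c1. Qed.

Lemma tcoordP k a x y : tcoord k (a *: x + y) = a * tcoord k x + tcoord k y.
Proof. by rewrite /tcoord gammaP gcoordP. Qed.

Definition dval (a : dual H) : K * K :=
  (a (vsproj H (torus_elt 1 0)), a (vsproj H (torus_elt 0 1))).

Lemma dvalE (a : dual H) (h : subvs_of H) :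
  a h = tcoord 0 (vsval h) * (dval a).1 + tcoord 1 (vsval h) * (dval a).2.
Proof.
have hH := subvsP h; rewrite {1}(_ : h = tcoord 0 (vsval h) *: vsproj H (torus_elt 1 0)
    + (tcoord 1 (vsval h) *: vsproj H (torus_elt 0 1) + 0)).
  by rewrite linearP linearP linear0 addr0.
apply: subvs_inj; rewrite addr0 linearP linearZ /= !vsprojK ?torus_elt_mem //.
rewrite {1}(torus_eltE hH) /torus_elt -!linearZ -linearD; congr (gamma g _).
by rewrite !scalerDr !scalerA !mulr1 !mulr0 !scale0r addr0 add0r.
Qed.

Lemma dval0 : dval (0 : dual H) = (0, 0).
Proof. by rewrite /dval !lfunE. Qed.

Lemma dval_inj (a b : dual H) : dval a = dval b -> a = b.
Proof. by move=> ab; apply/lfunP => h; rewrite !dvalE ab. Qed.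

Definition root_fun (k : nat) (h : subvs_of H) : K^o := eigen (vsval h) k.

Lemma root_fun_linear k : linear (root_fun k).
Proof.
move=> a x y; rewrite /root_fun /eigen /weight_val linearP /= !tcoordP -[_ *: _]/(_ * _).
by ring.
Qed.

HB.instance Definition _ k :=
  GRing.isLinear.Build K (subvs_of H) K^o *:%R (root_fun k) (root_fun_linear k).

Definition root_of (k : nat) : dual H := linfun (root_fun k).

Lemma root_ofE k h : root_of k h = eigen (vsval h) k.
Proof. by rewrite lfunE. Qed.

Lemma dval_root k : dval (root_of k) = (zr (graded_weight k).1, zr (graded_weight k).2).
Proof.
rewrite /dval !root_ofE !vsprojK ?torus_elt_mem // /eigen /weight_val.
have [-> ->] := tcoord_elt 1 0; have [-> ->] := tcoord_elt 0 1.
by rewrite !mul1r !mul0r addr0 add0r.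
Qed.

Lemma root_of_eq k l : graded_weight k = graded_weight l -> root_of k = root_of l.
Proof. by move=> kl; apply: dval_inj; rewrite !dval_root kl. Qed.

Lemma dual_vectorP (a : dual H) : let t := dual_vector a in
  [/\ t \in H, tcoord 0 t = (6%:R * (dval a).1 + 3%:R * (dval a).2) / 72%:R &
      tcoord 1 t = (3%:R * (dval a).1 + 2%:R * (dval a).2) / 72%:R].
Proof.
have n72 : 72%:R != 0 :> K by rewrite pnatr_eq0.
pose A := (dval a).1; pose B := (dval a).2.
rewrite -/A -/B /=; set t := dual_vector a.
have [tH tP] : t \in H /\ forall h : subvs_of H, killing t (vsval h) = a h.
  pose P := [set t' : L | t' \in H /\ forall h : subvs_of H, killing t' (vsval h) = a h]%classic.
  apply: (@xgetPex L 0 P); exists (torus_elt ((6%:R * A + 3%:R * B) / 72%:R) ((3%:R * A + 2%:R * B) / 72%:R)).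
  split=> [|h]; first exact: torus_elt_mem.
  rewrite killing_form ?torus_elt_mem ?subvsP // dvalE -/A -/B.
  by have [-> ->] := tcoord_elt ((6%:R * A + 3%:R * B) / 72%:R) ((3%:R * A + 2%:R * B) / 72%:R); field.
have k0 := tP (vsproj H (torus_elt 1 0)); have k1 := tP (vsproj H (torus_elt 0 1)).
rewrite vsprojK ?torus_elt_mem // killing_form ?torus_elt_mem // in k0.
rewrite vsprojK ?torus_elt_mem // killing_form ?torus_elt_mem // in k1.
have [e00 e01] := tcoord_elt 1 0; have [e10 e11] := tcoord_elt 0 1.
rewrite e00 e01 -/A in k0; rewrite e10 e11 -/B in k1.
rewrite -[a _]/A in k0; rewrite -[a _]/B in k1.
split => //.
  by apply: (lincomb2 (a := 6%:R / 72%:R) (b := 3%:R / 72%:R) k0 k1); field.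
by apply: (lincomb2 (a := 3%:R / 72%:R) (b := 2%:R / 72%:R) k0 k1); field.
Qed.

Lemma dual_formE (a b : dual H) : dual_form a b =
  (6%:R * (dval a).1 * (dval b).1 + 3%:R * ((dval a).1 * (dval b).2 + (dval a).2 * (dval b).1)
   + 2%:R * (dval a).2 * (dval b).2) / 72%:R.
Proof.
have [aH a0 a1] := dual_vectorP a; have [bH b0 b1] := dual_vectorP b.
have n72 : 72%:R != 0 :> K by rewrite pnatr_eq0.
by rewrite /dual_form killing_form // a0 a1 b0 b1; field.
Qed.

Lemma dual_form_root k :
  dual_form (root_of k) (root_of k) = zr (weight_norm (graded_weight k)) / 72%:R.
Proof.
have z2 : zr 2%BZ = 2%:R :> K by exact: zr2.
have z6 : zr 6%BZ = 6%:R :> K.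
  by rewrite -[6%BZ]/(Z.mul 2%BZ (Z.add 2%BZ 1%BZ)) zrM zrD zr2 zr1; ring.
rewrite dual_formE dval_root /weight_norm; case: (graded_weight k) => a b.
by rewrite !zrD !zrM z2 z6 /=; congr (_ / _); ring.
Qed.

Lemma weight_vector_root (a : dual H) x k : weight_vector a x -> (k < 78)%N ->
  tcoord k x != 0 -> a = root_of k.
Proof.
move=> ax k78 xk; apply/lfunP => h; rewrite root_ofE.
have := ax h => /(congr1 (tcoord k)); rewrite H_eigen ?subvsP //.
have -> : tcoord k ((a h : K) *: x) = a h * tcoord k x by rewrite /tcoord linearZ gcoordZ.
by move/(mulIf xk).
Qed.

Lemma root_weight_vector k : (k < 78)%N -> weight_vector (root_of k) (gamma g (Gv k)).
Proof.
move=> k78 h; apply: tcoord_ext => l l78; rewrite H_eigen ?subvsP // root_ofE.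
rewrite /tcoord linearZ gcoordZ /= gammaK // (gcoord_G ww simpleL chevL) //.
by case: eqP => [->|]; rewrite ?mulr0.
Qed.

Lemma gamma_G_neq0 k : (k < 78)%N -> gamma g (Gv k) != 0.
Proof.
move=> k78; apply: contraNneq (Gv_neq0 ww simpleL chevL k78) => E.
by rewrite -(gammaK ga (Gv k)) E linear0.
Qed.

Lemma root_of_neq0 k : k \in short_indices ++ long_indices -> root_of k != 0.
Proof.
move=> kr; apply/eqP => r0; have := dual_form_root k; rewrite r0 dual_formE dval0 => E.
have /eqP : zr (weight_norm (graded_weight k)) / 72%:R = 0 :> K by rewrite -E /=; ring.
rewrite mulf_eq0 invr_eq0 pnatr_eq0 orbF zr_eq0.
have /andP[/allP/(_ k) s /allP/(_ k) l] := weight_norm_ok.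
by move: kr; rewrite mem_cat => /orP[/s|/l]/eqP ->.
Qed.

(** The source of the asymmetry in the theorem: long weights occur only at indices of G2 itself,
    whereas short weights recur in every block. *)
Lemma weight_class k : (k < 78)%N -> root_of k != 0 ->
  (exists2 l, l \in short_indices & root_of k = root_of l) \/ k \in long_indices.
Proof.
move=> k78 kn0; have /allP/(_ k) := weight_classes; rewrite mem_iota => /(_ k78).
case/orP=> [/orP[/eqP k0|/hasP[l ls /eqP kl]]|]; [|left|by right].
  case/eqP: kn0; by apply: dval_inj; rewrite dval_root k0 zr0 dval0.
by exists l => //; exact: root_of_eq.
Qed.

Lemma short_long_lt k : k \in short_indices ++ long_indices -> (2 <= k < 14)%N.
Proof. by move: k; apply/allP. Qed.

Lemma rootsE (a : dual H) : Defs.roots U H a <->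
  exists2 k, k \in short_indices ++ long_indices & a = root_of k.
Proof.
split=> [[an0 [x [xU x0 ax]]]|[k kr ->]].
  have yG : in_G2 (tau x) by apply: in_G2_gamma; apply/UP.
  have [k k14 xk] : exists2 k, (k < 14)%N & tcoord k x != 0.
    have [/hasP[k]|/hasPn none] := boolP (has (fun k => tcoord k x != 0) (iota 0 14)).
      by rewrite mem_iota => k14 xk; exists k.
    case/eqP: x0; apply: tcoord_ext => k k78.
    have -> : tcoord k 0 = 0 by rewrite /tcoord linear0 gcoord0.
    have [k14|k14] := ltnP k 14; last by apply: yG; rewrite k14.
    by apply/eqP; have := none k; rewrite mem_iota negbK; apply.
  have k78 : (k < 78)%N by apply: ltn_trans k14 _.
  have E := weight_vector_root ax k78 xk; rewrite E in an0.
  have [[l ls lE]|kl] := weight_class k78 an0.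
    by exists l; rewrite ?mem_cat ?ls // E.
  by exists k; rewrite ?mem_cat ?kl ?orbT.
have /andP[_ k14] := short_long_lt kr; have k78 : (k < 78)%N by apply: ltn_trans k14 _.
split; first exact: root_of_neq0.
exists (gamma g (Gv k)); split.
- by apply/UP; apply: in_G2_gamma; exact: in_G2_G.
- exact: gamma_G_neq0.
exact: root_weight_vector.
Qed.

End Torus.

End Gamma.

(** * The automorphisms of order 3 *)

(* rho^vee, half the sum of the positive coroots; its eigenvalues are the heights. *)
Definition E6_rho_vee : svec :=
  [seq (N.of_nat p.1, (Z.of_nat p.2, Z0)) | p <- zip (iota 72 6) [:: 8; 11; 15; 21; 15; 8]].

Definition E6_height (k : nat) : Z :=
  if (k < 72)%N then
    let s := Zsum (E6_root (k %% 36)%N) in if (k < 36)%N then s else Z.opp s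
  else Z0.

Lemma E6_height_ok :
  all (fun k => sbr E6_rho_vee (skey k 1%BZ) == sscale (E6_height k, Z0) (skey k 1%BZ))
    (iota 0 78) &&
  all (fun k => E6_height k == 1%BZ) (iota 0 6) && (E6_height 35 == 11%BZ) &&
  all (fun k => (k == 35)%N || Z.ltb (E6_height k) 11%BZ) (iota 0 78).
Proof. by vm_compute. Qed.

(** Settles the sign: the prescribed word is exactly the basis vector of the lowest root, with
    coefficient 1. *)
Lemma e_minus_theta_ok :
  foldr sbr (skf 0) [:: skf 1; skf 3; skf 4; skf 2; skf 3; skf 1; skf 5; skf 4; skf 3; skf 2]
  == skey 71 1%BZ.
Proof. by vm_compute. Qed.

Lemma sigma_gens_ok :
  all (fun k => (nth [::] sigma0_mx k == sigma0_e k) && (nth [::] sigma0_mx (k + 36) == sigma0_f k) &&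
     (nth [::] sigma1_mx k == sscale (eis_omega (k \in [:: 0; 5]%N)) (ske k)) &&
     (nth [::] sigma1_mx (k + 36) == sscale (eis_omega (2 * (k \in [:: 0; 5]%N))) (skf k))) (iota 0 6).
Proof. by vm_compute. Qed.

Lemma sigma_comm_ok :
  all (fun k => slin sigma0_mx (nth [::] sigma1_mx k) == slin sigma1_mx (nth [::] sigma0_mx k))
    (iota 0 78).
Proof. by vm_compute. Qed.

(** * Identification of the highest root vector *)

Section HighestRoot.
Local Opaque sbr E6_height E6_rho_vee E6_parent.
Context {K : numFieldType} {L : finLieType K}.
Variable w : K.
Hypothesis ww : w ^+ 2 + w + 1 = 0.
Variables e f : 'I_6 -> L.
Hypothesis simpleL : simple_lie {:L}.
Hypothesis chevL : chevalley_generators cartan_E6 {:L} e f.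
Local Notation B := (B6 e f).
Local Notation ev := (seval w B).
Local Notation Hc := (chevalley_cartan e f).

Lemma h_mem j : (j < 6)%N -> B`_(72 + j) \in Hc.
Proof.
move=> j6; rewrite (B6_h e f j6) /e_ /f_; apply: memv_span.
by apply/mapP; exists (inord j); rewrite ?mem_enum.
Qed.

Lemma weight_vectorD (H : {vspace L}) (a b : dual H) x y : weight_vector a x -> weight_vector b y ->
  weight_vector (a + b) [lie x, y].
Proof.
move=> ax bx h; rewrite lieA ax bx lieZl lieZr -scalerDl; congr (_ *: _).
by rewrite add_lfunE.
Qed.

Lemma weight_vectorZ (H : {vspace L}) (a : dual H) c x : weight_vector a x -> weight_vector a (c *: x).
Proof. by move=> ax h; rewrite lieZr ax !scalerA mulrC. Qed.

Variable alpha : 'I_6 -> dual Hc.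
Hypothesis alpha_simple : forall i, weight_vector (alpha i) (e i).

Lemma root_weight k : (k < 36)%N -> exists a : dual Hc, weight_vector a B`_k.
Proof.
elim/ltn_ind: k => k IHk k36; case: (ltnP k 6) => k6.
  by exists (alpha (inord k)); rewrite (B6_e e f k6).
rewrite root_basis_pos //; case E: (E6_parent k) => [i [c p]].
have [i6 pk _] := E6_parent_lt k6 k36 E; rewrite (root_vector_rec _ k6 k36 E).
have [a] := IHk p pk (ltn_trans pk k36); rewrite root_basis_pos ?(ltn_trans pk) // => ap.
by exists (alpha (inord i) + a); apply: weight_vectorZ; apply: weight_vectorD.
Qed.

Definition rho_vee : L := ev E6_rho_vee.

Lemma rho_vee_mem : rho_vee \in Hc.
Proof.
Local Transparent E6_rho_vee.
rewrite /rho_vee /seval /E6_rho_vee /= !big_cons big_nil addr0.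
apply: rpredD; first by apply: rpredZ; exact: (@h_mem 0 isT).
apply: rpredD; first by apply: rpredZ; exact: (@h_mem 1 isT).
apply: rpredD; first by apply: rpredZ; exact: (@h_mem 2 isT).
apply: rpredD; first by apply: rpredZ; exact: (@h_mem 3 isT).
apply: rpredD; first by apply: rpredZ; exact: (@h_mem 4 isT).
by apply: rpredZ; exact: (@h_mem 5 isT).
Local Opaque E6_rho_vee.
Qed.

Lemma lie_rho_vee k : (k < 78)%N -> [lie rho_vee, B`_k] = zr (E6_height k) *: B`_k.
Proof.
move=> k78; have /andP[/andP[/andP[/allP/(_ k) h _] _] _] := E6_height_ok.
move: h; rewrite mem_iota => /(_ k78)/eqP/(congr1 ev).
by rewrite (ev_br ww chevL) !ev_skey sevalZ // ev_skey /eval_eis /= zr0 mul0r addr0.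
Qed.

Lemma rho_vee_weight (a : dual Hc) x k : weight_vector a x -> (k < 78)%N ->
  coord (B_tuple e f) (inord k) x != 0 -> a (vsproj Hc rho_vee) = zr (E6_height k) :> K.
Proof.
move=> ax k78 xk; have := ax (vsproj Hc rho_vee); rewrite vsprojK ?rho_vee_mem //.
have fB : free (B_tuple e f) := free_B6 ww simpleL chevL.
move/(congr1 (coord (B_tuple e f) (inord k))); rewrite linearZ /= {1}(B_coord ww simpleL chevL x).
rewrite lie_sumr linear_sum (bigD1 (inord k)) //= big1 ?addr0 => [|i ik].
  rewrite lieZr lie_rho_vee; last by rewrite inordK.
  rewrite !linearZ /= (coord_free (inord k) (inord k) fB) eqxx inordK // mulr1 mulrC.
  by move/(mulIf xk) => ->.
rewrite lieZr lie_rho_vee // !linearZ /= (coord_free i (inord k) fB) (negPf ik).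
by rewrite !mulr0.
Qed.

(** The height is evaluation at rho^vee. If b is the weight of [x_35], then theta - b is a
    nonnegative combination of simple roots, so theta has height at least 11, reached by [x_35]
    alone. *)
Lemma highest_weight_vector (theta : dual Hc) : highest_root alpha theta ->
  weight_vector theta B`_35 /\ B`_35 != 0.
Proof.
move=> [[theta0 [x [_ x0 thx]]] high].
have B35 : B`_35 != 0 := B6_neq0 simpleL chevL (isT : (35 < 72)%N).
have fB : free (B_tuple e f) := free_B6 ww simpleL chevL.
have coordB k : (k < 78)%N -> coord (B_tuple e f) (inord k) B`_k = 1.
  move=> k78; have := coord_free (inord k) (inord k) fB.
  by rewrite eqxx inordK.
have /andP[/andP[/andP[_ /allP h1] /eqP h35] /allP hmax] := E6_height_ok.
have [b b35] := @root_weight 35 isT.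
have b_rho : b (vsproj Hc rho_vee) = zr 11%BZ :> K.
  by rewrite (rho_vee_weight b35 (k := 35)) ?h35 // coordB ?oner_neq0.
have b0 : b != 0.
  apply/eqP => b0; move: b_rho; rewrite b0 lfunE /= => /esym/eqP.
  by rewrite zr_eq0.
have [|c thb] := high b; first by split=> //; exists B`_35; rewrite memvf.
have a_rho i : alpha i (vsproj Hc rho_vee) = 1 :> K.
  have i78 : (i < 78)%N by have := ltn_ord i; lia.
  have eB : e i = B`_i by rewrite (e_inord e i) (B6_e e f (ltn_ord i)).
  have := alpha_simple i; rewrite eB => ai.
  rewrite (rho_vee_weight ai i78) ?coordB ?oner_neq0 //.
  by rewrite (eqP (h1 i _)) ?zr1 // mem_iota ltn_ord.
have only35 (k : 'I_78) : coord (B_tuple e f) k x != 0 -> val k = 35%N.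
  move=> xk; have k78 := ltn_ord k.
  have th_k : theta (vsproj Hc rho_vee) = zr (E6_height k) :> K.
    by apply: (rho_vee_weight thx k78); rewrite inord_val.
  have : (theta - b) (vsproj Hc rho_vee) = (\sum_i c i)%:R :> K.
    rewrite thb sum_lfunE natr_sum; apply: eq_bigr => i _.
    rewrite -scaler_nat scale_lfunE a_rho.
    by rewrite -[_ *: _]/(_ * _) mulr1.
  rewrite add_lfunE opp_lfunE th_k b_rho => E.
  have /orP[/eqP//|/Z.ltb_lt lt] : (val k == 35%N) || Z.ltb (E6_height k) 11%BZ.
    by apply: hmax; rewrite mem_iota.
  have : zr (Z.sub (E6_height k) 11%BZ) = zr (Z.of_nat (\sum_i c i)) :> K.
    by rewrite zr_nat -E -Z.add_opp_r zrD zrN.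
  by move/zr_inj; lia.
have [k xk] : exists k : 'I_78, coord (B_tuple e f) k x != 0.
  apply/existsP; apply: contraNT x0 => /existsPn x0; rewrite (B_coord ww simpleL chevL x).
  by apply/eqP; rewrite big1 // => i _; have /negPn/eqP -> := x0 i; rewrite scale0r.
have k35 := only35 k xk; split => //.
have xE : x = coord (B_tuple e f) k x *: B`_35.
  rewrite {1}(B_coord ww simpleL chevL x) (bigD1 k) // big1 ?addr0 => [|i /andP[_ ik]].
    by rewrite -[nat_of_ord k]/(val k) k35; exact: addr0.
  have [xi|xi] := eqVneq (coord (B_tuple e f) i x) 0; first by rewrite xi scale0r.
  by case/eqP: ik; apply: val_inj; rewrite (only35 i xi) k35.
rewrite -[B`_35](scalerK xk) -xE; exact: weight_vectorZ.
Qed.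

End HighestRoot.

(** * The toroidal algebra *)

Section RootOfUnity.
Context {R : realType}.

Definition cis (x : R) : R[i] := (cos x +i* sin x)%C.

Lemma cisD x y : cis (x + y) = cis x * cis y.
Proof. by rewrite /cis cosD sinD; simpc; congr (_ +i* _)%C; ring. Qed.

Lemma omega_quadratic : (root_unity 3 : R[i]) ^+ 2 + root_unity 3 + 1 = 0.
Proof.
have -> : root_unity 3 = cis (2 * pi / 3%:R) by [].
set x := 2 * pi / 3%:R; have c1 : cis x != 1.
  have /gt_eqF : 0 < sin x.
    have p0 := pi_gt0 R; apply: sin_gt0_pi.
    by rewrite /x; apply/andP; split; [apply: divr_gt0 => //; apply: mulr_gt0|
      rewrite ltr_pdivrMr // mulrC ltr_pM2l // ltr_nat].
  by rewrite eq_complex /= => ->; rewrite andbF.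
have c3 : cis x ^+ 3 = 1.
  rewrite !exprS expr0 mulr1 -!cisD.
  have -> : x + (x + x) = pi *+ 2 by rewrite /x; field.
  by rewrite /cis cos2pi sin2pi.
have /eqP : (cis x - 1) * (cis x ^+ 2 + cis x + 1) = 0.
  have -> : (cis x - 1) * (cis x ^+ 2 + cis x + 1) = cis x ^+ 3 - 1 by ring.
  by rewrite c3 subrr.
by rewrite mulf_eq0 subr_eq0 (negPf c1) => /eqP.
Qed.

End RootOfUnity.

(** * Existence, uniqueness, orders and commutation of the two automorphisms *)

Section Sigma.
Local Opaque sbr slin sigma0_mx sigma1_mx.
Context {R : realType} {L : finLieType R[i]}.
Variables e f : 'I_6 -> L.
Hypothesis simpleL : simple_lie {:L}.
Hypothesis chevL : chevalley_generators cartan_E6 {:L} e f.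
Local Notation w := (root_unity 3 : R[i]).
Local Notation ww := (@omega_quadratic R).
Local Notation B := (B6 e f).
Local Notation ev := (seval w B).
Local Notation sigma0 := (sigma0 w e f).
Local Notation sigma1 := (sigma1 w e f).

Lemma e_minus_thetaE : e_minus_theta f = B`_71.
Proof.
rewrite -(ev_skey w e f 71) -(eqP e_minus_theta_ok) [foldr _ _ _]/=.
rewrite !(ev_br ww chevL) !ev_skey /e_minus_theta [LHS]/=.
by rewrite !B6_f.
Qed.

Lemma sigma_gens k : (k < 6)%N ->
  [/\ sigma0 B`_k = ev (sigma0_e k), sigma0 B`_(k + 36) = ev (sigma0_f k),
      sigma1 B`_k = w ^+ (k \in [:: 0; 5]%N) *: B`_k &
      sigma1 B`_(k + 36) = w ^+ (2 * (k \in [:: 0; 5]%N)) *: B`_(k + 36)].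
Proof.
move=> k6; have k78 : (k < 78)%N by lia. have k78' : (k + 36 < 78)%N by lia.
have /allP/(_ k) := sigma_gens_ok; rewrite mem_iota => /(_ k6).
move=> /andP[/andP[/andP[/eqP E0 /eqP E1] /eqP E2] /eqP E3].
rewrite /sigma0 /sigma1 !(lmap_B ww simpleL chevL) // E0 E1 E2 E3 !(sevalZ ww) /ske /skf.
rewrite !(ev_skey w e f).
by rewrite !(eval_omega ww) //; case: (k \in [:: 0; 5]%N).
Qed.

Lemma sigma0_spec : is_sigma0 e f B`_35 sigma0.
Proof.
have gen := sigma_gens; have [aB aF] : (forall k, (k < 6)%N -> B`_k = e (inord k)) /\
    (forall k, (k < 6)%N -> B`_(k + 36) = f (inord k)).
  by split=> k k6; [exact: (B6_e e f k6)|exact: (B6_f e f k6)].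
split.
- exact: (lmap_auto ww simpleL chevL (S := sigma0_mx) erefl sigma0_auto sigma0_order3).
- rewrite -!aB // e_minus_thetaE.
  have s k (k6 : (k < 6)%N) : sigma0 B`_k = ev (sigma0_e k) by have [] := gen k k6.
  by rewrite !s // /sigma0_e /= /ske !ev_skey.
rewrite -!aF //.
have s k (k6 : (k < 6)%N) : sigma0 B`_(k + 36) = ev (sigma0_f k) by have [] := gen k k6.
by rewrite !s // /sigma0_f /= /skf !ev_skey.
Qed.

Lemma sigma1_spec : is_sigma1 e f sigma1.
Proof.
have gen := sigma_gens; have [aB aF] : (forall k, (k < 6)%N -> B`_k = e (inord k)) /\
    (forall k, (k < 6)%N -> B`_(k + 36) = f (inord k)).
  by split=> k k6; [exact: (B6_e e f k6)|exact: (B6_f e f k6)].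
split.
- exact: (lmap_auto ww simpleL chevL (S := sigma1_mx) erefl sigma1_auto sigma1_order3).
- move=> k; rewrite !inE => k4; have k6 : (k.-1 < 6)%N by move: k4; case/or4P => /eqP ->.
  have [_ _ s1 s2] := gen _ k6; rewrite -aB // -aF // s1 s2.
  have -> : k.-1 \in [:: 0; 5]%N = false by move: k4; case/or4P => /eqP ->.
  by rewrite !scale1r.
move=> k; rewrite !inE => k2; have k6 : (k.-1 < 6)%N by move: k2; case/orP => /eqP ->.
have [_ _ s1 s2] := gen _ k6; rewrite -aB // -aF // s1 s2.
by have -> : k.-1 \in [:: 0; 5]%N by move: k2; case/orP => /eqP ->.
Qed.

Lemma sigma0_uniq s : is_sigma0 e f B`_35 s -> s = sigma0.
Proof.
move=> [autos [s1 [s2 [s3 [s4 [s5 s6]]]]] [t1 [t2 [t3 [t4 [t5 t6]]]]]].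
have [auto0 [u1 [u2 [u3 [u4 [u5 u6]]]]] [v1 [v2 [v3 [v4 [v5 v6]]]]]] := sigma0_spec.
apply: (lie_automorphism_ext chevL autos auto0) => k.
rewrite mem_cat !mem_iota => /orP[/andP[_ k6]|/andP[k36 k42]].
  rewrite (B6_e e f k6) /e_; move: k6.
  by case: k => [|[|[|[|[|[|//]]]]]] _; rewrite ?s1 ?s2 ?s3 ?s4 ?s5 ?s6 ?u1 ?u2 ?u3 ?u4 ?u5 ?u6.
have k6 : (k - 36 < 6)%N by lia.
rewrite -(subnK k36) (B6_f e f k6) /f_; move: (k - 36)%N k6.
by case=> [|[|[|[|[|[|//]]]]]] _; rewrite ?t1 ?t2 ?t3 ?t4 ?t5 ?t6 ?v1 ?v2 ?v3 ?v4 ?v5 ?v6.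
Qed.

Lemma sigma1_uniq s : is_sigma1 e f s -> s = sigma1.
Proof.
move=> [autos s2 s1]; have [auto1 u2 u1] := sigma1_spec.
apply: (lie_automorphism_ext chevL autos auto1) => k.
have gens i : (i < 6)%N -> s (e (inord i)) = sigma1 (e (inord i)) /\ s (f (inord i)) = sigma1 (f (inord i)).
  move=> i6; have [i1|i1] := boolP (i.+1 \in [:: 1; 6]%N).
    by have [-> ->] := s1 _ i1; have [-> ->] := u1 _ i1.
  have i2 : i.+1 \in [:: 2; 3; 4; 5]%N by move: i6 i1; case: i => [|[|[|[|[|[|//]]]]]].
  by have [-> ->] := s2 _ i2; have [-> ->] := u2 _ i2.
rewrite mem_cat !mem_iota => /orP[/andP[_ k6]|/andP[k36 k42]].
  by rewrite (B6_e e f k6); have [] := gens _ k6.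
have k6 : (k - 36 < 6)%N by lia.
by rewrite -(subnK k36) (B6_f e f k6); have [] := gens _ k6.
Qed.

Lemma sigma_orders : automorphism_order sigma0 3 /\ automorphism_order sigma1 3.
Proof.
have Bn0 k : (k < 72)%N -> B`_k != 0 by exact: (B6_neq0 simpleL chevL).
have w1 : w != 1 by exact: (w_neq1 ww).
have [w21 w2w] := ww_omega_neq ww.
have fB : free (B_tuple e f) := free_B6 ww simpleL chevL.
have uB : uniq (B_tuple e f) by exact: free_uniq fB.
have Bneq i j : (i < 78)%N -> (j < 78)%N -> i != j -> B`_i != B`_j.
  move=> i78 j78; apply: contra_neq => E; apply/eqP.
  by rewrite -(nth_uniq 0 _ _ uB) ?size_B6 //; apply/eqP.
have [_ [s1 [_ [_ [_ [_ s6]]]]] _] := sigma0_spec.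
have e1 : e (inord 0) = B`_0 by rewrite (B6_e e f).
have e6 : e (inord 5) = B`_5 by rewrite (B6_e e f).
rewrite -[1.-1]/0%N e1 -[6.-1]/5%N e6 in s1; rewrite -[6.-1]/5%N e6 e_minus_thetaE in s6.
have t1 : sigma1 B`_0 = w *: B`_0 by have [_ _ -> _] := sigma_gens (isT : (0 < 6)%N).
split; split => //.
- exact: (iter_sigma0 ww simpleL chevL).
- move=> m m3; exists B`_0; case: m m3 => [|[|[|//]]] // _; rewrite !iterS -[iter 0 _ _]/(B`_0) ?s1 ?s6.
    exact: (Bneq 5%N 0%N).
  exact: (Bneq 71%N 0%N).
- exact: (iter_sigma1 ww simpleL chevL).
move=> m m3; exists B`_0; case: m m3 => [|[|[|//]]] // _; rewrite !iterS -[iter 0 _ _]/(B`_0) t1.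
  rewrite -subr_eq0 -[X in _ - X]scale1r -scalerBl scaler_eq0 subr_eq0 (negPf w1).
  exact: (Bn0 0%N).
have -> : sigma1 (w *: B`_0) = w *: sigma1 B`_0 by exact: linearZ.
rewrite t1 scalerA.
rewrite -subr_eq0 -[X in _ - X]scale1r -scalerBl scaler_eq0 subr_eq0 -expr2 (negPf w21).
exact: (Bn0 0%N).
Qed.

Lemma sigma_comm x : sigma0 (sigma1 x) = sigma1 (sigma0 x).
Proof.
rewrite -!comp_lfunE; congr (fun_of_lfun _ x); apply: (eq_lfun_B ww simpleL chevL) => k k78.
rewrite !comp_lfunE /sigma0 /sigma1 !(lmap_B ww simpleL chevL) // !(lmap_ev ww simpleL chevL) //.
have /allP/(_ k) := sigma_comm_ok; rewrite mem_iota => /(_ k78)/eqP.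
by move=> /(congr1 ev).
Qed.

End Sigma.

(** * The adjoint action of the toroidal Cartan subalgebra *)

Section ToroidalCartan.
Context {K : fieldType} {L : finLieType K}.
Local Open Scope classical_set_scope.

Lemma fsbig_single (T : choiceType) (V : nmodType) (F : T -> V) r0 :
  (forall r, r != r0 -> F r = 0) -> \sum_(r \in [set: T]) F r = F r0.
Proof.
move=> F0; rewrite -(fsbig_widen [set r0] setT) ?fsbig_set1 //.
by move=> r /= [_ /eqP]; exact: F0.
Qed.

Lemma sum_delta (V : lmodType K) n (F : 'I_n -> V) j :
  \sum_i (delta_mx 0 j : 'rV[K]_n) 0 i *: F i = F j.
Proof.
rewrite (bigD1 j) //= mxE !eqxx scale1r big1 ?addr0 // => i ij.
by rewrite mxE (negPf ij) andbF scale0r.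
Qed.

Lemma laurentP (W : lmodType K) (x y : laurent W) : (forall r, x r = y r) -> x = y.
Proof. by move=> xy; apply/val_inj/funext => r; exact: xy. Qed.

Lemma laurentD (W : lmodType K) (x y : laurent W) r : (x + y) r = x r + y r.
Proof. by []. Qed.

Lemma laurentZ (W : lmodType K) a (x : laurent W) r : (a *: x) r = a *: x r.
Proof. by []. Qed.

Lemma laurent0 (W : lmodType K) r : (0 : laurent W) r = 0.
Proof. by []. Qed.

Lemma monoE (W : lmodType K) r (v : W) s : mono r v s = if s == r then v else 0.
Proof. by []. Qed.

Lemma degree_derE (W : lmodType K) j (x : laurent W) r : degree_der j x r = (r 0 j)%:~R *: x r.
Proof. by []. Qed.

Lemma loop_bracket_mono0 (h : L) (x : laurent L) r : loop_bracket (mono 0 h) x r = [lie h, x r].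
Proof.
rewrite -[LHS]/(\sum_(s \in [set: _]) [lie mono 0 h s, x (r - s)]) (@fsbig_single _ _ _ 0).
  by rewrite monoE eqxx subr0.
by move=> s s0; rewrite monoE (negPf s0) lie0x.
Qed.

Lemma class_of0 : class_of 0 = 0 :> kaehler K.
Proof. exact: raddf0. Qed.

Lemma cocycle_mono0 (h : L) (x : laurent L) : cocycle (mono 0 h) x = 0.
Proof.
rewrite -class_of0; congr class_of; apply: laurentP => r; rewrite laurent0.
rewrite -[LHS]/(\sum_(s \in [set: _]) killing (mono 0 h s) (x (r - s)) *: map_mx intr s).
rewrite (@fsbig_single _ _ _ 0) => [|s s0].
  rewrite (_ : map_mx _ 0 = 0) ?scaler0 //.
  by apply/rowP => j; rewrite !mxE.
by rewrite monoE (negPf s0) killing0x scale0r.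
Qed.

Lemma degree_der_mono (W : lmodType K) j r (v : W) :
  degree_der j (mono r v) = (r 0 j)%:~R *: mono r v.
Proof.
apply: laurentP => s; rewrite degree_derE laurentZ monoE.
by case: eqP => [->|_] //; rewrite !scaler0.
Qed.

Lemma degree_der_mono0 (W : lmodType K) j (v : W) : degree_der j (mono 0 v) = 0.
Proof. by rewrite degree_der_mono mxE scale0r. Qed.

Lemma kaehler_der0 j : kaehler_der j 0 = 0 :> kaehler K.
Proof.
rewrite -class_of0 kaehler_der_class; congr class_of; apply: laurentP => r.
by rewrite degree_derE laurent0 scaler0.
Qed.

(** The cocycle carries the exponent of its first argument, which is 0 here, and degree derivations
    kill constants. *)
Lemma cartan_bracket (h : L) a k (x : laurent L) (z : kaehler K) c :
  toroidal_bracket (toroidal_cartan h a k) (x, z, c) =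
  (loop_bracket (mono 0 h) x + \sum_j a 0 j *: degree_der j x,
   \sum_j a 0 j *: kaehler_der j z, 0).
Proof.
rewrite /toroidal_bracket /toroidal_cartan cocycle_mono0 add0r.
congr (_ + _, _, _); apply: eq_bigr => j _.
  by rewrite degree_der_mono0 scaler0 subr0.
by rewrite kaehler_der_class degree_der_mono0 class_of0 scaler0 subr0.
Qed.

End ToroidalCartan.

Lemma graded_degree_block b i : (i < 8)%N -> graded_degree (14 + 8 * b + i) = b.+1.
Proof.
move=> i8; have b14 : (14 + 8 * b + i < 14)%N = false by lia.
by rewrite /graded_degree b14; congr _.+1; lia.
Qed.

Lemma graded_degree0 k : (k < 14)%N -> graded_degree k = 0%N.
Proof. by rewrite /graded_degree => ->. Qed.

(** * The non-isotropic roots *)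

Section NonisotropicRoots.
Local Opaque graded_weight graded_degree.
Context {R : realType} {L : finLieType R[i]}.
Variables e f : 'I_6 -> L.
Hypothesis simpleL : simple_lie {:L}.
Hypothesis chevL : chevalley_generators cartan_E6 {:L} e f.
Local Notation w := (root_unity 3 : R[i]).
Local Notation ww := (@omega_quadratic R).
Local Notation sigma0 := (sigma0 w e f).
Local Notation sigma1 := (sigma1 w e f).
Local Notation gr := (graded sigma0 sigma1 3 3).
Local Notation Gv := (Gv w e f).
Local Notation gcoord := (gcoord w e f).
Local Notation in_G2 := (in_G2 w e f).

Definition mod3 (p : int) : nat := `|(p %% 3)%Z|%N.

Lemma mod3_lt p : (mod3 p < 3)%N.
Proof. by rewrite /mod3; have := modz_ge0 p (isT : 3 != 0 :> int); have := ltz_pmod p (isT : 0 < 3 :> int); lia. Qed.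

Lemma mod3_eq0 p : mod3 p = 0%N -> p = 3 * (p %/ 3)%Z.
Proof. by rewrite /mod3 => p0; have := divz_eq p 3; lia. Qed.

Lemma mod3M p : mod3 (3 * p) = 0%N.
Proof. by rewrite /mod3 mulrC modzMl. Qed.

Lemma omega_exprz (p : int) : w ^ p = w ^+ mod3 p.
Proof.
have w0 : w != 0.
  by apply: contra_eq_neq (w_order3 ww) => ->; rewrite expr0n /= eq_sym oner_eq0.
rewrite {1}(divz_eq p 3) expfzDr // [X in w ^ X * _]mulrC -exprz_exp.
rewrite -[w ^ 3]/(w ^+ 3) (w_order3 ww) exp1rz mul1r.
by rewrite -[(p %% 3)%Z]gez0_abs ?modz_ge0.
Qed.

Lemma graded_mem p q x : x \in gr p q <->
  forall k, (k < 78)%N -> graded_degree k != (3 * mod3 p + mod3 q)%N -> gcoord k x = 0.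
Proof.
rewrite mem_graded !omega_exprz -(graded_gcoord ww simpleL chevL) ?mod3_lt //.
by split=> [/andP[/eqP -> /eqP ->]|[-> ->]]; rewrite ?eqxx.
Qed.

Lemma graded00 x : x \in gr 0 0 <-> in_G2 x.
Proof.
rewrite graded_mem -(graded_gcoord ww simpleL chevL (p := 0) (q := 0)) // !expr0 !scale1r.
by rewrite (in_G2_sigma ww simpleL chevL).
Qed.

Lemma graded_irr (i j : nat) : (i <= 2)%N -> (j <= 2)%N -> (i, j) != (0, 0)%N ->
  irr7_plus_trivial (gr 0 0) (gr i j).
Proof.
move=> i2 j2 ij; have ij0 : (0 < 3 * i + j)%N.
  by rewrite lt0n; apply: contra ij => /eqP E; apply/eqP; congr (_, _); lia.
apply: (graded_irr7_plus_trivial ww simpleL chevL graded00 (b := (3 * i + j).-1)); first by lia.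
move=> x; rewrite graded_mem prednK //.
by have [-> ->] : mod3 i = i /\ mod3 j = j by rewrite /mod3 !modz_nat /=; lia.
Qed.

Lemma gamma_graded g p q x : x \in gr p q -> gamma w e f g x \in gr p q.
Proof.
have [g0 g1] := gamma_sigma ww simpleL chevL g x.
rewrite !mem_graded g0 g1 => /andP[/eqP -> /eqP ->].
by rewrite !linearZ /= !eqxx.
Qed.

Variable H : {vspace L}.
Hypothesis cH : cartan_subalgebra (gr 0 0) H.

Theorem nonisotropic_rootsE : nonisotropic_roots sigma0 sigma1 3 3 H = G2_33 (gr 0 0) H.
Proof.
have [g ga HP] := cartan_conjugate ww simpleL chevL graded00 cH.
pose rt k : dual H := root_of w e f g H k.
have rE (a : dual H) : Defs.roots (gr 0 0) H a <->
    exists2 k, k \in short_indices ++ long_indices & a = rt k :=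
  rootsE ww simpleL chevL ga graded00 HP a.
have form k : dual_form (rt k) (rt k) = zr (weight_norm (graded_weight k)) / 72%:R :=
  dual_form_root ww simpleL chevL ga HP k.
have z2 : zr 2%BZ = 2%:R :> R[i] := zr_nat _ 2.
have z6 : zr 6%BZ = 6%:R :> R[i] := zr_nat _ 6.
have short_form k : k \in short_indices -> dual_form (rt k) (rt k) = 2%:R / 72%:R.
  by move=> ks; have /andP[/allP/(_ _ ks)/eqP E _] := weight_norm_ok; rewrite form E z2.
have long_form k : k \in long_indices -> dual_form (rt k) (rt k) = 6%:R / 72%:R.
  by move=> ks; have /andP[_ /allP/(_ _ ks)/eqP E] := weight_norm_ok; rewrite form E z6.
have le72 m n : (m%:R / 72%:R <= n%:R / 72%:R :> R[i]) = (m <= n)%N.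
  by rewrite ler_pM2r ?ler_nat // invr_gt0 ltr0n.
have shortE (a : dual H) : short_root (gr 0 0) a <-> exists2 k, k \in short_indices & a = rt k.
  split=> [[/rE[k + ->] min]|[k ks ->]].
    rewrite mem_cat => /orP[ks|kl]; first by exists k.
    have /rE/min : exists2 l, l \in short_indices ++ long_indices & rt 3%N = rt l by exists 3%N.
    by rewrite (long_form k) // (short_form 3%N) // le72.
  split; first by apply/rE; exists k; rewrite ?mem_cat ?ks.
  move=> b /rE[l + ->]; rewrite mem_cat => /orP[ls|ll].
    by rewrite (short_form k) // (short_form l).
  by rewrite (short_form k) // (long_form l) // le72.
have longE (a : dual H) : long_root (gr 0 0) a <-> exists2 k, k \in long_indices & a = rt k.
  split=> [[/rE[k + ->] max]|[k ks ->]].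
    rewrite mem_cat => /orP[ks|kl]; last by exists k.
    have /rE/max : exists2 l, l \in short_indices ++ long_indices & rt 2%N = rt l by exists 2%N.
    by rewrite (short_form k) // (long_form 2%N) // le72.
  split; first by apply/rE; exists k; rewrite ?mem_cat ?ks ?orbT.
  move=> b /rE[l + ->]; rewrite mem_cat => /orP[ls|ll]; last by rewrite (long_form k) // (long_form l).
  by rewrite (short_form l) // (long_form k) // le72.
have deltaE (a : dual H) (m n : int) (d : 'rV[R[i]]_2) : d 0 0 = m%:~R -> d 0 1 = n%:~R ->
    (a, d) = ext_of a + m%:~R *: delta H 0 + n%:~R *: delta H 1.
  move=> d0 d1; congr (_, _); first by rewrite /= !scaler0 !addr0.
  apply/rowP => j; rewrite !mxE; move: j.
  by apply: ord2; rewrite /= ?mulr1 ?mulr0 ?add0r ?addr0.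
have form_eq0 (a : dual H) : a = 0 -> dual_form a a = 0.
  move=> ->; rewrite (dual_formE ww simpleL chevL ga HP) (dval0 w e f) /=; ring.
(* A graded vector of matching degree, transported by gamma and multiplied by the monomial t^r, is a
   root vector. *)
have realized k (a : dual H) (m n : int) : (k < 78)%N -> graded_degree k = (3 * mod3 m + mod3 n)%N ->
    a = rt k -> dual_form a a != 0 ->
    nonisotropic_roots sigma0 sigma1 3 3 H (ext_of a + m%:~R *: delta H 0 + n%:~R *: delta H 1).
  move=> k78 degk ak form0.
  pose r : 'rV[int]_2 := \row_j (if j == 0 then m else n).
  rewrite -(deltaE a m n (map_mx intr r)); [|by rewrite !mxE|by rewrite !mxE].
  split => //; exists (mono r (gamma w e f g (Gv k)), 0, 0); split.
  - split=> [s|]; last first.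
      exists 0%N, (fun=> 0), (fun=> 0), (fun=> 0); split; first by case.
      by rewrite big_ord0.
    rewrite /=; case: eqP => [->|_]; last exact: mem0v.
    rewrite !mxE /=; apply: gamma_graded; apply/graded_mem => l l78.
    rewrite (gcoord_G ww simpleL chevL) // -degk; case: (eqVneq l k) => [->|//].
    by rewrite eqxx.
  - apply/eqP => /(congr1 (fun X : toroidal L => X.1.1 r)); rewrite /= eqxx => G0.
    by have := gamma_G_neq0 ww simpleL chevL ga k78; rewrite G0 eqxx.
  move=> h c' k'; rewrite cartan_bracket.
  have -> : loop_bracket (mono 0 (vsval h)) (mono r (gamma w e f g (Gv k))) =
      (a h : R[i]) *: mono r (gamma w e f g (Gv k)).
    apply: laurentP => s; rewrite loop_bracket_mono0 laurentZ monoE.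
    case: eqP => _; last by rewrite liex0 scaler0.
    by rewrite ak; exact: (root_weight_vector ww simpleL chevL ga HP k78).
  rewrite [X in (_, X, _)]big1 => [|j _]; last by rewrite kaehler_der0 scaler0.
  rewrite -[RHS]/(ext_eval _ h c' *: mono r _, ext_eval _ h c' *: 0, ext_eval _ h c' *: 0) !scaler0.
  congr (_, _, _); rewrite /ext_eval scalerDl scaler_suml; congr (_ + _).
  by apply: eq_bigr => j _; rewrite degree_der_mono scalerA !mxE.
apply/seteqP; split=> [[a d] [form0 [[[x z] c] [[xgr _] Xn0 wt]]]|b].
  have a0 : a != 0 by apply: contraNneq form0 => /form_eq0 E; rewrite /ext_form /= E.
  have bracket (h : subvs_of H) (k : 'rV[R[i]]_2) :
    [/\ loop_bracket (mono 0 (vsval h)) x + \sum_j k 0 j *: degree_der j x = ext_eval (a, d) h k *: x,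
      \sum_j k 0 j *: kaehler_der j z = ext_eval (a, d) h k *: z & 0 = ext_eval (a, d) h k *: c].
    have := wt h k 0; rewrite cartan_bracket => E.
    split; [exact: (congr1 (fun X : toroidal L => X.1.1) E)|
      exact: (congr1 (fun X : toroidal L => X.1.2) E)|exact: (congr1 (fun X : toroidal L => X.2) E)].
  have eval0 h : ext_eval (a, d) h 0 = a h.
    by rewrite /ext_eval big1 ?addr0 // => j _; rewrite mxE mul0r.
  have wx r : weight_vector a (x r).
    move=> h; have [E _ _] := bracket h 0; move: (congr1 (fun u : laurent L => u r) E).
    rewrite big1 ?addr0 ?eval0 => [|j _]; last by rewrite mxE scale0r.
    by rewrite loop_bracket_mono0 laurentZ.
  (* Bracketing with some h where a is nonzero yields no central or derivation component, so X has
     none. *)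
  have [h ah] : exists h, a h != 0 :> R[i].
    apply: contrapT => none; case/eqP: a0; apply/lfunP => h; rewrite zero_lfunE.
    by apply/eqP/negPn/negP => ah; apply: none; exists h.
  have [z0 c0] : z = 0 /\ c = 0.
    have [_ Ez Ec] := bracket h 0; rewrite eval0 in Ez Ec.
    split; apply/eqP.
      have : a h *: z == 0 by rewrite -Ez big1 // => j _; rewrite mxE scale0r.
      by rewrite scaler_eq0 (negPf ah).
    have : a h *: c == 0 by rewrite -Ec.
    by rewrite scaler_eq0 (negPf ah).
  have [r xr] : exists r, x r != 0.
    apply: contrapT => none; case/eqP: Xn0; rewrite z0 c0; congr (_, _, _).
    apply: laurentP => r; apply/eqP/negPn/negP => xr; by apply: none; exists r.
  (* The bracket with d_j reads off the exponents of any monomial occurring in x, so these determine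
     the delta part. *)
  have dr j : d 0 j = (r 0 j)%:~R.
    have [+ _ _] := bracket 0 (delta_mx 0 j); rewrite sum_delta /ext_eval !linear0 add0r.
    rewrite (sum_delta (V := R[i]^o) (fun i => d 0 i)) => /(congr1 (fun u : laurent L => u r)).
    rewrite laurentD loop_bracket_mono0 lie0x add0r degree_derE laurentZ => /eqP.
    rewrite -subr_eq0 -scalerBl scaler_eq0 (negPf xr) orbF.
    by rewrite subr_eq0 => /eqP.
  have [k k78 xk] : exists2 k, (k < 78)%N & tcoord w e f g k (x r) != 0.
    apply: contrapT => none; case/eqP: xr; apply: (tcoord_ext ww simpleL chevL ga) => k k78.
    rewrite [RHS](_ : _ = 0); last by rewrite /tcoord linear0 gcoord0.
    by apply/eqP/negPn/negP => xk; apply: none; exists k.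
  have ak : a = rt k := weight_vector_root ww simpleL chevL ga HP (wx r) k78 xk.
  have rk0 : rt k != 0 by rewrite -ak.
  rewrite (deltaE a (r 0 0) (r 0 1) d) //.
  have [[l ls kl]|kl] := weight_class (g := g) (H := H) ww simpleL chevL ga HP k78 rk0.
    by left; exists a, (r 0 0), (r 0 1); split=> //; apply/shortE; exists l => //; rewrite ak.
  (* Indices of long weights lie below 14, in degree (0, 0); the exponents are therefore divisible
     by 3. *)
  pose p := r 0 0; pose q := r 0 1.
  have deg : graded_degree k = (3 * mod3 p + mod3 q)%N.
    apply/eqP; apply: contraNT xk => degk; apply/eqP.
    by have /graded_mem := gamma_graded (invmx g) (xgr r); apply.
  have k14 : (k < 14)%N by move: k kl {xk ak k78 rk0 deg}; apply/allP.
  rewrite graded_degree0 // in deg.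
  right; exists a, (p %/ 3)%Z, (q %/ 3)%Z; split; first by apply/longE; exists k.
  have [p0 q0] : mod3 p = 0%N /\ mod3 q = 0%N by move: deg; clear; lia.
  by rewrite -!mod3_eq0.
case=> [[a [m [n [/shortE[k ks ak] ->]]]]|[a [m [n [/longE[k kl ak] ->]]]]]; last first.
  have k14 : (k < 14)%N by move: k kl {ak}; apply/allP.
  apply: (realized k) => //; first by lia.
    by rewrite graded_degree0 // !mod3M.
  by rewrite ak (long_form k) // mulf_neq0 ?invr_eq0 ?pnatr_eq0.
have form0 : dual_form a a != 0.
  by rewrite ak (short_form k) // mulf_neq0 ?invr_eq0 ?pnatr_eq0.
have k14 : (k < 14)%N by move: k ks {ak}; apply/allP.
(* A short root has its own root vector in degree (0, 0); in the other degrees the block supplies an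
   octonion vector of the same weight. *)
have [d0|d0] := eqVneq (3 * mod3 m + mod3 n)%N 0%N.
  by apply: (realized k) => //; [lia|rewrite graded_degree0].
have [m3 n3] := (mod3_lt m, mod3_lt n).
have /hasP[i + /eqP wi] := allP short_oct_weight k ks; rewrite mem_iota => i7.
(* Blocks are numbered from 0, so block b has degree b+1. *)
set bl := (3 * mod3 m + mod3 n).-1%N; have b8 : (bl < 8)%N by rewrite /bl; move: m3 n3; clear; lia.
have i8 : (i < 8)%N by apply: ltn_trans i7 _.
apply: (realized (14 + 8 * bl + i)%N) => //; first by move: b8 i8; clear; lia.
  by rewrite graded_degree_block // prednK // lt0n.
by rewrite ak; apply: (root_of_eq ww simpleL chevL ga HP); rewrite graded_weight_block.
Qed.

End NonisotropicRoots.

Theorem mainTheorem8 (R : realType) (L : finLieType R[i])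
  (e f : 'I_6 -> L)
  (simpleL : simple_lie {:L})
  (chevL : chevalley_generators cartan_E6 {:L} e f)
  (alpha : 'I_6 -> dual (chevalley_cartan e f))
  (alpha_simple : forall i, weight_vector (alpha i) (e i))
  (theta : dual (chevalley_cartan e f))
  (theta_highest : highest_root alpha theta) :
  exists e_theta : L,
    [/\ e_theta != 0, weight_vector theta e_theta,
        exists! s0 : 'End(L), is_sigma0 e f e_theta s0,
        exists! s1 : 'End(L), is_sigma1 e f s1 &
        forall s0 s1 : 'End(L),
          is_sigma0 e f e_theta s0 -> is_sigma1 e f s1 ->
          let g_ := graded s0 s1 3 3 in
          [/\ automorphism_order s0 3 /\ automorphism_order s1 3,
              forall x, s0 (s1 x) = s1 (s0 x),
              simple_of_type cartan_G2 (g_ 0 0),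
              forall i j : nat, (i <= 2)%N -> (j <= 2)%N -> (i, j) != (0, 0)%N ->
                irr7_plus_trivial (g_ 0 0) (g_ i j) &
              forall H : {vspace L}, cartan_subalgebra (g_ 0 0) H ->
                nonisotropic_roots s0 s1 3 3 H = G2_33 (g_ 0 0) H]].
Proof.
have [theta35 B35] := highest_weight_vector (@omega_quadratic R) simpleL chevL alpha_simple theta_highest.
exists (B6 e f)`_35; split => //.
- exists (sigma0 (root_unity 3) e f); split; first exact: sigma0_spec.
  by move=> s /(sigma0_uniq simpleL chevL) ->.
- exists (sigma1 (root_unity 3) e f); split; first exact: sigma1_spec.
  by move=> s /(sigma1_uniq simpleL chevL) ->.
move=> s0 s1 /(sigma0_uniq simpleL chevL) -> /(sigma1_uniq simpleL chevL) -> g_.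
have U00 := graded00 simpleL chevL.
split.
- exact: sigma_orders.
- exact: sigma_comm.
- split; first exact: (U_simple (@omega_quadratic R) simpleL chevL U00).
  by do 2 eexists; exact: (U_chevalley (@omega_quadratic R) simpleL chevL U00).
- exact: graded_irr.
exact: nonisotropic_rootsE.
Qed.
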